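(* Let $X$ be a compact complex manifold, $(E,h)\to X$ a very ample hermitian holomorphic line bundle, and $-i\omega$ the curvature form of $h$. The dual Fubini--Study map $\Phi:\mathcal A_E\to\mathcal H_\omega$ is proper and injective, and the closure of $\mathrm{FS}(\mathcal H_E)$ in $\mathcal H_\omega$ is $\Phi(\mathcal A_E)$.
   Context: $\mathcal O(E)$ is the finite dimensional complex vector space of holomorphic sections of $E$, $\mathcal O(E)^*$ its dual. An inner product on a complex vector space means a hermitian symmetric sesquilinear form (linear in the first variable), not necessarily definite. $\mathcal H_E$ is the set of positive definite inner products on $\mathcal O(E)$; $\mathcal I_E$ is the finite dimensional real vector space of all inner products on $\mathcal O(E)^*$. The map $\delta$: given a subspace $V\subset\mathcal O(E)$ and a nondegenerate inner product $\langle\,,\rangle$ on $V$, $\delta(V,\langle\,,\rangle)=\langle\langle\,,\rangle\rangle\in\mathcal I_E$ is the pullback, under the restriction map $\mathcal O(E)^*\to V^*$, of the dual inner product on $V^*$; explicitly $\langle\langle\sigma,\tau\rangle\rangle=\langle s_\tau,s_\sigma\rangle$, where $s_\sigma\in V$ is determined by $\sigma(s)=\langle s,s_\sigma\rangle$ for all $s\in V$. This gives a bijection between such pairs $(V,\langle\,,\rangle)$ and $\mathcal I_E$. Bergman function: if $\langle\langle\,,\rangle\rangle=\delta(V,\langle\,,\rangle)$ is positive semidefinite (equivalently $\langle\,,\rangle$ is positive definite on $V$), its Bergman function is $\kappa(x)=\sum_j h(s_j(x),s_j(x))$, $x\in X$, for any orthonormal basis $(s_j)$ of $(V,\langle\,,\rangle)$.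 Rather ample: a subspace $V\subset\mathcal O(E)$ is rather ample if for every $x\in X$ and nonzero $v\in T^{1,0}_xX$ there are sections $s,t\in V$ such that $s(x)\ne0$ but $t$ vanishes at $x$, to first order in the direction $v$; i.e., writing $t=\psi e$ with a nonvanishing local holomorphic section $e$ of $E$ near $x$, $\psi(x)=0$ and $\partial\psi(v)\neq0$. $\mathcal A_E\subset\mathcal I_E$, with the subspace topology, is the set of positive semidefinite $\langle\langle\,,\rangle\rangle=\delta(V,\langle\,,\rangle)$ for which $V$ is rather ample. The dual Fubini--Study map is $\Phi(\langle\langle\,,\rangle\rangle)=\log\kappa$, where $\kappa$ is the Bergman function of $\langle\langle\,,\rangle\rangle\in\mathcal A_E$. $C^\infty(X)$ is the Fréchet space of smooth functions $X\to\mathbb R$; $\omega$ is the real $(1,1)$-form with $\omega=-i\partial\overline\partial\log h(e,e)$ for any nonvanishing local holomorphic section $e$ of $E$; $\mathcal H_\omega=\{u\in C^\infty(X):\omega+i\partial\overline\partial u>0\}$, an open subset of $C^\infty(X)$. For elements of $\mathcal A_E$ the Bergman function $\kappa$ is positive and $\log\kappa\in\mathcal H_\omega$. The Fubini--Study map $\mathrm{FS}:\mathcal H_E\to\mathcal H_\omega$ sends $\langle\,,\rangle$ to $\log\kappa$, where $\kappa(x)=\sup\{h(s(x),s(x))/\langle s,s\rangle:s\in\mathcal O(E)\setminus\{0\}\}$; it equals $\Phi\circ\delta(\mathcal O(E),\cdot)$.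
   Formalization: X is taken connected and of positive dimension: on a disconnected X the map Φ is never injective (κ does not see the mixed part of the form), and in dimension 0 the space V=0 is vacuously rather ample, so log κ is undefined. *)

(* Defs.v *)
From HB Require Import structures.
From mathcomp Require Import all_boot all_order all_algebra.
From mathcomp Require Import complex.
From mathcomp Require Import all_classical all_reals all_analysis.

Set Implicit Arguments.
Unset Strict Implicit.
Unset Printing Implicit Defensive.

Import Order.TTheory GRing.Theory Num.Theory numFieldNormedType.Exports.

Local Open Scope classical_set_scope.
Local Open Scope ring_scope.

(* Packing R[i] as a numClosedFieldType gives it the topology, the partial
   order (0 < z means that z is real and positive) and the conjugation of such
   a field. *)
Definition cplx (R : realType) : numClosedFieldType := R[i].

Definition re (R : realType) (z : cplx R) : R := complex.Re z.
Definition im (R : realType) (z : cplx R) : R := complex.Im z.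

(* C^n as the real normed space R^n * R^n: (x, y) stands for x + i y. *)
Definition Cn (R : realType) (n : nat) : normedModType R :=
  ('rV[R]_n * 'rV[R]_n)%type.

Section Calculus.
Variables (R : realType) (n : nat).
Local Notation C := (cplx R).
Local Notation Cn := (Cn R n).

Fixpoint iterD (vs : seq Cn) (f : Cn -> R) : Cn -> R :=
  if vs is v :: vs' then fun z => 'D_v (iterD vs' f) z else f.

(* C^oo on the open set W: all iterated directional derivatives exist and are
   continuous. *)
Definition smooth_on (W : set Cn) (f : Cn -> R) : Prop :=
  forall vs z, W z ->
    {for z, continuous (iterD vs f)} /\
    (forall v, derivable (iterD vs f) z v).

Definition pd (v : Cn) (f : Cn -> C) (z : Cn) : C :=
  Complex ('D_v (@re R \o f) z) ('D_v (@im R \o f) z).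

Definition e_re (j : 'I_n) : Cn := (delta_mx 0 j, 0).
Definition e_im (j : 'I_n) : Cn := (0, delta_mx 0 j).

Definition dz (j : 'I_n) (f : Cn -> C) (z : Cn) : C :=
  (pd (e_re j) f z - 'i * pd (e_im j) f z) / 2%:R.

Definition dzbar (j : 'I_n) (f : Cn -> C) (z : Cn) : C :=
  (pd (e_re j) f z + 'i * pd (e_im j) f z) / 2%:R.

Definition holomorphic_on (W : set Cn) (f : Cn -> C) : Prop :=
  [/\ smooth_on W (@re R \o f), smooth_on W (@im R \o f) &
      forall j z, W z -> dzbar j f z = 0].

Definition zcoord (j : 'I_n) (z : Cn) : C := Complex (z.1 0 j) (z.2 0 j).

(* coefficient matrix of d dbar f, i.e. of the form
   i d dbar f = i \sum_(j, k) a_jk dz_j /\ dzbar_k *)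
Definition ddbar (f : Cn -> R) (z : Cn) : 'M[C]_n :=
  \matrix_(j, k) dz j (dzbar k (fun w => Complex (f w) 0)) z.

Definition herm_posdef (A : 'M[C]_n) : Prop :=
  forall v : 'rV[C]_n, v != 0 ->
    0 < \sum_(j < n) \sum_(k < n) A j k * v 0 j * (v 0 k)^*.

Lemma iterD_lin (W : set Cn) (f g : Cn -> R) (a b : R) :
  open W -> smooth_on W f -> smooth_on W g ->
  forall vs z, W z ->
    iterD vs (a \*: f + b \*: g) z = a * iterD vs f z + b * iterD vs g z.
Proof.
move=> oW sf sg; elim=> [//|v vs IH] z Wz /=.
have [_ /(_ v) df] := sf vs z Wz; have [_ /(_ v) dg] := sg vs z Wz.
rewrite (@near_eq_derive _ _ _ _ (a \*: iterD vs f + b \*: iterD vs g)).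
  by rewrite deriveD ?deriveZ //; exact: derivableZ.
by near=> w; apply: IH; near: w; exact: open_nbhs_nbhs.
Unshelve. all: by end_near. Qed.

Lemma smooth_on_lin (W : set Cn) (f g : Cn -> R) (a b : R) :
  open W -> smooth_on W f -> smooth_on W g ->
  smooth_on W (a \*: f + b \*: g).
Proof.
move=> oW sf sg vs z Wz.
have [cf df] := sf vs z Wz; have [cg dg] := sg vs z Wz.
have E : {near z, a \*: iterD vs f + b \*: iterD vs g
                  =1 iterD vs (a \*: f + b \*: g)}.
  near=> w; rewrite (@iterD_lin W) //.
  by near: w; exact: open_nbhs_nbhs.
split=> [|v].
  rewrite /prop_for /continuous_at (@iterD_lin W) //.
  apply: cvg_trans; first exact: near_eq_cvg E.
  by apply: cvgD; apply: (@cvgZl_tmp R R^o).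
apply: near_eq_derivable E _.
by apply: derivableD; apply: derivableZ.
Unshelve. all: by end_near. Qed.

Lemma smooth_on_derivable W f z v :
  smooth_on W f -> W z -> derivable f z v.
Proof. by move=> sf Wz; have [_] := sf [::] z Wz; apply. Qed.

Lemma derivable_lin (f g : Cn -> R) (a b : R) z v :
  derivable f z v -> derivable g z v -> derivable (a \*: f + b \*: g) z v.
Proof. by move=> df dg; apply: derivableD; apply: derivableZ. Qed.

Lemma derive_lin (f g : Cn -> R) (a b : R) z v :
  derivable f z v -> derivable g z v ->
  'D_v (a \*: f + b \*: g) z = a * 'D_v f z + b * 'D_v g z.
Proof. by move=> df dg; rewrite deriveD ?deriveZ //; apply: derivableZ. Qed.

Lemma re_lin (a : C) (f g : Cn -> C) :
  @re R \o (fun w => a * f w + g w) =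
  (1 \*: (re a \*: (@re R \o f) + (- im a) \*: (@im R \o f))
   + 1 \*: (@re R \o g)).
Proof.
apply/funext => w; rewrite /re /im /=.
rewrite !fctE /= /GRing.scale /= !mul1r.
by case: a (f w) (g w) => [? ?] [? ?] [? ?] /=; rewrite mulNr.
Qed.

Lemma im_lin (a : C) (f g : Cn -> C) :
  @im R \o (fun w => a * f w + g w) =
  (1 \*: (re a \*: (@im R \o f) + im a \*: (@re R \o f))
   + 1 \*: (@im R \o g)).
Proof.
apply/funext => w; rewrite /re /im /=.
rewrite !fctE /= /GRing.scale /= !mul1r.
by case: a (f w) (g w) => [? ?] [? ?] [? ?] /=.
Qed.

Lemma pd_lin W (a : C) (f g : Cn -> C) v z :
  holomorphic_on W f -> holomorphic_on W g -> W z ->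
  pd v (fun w => a * f w + g w) z = a * pd v f z + pd v g z.
Proof.
move=> [rf mf _] [rg mg _] Wz.
have drf := @smooth_on_derivable _ _ z v rf Wz.
have dmf := @smooth_on_derivable _ _ z v mf Wz.
have drg := @smooth_on_derivable _ _ z v rg Wz.
have dmg := @smooth_on_derivable _ _ z v mg Wz.
rewrite /pd re_lin im_lin.
rewrite !derive_lin ?mul1r //; try exact: derivable_lin.
by case: a => a b; rewrite /re /im /= mulNr.
Qed.

Lemma holomorphic_on_lin W (a : C) (f g : Cn -> C) :
  open W -> holomorphic_on W f -> holomorphic_on W g ->
  holomorphic_on W (fun w => a * f w + g w).
Proof.
move=> oW hf hg; have [rf mf cf] := hf; have [rg mg cg] := hg.
split.
- by rewrite re_lin; do 2?apply: smooth_on_lin => //.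
- by rewrite im_lin; do 2?apply: smooth_on_lin => //.
- move=> j z Wz; rewrite /dzbar !(pd_lin a _ hf hg Wz).
  have := cf j z Wz; have := cg j z Wz; rewrite /dzbar => Eg Ef.
  transitivity (a * ((pd (e_re j) f z + 'i * pd (e_im j) f z) / 2%:R)
     + (pd (e_re j) g z + 'i * pd (e_im j) g z) / 2%:R).
    rewrite mulrA -mulrDl; congr (_ / _).
    by rewrite !mulrDr !addrA mulrCA; congr (_ + _); rewrite -!addrA;
       congr (_ + _); rewrite addrC.
  by rewrite Ef Eg mulr0 addr0.
Qed.

Lemma holomorphic_on0 W : holomorphic_on W (fun=> 0).
Proof.
have s0 : smooth_on W (fun=> 0).
  have i0 vs : iterD vs (fun=> 0) = (fun=> 0).
    elim: vs => //= v vs ->; apply/funext => z; exact: derive_cst.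
  by move=> vs z _; rewrite i0; split => [|v]; [exact: cvg_cst|
     exact: derivable_cst].
split=> [||j z Wz]; [exact: s0|exact: s0|].
rewrite /dzbar /pd (_ : @re R \o _ = cst 0) // (_ : @im R \o _ = cst 0) //.
by rewrite !derive_cst (_ : Complex 0 0 = 0 :> C) // mulr0 addr0 mul0r.
Qed.

End Calculus.

(* A holomorphic atlas on X; [chart_of c] is the inverse of the chart
   [chart_to c : chart_dom c -> chart_cod c]. *)
Record complex_atlas (R : realType) (X : topologicalType) (n : nat) := {
  chart : Type;
  chart_dom : chart -> set X;
  chart_cod : chart -> set (Cn R n);
  chart_to : chart -> X -> Cn R n;
  chart_of : chart -> Cn R n -> X;
  chart_dom_open : forall c, open (chart_dom c);
  chart_cod_open : forall c, open (chart_cod c);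
  chart_to_cod : forall c x, chart_dom c x -> chart_cod c (chart_to c x);
  chart_of_dom : forall c z, chart_cod c z -> chart_dom c (chart_of c z);
  chart_toK : forall c x, chart_dom c x -> chart_of c (chart_to c x) = x;
  chart_ofK : forall c z, chart_cod c z -> chart_to c (chart_of c z) = z;
  chart_to_continuous : forall c, {in chart_dom c, continuous (chart_to c)};
  chart_of_continuous : forall c, {in chart_cod c, continuous (chart_of c)};
  chart_cover : forall x, exists c, chart_dom c x;
  chart_compat : forall c c' j,
    holomorphic_on (chart_cod c `&` chart_of c @^-1` chart_dom c')
      (fun z => zcoord j (chart_to c' (chart_of c z)))
}.

Section Manifold.
Variables (R : realType) (X : topologicalType) (n : nat).
Variable M : complex_atlas R X n.
Local Notation C := (cplx R).
Local Notation Cn := (Cn R n).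

Definition hol_on (U : set X) (f : X -> C) : Prop :=
  forall c : chart M, holomorphic_on (chart_cod c `&` chart_of c @^-1` U)
                        (f \o chart_of c).

Definition csmooth_on (U : set X) (u : X -> R) : Prop :=
  forall c : chart M, smooth_on (chart_cod c `&` chart_of c @^-1` U)
                        (u \o chart_of c).

(* d f (v) at x, where v in T^{1,0}_x X has coordinates v in the chart c *)
Definition dhol (c : chart M) (v : 'rV[C]_n) (f : X -> C) (x : X) : C :=
  \sum_(j < n) dz j (f \o chart_of c) (chart_to c x) * v 0 j.

(* A (1,1)-form i \sum_(j, k) a_jk dz_j /\ dzbar_k, given by its coefficient
   matrix in each chart; only the values on [chart_cod c] matter. *)
Definition form11 := forall c : chart M, Cn -> 'M[C]_n.

Lemma open_chart_pre (c : chart M) (U : set X) :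
  open U -> open (chart_cod c `&` chart_of c @^-1` U).
Proof.
move=> oU; rewrite openE => z [cz Uz]; rewrite /interior.
apply: filterI; first by apply: open_nbhs_nbhs; split=> //; exact: chart_cod_open.
have := @chart_of_continuous _ _ _ M c z; rewrite inE => /(_ cz); apply.
exact: open_nbhs_nbhs.
Qed.

(* The jets of u in the charts; the topology of [cinfty] is the one of uniform
   convergence of all iterated derivatives on the compact subsets of the
   charts.  It induces the Frechet topology on the subset of smooth functions,
   and it is only ever used on subsets of it. *)
Definition jets (u : X -> R) :
    prod_topology (fun k : chart M * seq Cn =>
      {family [set K : set Cn | compact K /\ K `<=` chart_cod k.1], Cn -> R}) :=
  fun k => iterD k.2 (u \o chart_of k.1).

Definition cinfty : topologicalType := initial_topology jets.

End Manifold.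

(* The fibers are the lines [fiber x]; the holomorphic structure is given by
   local frames with holomorphic transition functions. *)
Record line_bundle (R : realType) (X : topologicalType) (n : nat)
    (M : complex_atlas R X n) := {
  fiber : X -> lmodType (cplx R);
  frame_idx : Type;
  frame_dom : frame_idx -> set X;
  frame : frame_idx -> forall x, fiber x;
  frame_dom_open : forall i, open (frame_dom i);
  frame_cover : forall x, exists i, frame_dom i x;
  frame_neq0 : forall i x, frame_dom i x -> frame i x != 0;
  frame_span : forall i x, frame_dom i x ->
    forall w : fiber x, exists a : cplx R, w = a *: frame i x;
  frame_trans : forall i j, exists2 g : X -> cplx R,
    hol_on M (frame_dom i `&` frame_dom j) g &
    forall x, frame_dom i x -> frame_dom j x -> frame j x = g x *: frame i x
}.

Section Sections.
Variables (R : realType) (X : topologicalType) (n : nat).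
Variables (M : complex_atlas R X n) (E : line_bundle M).
Local Notation C := (cplx R).

Definition hol_section_on (U : set X) (s : forall x, fiber E x) : Prop :=
  forall i : frame_idx E, exists2 f : X -> C,
    hol_on M (U `&` frame_dom i) f &
    forall x, U x -> frame_dom i x -> s x = f x *: frame i x.

(* e is a nonvanishing holomorphic section of E over the open set U *)
Definition local_frame (U : set X) (e : forall x, fiber E x) : Prop :=
  [/\ open U, hol_section_on U e & forall x, U x -> e x != 0].

(* the space O(E) *)
Record hsec := HSec {
  hsec_val :> forall x, fiber E x;
  hsecP : hol_section_on setT hsec_val
}.

HB.instance Definition _ := gen_eqMixin hsec.
HB.instance Definition _ := gen_choiceMixin hsec.

Lemma hsec_inj (s t : hsec) : (forall x, s x = t x) -> s = t.
Proof.
move: s t => [s sP] [t tP] /= st.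
have Est : s = t by apply: functional_extensionality_dep.
by move: sP tP; rewrite Est => sP tP; congr HSec; exact: Prop_irrelevance.
Qed.

Lemma hol_section_lin (a : C) (s t : hsec) :
  hol_section_on setT (fun x => a *: s x + t x).
Proof.
move=> i; have [f hf Ef] := hsecP s i; have [g hg Eg] := hsecP t i.
exists (fun x => a * f x + g x) => [c|x Ux ix].
  apply: (@holomorphic_on_lin _ _ _ a (f \o chart_of c) (g \o chart_of c)).
  - apply: open_chart_pre; rewrite setTI; exact: frame_dom_open.
  - exact: hf.
  - exact: hg.
by rewrite Ef // Eg // scalerA scalerDl.
Qed.

Lemma hol_section0 : hol_section_on setT (fun x : X => 0 : fiber E x).
Proof.
move=> i; exists (fun=> 0) => [c|x _ _]; last by rewrite scale0r.
exact: holomorphic_on0.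
Qed.

Definition hsec0 : hsec := HSec hol_section0.
Definition hsec_lin (a : C) (s t : hsec) : hsec := HSec (hol_section_lin a s t).
Definition hsec_add (s t : hsec) : hsec := hsec_lin 1 s t.
Definition hsec_opp (s : hsec) : hsec := hsec_lin (-1) s hsec0.
Definition hsec_scale (a : C) (s : hsec) : hsec := hsec_lin a s hsec0.

Lemma hsec_addA : associative hsec_add.
Proof. by move=> s t u; apply: hsec_inj => x /=; rewrite !scale1r addrA. Qed.
Lemma hsec_addC : commutative hsec_add.
Proof. by move=> s t; apply: hsec_inj => x /=; rewrite !scale1r addrC. Qed.
Lemma hsec_add0 : left_id hsec0 hsec_add.
Proof. by move=> s; apply: hsec_inj => x /=; rewrite scale1r add0r. Qed.
Lemma hsec_addN : left_inverse hsec0 hsec_opp hsec_add.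
Proof.
by move=> s; apply: hsec_inj => x /=; rewrite scale1r addr0 scaleN1r addNr.
Qed.

HB.instance Definition _ :=
  GRing.isZmodule.Build hsec hsec_addA hsec_addC hsec_add0 hsec_addN.

Lemma hsec_scaleA (a b : C) (s : hsec) :
  hsec_scale a (hsec_scale b s) = hsec_scale (a * b) s.
Proof. by apply: hsec_inj => x /=; rewrite !addr0 scalerA. Qed.
Lemma hsec_scale1 : left_id 1 hsec_scale.
Proof. by move=> s; apply: hsec_inj => x /=; rewrite addr0 scale1r. Qed.
Lemma hsec_scaleDr : right_distributive hsec_scale +%R.
Proof.
by move=> a s t; apply: hsec_inj => x /=; rewrite !addr0 !scale1r scalerDr.
Qed.
Lemma hsec_scaleDl (s : hsec) : {morph hsec_scale^~ s : a b / a + b}.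
Proof.
by move=> a b; apply: hsec_inj => x /=; rewrite !addr0 !scale1r scalerDl.
Qed.

HB.instance Definition _ := GRing.Zmodule_isLmodule.Build C hsec
  hsec_scaleA hsec_scale1 hsec_scaleDr hsec_scaleDl.

End Sections.

Record hermitian_metric (R : realType) (X : topologicalType) (n : nat)
    (M : complex_atlas R X n) (E : line_bundle M) := {
  herm :> forall x, fiber E x -> fiber E x -> cplx R;
  herm_linear : forall x a (u v w : fiber E x),
    herm (a *: u + v) w = a * herm u w + herm v w;
  herm_sym : forall x (u v : fiber E x), herm v u = (herm u v)^*;
  herm_gt0 : forall x (u : fiber E x), u != 0 -> 0 < herm u u;
  herm_smooth : forall i : frame_idx E,
    csmooth_on M (frame_dom i)
      (fun x => re (herm (frame i x) (frame i x)))
}.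
Arguments herm {R X n M E} h x : rename.

Definition dual (R : realType) (W : lmodType (cplx R)) : Type :=
  {linear W -> (cplx R)^o}.

Section Dual.
Variables (R : realType) (W : lmodType (cplx R)).
Local Notation C := (cplx R).
Local Notation D := (dual W).

Definition dual_fun (s : D) : W -> C := fun w => (s : {linear W -> C^o}) w.

HB.instance Definition _ := Choice.copy (dual W) {linear W -> C^o}.

Lemma dual_inj (s t : D) : dual_fun s =1 dual_fun t -> s = t.
Proof.
move: s t => [s [[sB] [sZ]]] [t [[tB] [tZ]]] /= st.
have Est : s = t by apply/funext => w; exact: st.
move: sB sZ tB tZ {st}; rewrite {}Est => sB sZ tB tZ.
by rewrite (Prop_irrelevance sB tB) (Prop_irrelevance sZ tZ).
Qed.

Definition dual0 : D := (\0 : {linear W -> C^o}).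
Definition dual_add (s t : D) : D :=
  ((s : {linear W -> C^o}) \+ (t : {linear W -> C^o}) : {linear W -> C^o}).
Definition dual_opp (s : D) : D :=
  (\- (s : {linear W -> C^o}) : {linear W -> C^o}).
Definition dual_scale (a : C) (s : D) : D :=
  (a \*: (s : {linear W -> C^o}) : {linear W -> C^o}).

Lemma dual_addA : associative dual_add.
Proof. by move=> s t u; apply: dual_inj => w; exact: addrA. Qed.
Lemma dual_addC : commutative dual_add.
Proof. by move=> s t; apply: dual_inj => w; exact: addrC. Qed.
Lemma dual_add0 : left_id dual0 dual_add.
Proof. by move=> s; apply: dual_inj => w; exact: add0r. Qed.
Lemma dual_addN : left_inverse dual0 dual_opp dual_add.
Proof. by move=> s; apply: dual_inj => w; exact: addNr. Qed.

HB.instance Definition _ :=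
  GRing.isZmodule.Build (dual W) dual_addA dual_addC dual_add0 dual_addN.

Lemma dual_scaleA (a b : C) (s : D) :
  dual_scale a (dual_scale b s) = dual_scale (a * b) s.
Proof. by apply: dual_inj => w; exact: mulrA. Qed.
Lemma dual_scale1 : left_id 1 dual_scale.
Proof. by move=> s; apply: dual_inj => w; exact: mul1r. Qed.
Lemma dual_scaleDr : right_distributive dual_scale +%R.
Proof. by move=> a s t; apply: dual_inj => w; exact: mulrDr. Qed.
Lemma dual_scaleDl (s : D) : {morph dual_scale^~ s : a b / a + b}.
Proof. by move=> a b; apply: dual_inj => w; exact: mulrDl. Qed.

HB.instance Definition _ := GRing.Zmodule_isLmodule.Build C (dual W)
  dual_scaleA dual_scale1 dual_scaleDr dual_scaleDl.

End Dual.
Coercion dual_fun : dual >-> Funclass.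

Section InnerProducts.
Variables (R : realType) (W : lmodType (cplx R)).
Local Notation C := (cplx R).
Implicit Types (V : set W) (ip : W -> W -> C).

Definition subspace V : Prop :=
  V 0 /\ forall (a : C) u v, V u -> V v -> V (a *: u + v).

(* ip restricts to a hermitian symmetric sesquilinear form on V; its values
   outside V are irrelevant *)
Definition inner_product V ip : Prop :=
  (forall (a : C) u v w, V u -> V v -> V w ->
     ip (a *: u + v) w = a * ip u w + ip v w) /\
  (forall u v, V u -> V v -> ip v u = (ip u v)^*).

Definition nondegenerate V ip : Prop :=
  forall u, V u -> (forall v, V v -> ip u v = 0) -> u = 0.

Definition posdef V ip : Prop := forall u, V u -> u != 0 -> 0 < ip u u.

Definition possemidef V ip : Prop := forall u, V u -> 0 <= ip u u.

Definition orthonormal_basis V ip (m : nat) (s : 'I_m -> W) : Prop :=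
  [/\ forall i, V (s i),
      forall i j, ip (s i) (s j) = (i == j)%:R &
      forall u, V u -> exists a : 'I_m -> C, u = \sum_(i < m) a i *: s i].

(* the vector of V that represents the restriction of sigma to V *)
Definition riesz V ip (sigma : dual W) : W :=
  xget 0 [set s | V s /\ forall u, V u -> sigma u = ip u s].

Definition delta V ip : dual W -> dual W -> C :=
  fun sigma tau => ip (riesz V ip tau) (riesz V ip sigma).

(* Forms on the dual, with the topology of pointwise convergence: on the
   hermitian forms on a finite dimensional dual it induces the usual topology
   of a finite dimensional real vector space. *)
Definition dual_forms : topologicalType :=
  {ptws dual W -> {ptws dual W -> C}}.

End InnerProducts.

(* the space I_E, for W = O(E) *)
Definition dual_inner_products (R : realType) (W : lmodType (cplx R)) :
    set (dual_forms W) :=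
  [set G : dual_forms W | inner_product setT (G : dual W -> dual W -> cplx R)].

Section FubiniStudy.
Variables (R : realType) (X : topologicalType) (n : nat).
Variables (M : complex_atlas R X n) (E : line_bundle M).
Variable h : hermitian_metric E.
Local Notation C := (cplx R).
Local Notation OE := (hsec E).

(* The point of P(O(E)^* ) attached to x: the space of the functionals that
   factor through the evaluation at x, which is a line as soon as some section
   does not vanish at x. *)
Definition kodaira (x : X) : set (dual OE) :=
  [set sigma | exists l : {linear fiber E x -> C^o},
                 forall s : OE, sigma s = l (s x)].

(* The map [kodaira : X -> P(O(E)^* )] is defined everywhere and is an
   injective immersion, hence an embedding when X is compact.  In a local frame
   e, it lifts to the map that sends x to the functional s |-> f s x, where
   s = f s * e; the differential of the induced map to the projective space is
   injective when it sends no nonzero v to a multiple of the lift itself. *)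
Definition very_ample : Prop :=
  [/\ forall x, exists s : OE, s x != 0,
      injective kodaira &
      forall (c : chart M) x U e (f : OE -> X -> C) (v : 'rV[C]_n),
        chart_dom c x -> U x -> local_frame U e ->
        (forall (s : OE) y, U y -> s y = f s y *: e y) ->
        v != 0 ->
        ~ exists a : C, forall s : OE, dhol c v (f s) x = a * f s x].

Definition rather_ample (V : set OE) : Prop :=
  forall (x : X) (c : chart M) (v : 'rV[C]_n), chart_dom c x -> v != 0 ->
    exists s t : OE,
      [/\ V s, V t, s x != 0 &
          exists U e (psi : X -> C),
            [/\ local_frame U e, U x,
                forall y, U y -> t y = psi y *: e y,
                psi x = 0 & dhol c v psi x != 0]].

(* omega = - i d dbar log h(e, e) for every local frame e; equivalently,
   - i omega is the curvature form of h. *)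
Definition curvature (omega : form11 M) : Prop :=
  forall (c : chart M) U e z, local_frame U e ->
    chart_cod c z -> U (chart_of c z) ->
    omega c z =
      - ddbar (fun w => let x := chart_of c w in ln (re (h x (e x) (e x)))) z.

Definition H_omega (omega : form11 M) : set (cinfty M) :=
  [set u : X -> R | csmooth_on M setT u /\
    forall (c : chart M) z, chart_cod c z ->
      herm_posdef (omega c z + ddbar (u \o chart_of c) z)].

Definition A_E : set (dual_forms OE) :=
  [set G : dual_forms OE | [/\ dual_inner_products G, possemidef setT (G : dual OE -> dual OE -> C) &
    exists V ip, [/\ subspace V, inner_product V ip, nondegenerate V ip,
                     G = delta V ip & rather_ample V]]].

Definition is_bergman (G : dual_forms OE) (kappa : X -> R) : Prop :=
  exists V ip m (s : 'I_m -> OE),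
    [/\ subspace V, inner_product V ip, posdef V ip, G = delta V ip &
        orthonormal_basis V ip s /\
        forall x, kappa x = \sum_(j < m) re (h x (s j x) (s j x))].

(* the kappa such that [is_bergman G kappa], if G is positive semidefinite *)
Definition bergman (G : dual_forms OE) : X -> R :=
  xget (fun=> 0) [set kappa | is_bergman G kappa].

Definition Phi (G : dual_forms OE) : cinfty M := fun x => ln (bergman G x).

Definition H_E : set (OE -> OE -> C) :=
  [set ip | inner_product setT ip /\ posdef setT ip].

Definition FS (ip : OE -> OE -> C) : cinfty M :=
  fun x => ln (sup [set re (h x (s x) (s x) / ip s s)
                     | s in [set s : OE | s != 0]]).

End FubiniStudy.

(* properness of f as a map from A to B, both with the subspace topology *)
Definition proper_map (S T : topologicalType) (A : set S) (B : set T)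
    (f : S -> T) : Prop :=
  [/\ {within A, continuous f}, f @` A `<=` B &
      forall K : set T, K `<=` B -> compact K -> compact (A `&` f @^-1` K)].

(* Main.v *)
From HB Require Import structures.
From mathcomp Require Import all_boot all_order all_algebra.
From mathcomp Require Import complex finmap.
From mathcomp Require Import all_classical all_reals all_analysis.
From mathcomp Require Import ring lra.
Require Import Defs.
Set Implicit Arguments.
Unset Strict Implicit.
Unset Printing Implicit Defensive.
Import Order.TTheory GRing.Theory Num.Theory numFieldNormedType.Exports.
Local Open Scope classical_set_scope.
Local Open Scope ring_scope.

(** Once a frame is chosen at x, evaluation at x is a functional ev_x on O(E),
    and the Bergman function of a positive semidefinite form G on O(E)^* is
    kappa(x) = |frame|^2 G(ev_x, ev_x) (form_kappa, nf_bergman): it depends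
    linearly on G.  Moreover G has a normal form
    G(sigma, tau) = sum_k sigma(s_k) conj(tau(s_k)) with independent s_k
    (psd_normal_form); then V is the span of the s_k and, in a local frame,
    log kappa is log h(e, e) + log sum_k |f_k|^2.  The curvature of h cancels
    the first summand, so omega + i d dbar log kappa is the pulled back
    Fubini-Study form i d dbar log sum_k |f_k|^2.  In the direction v its value
    is S^-3 sum_k |S df_k(v) - c f_k|^2, with S = sum_k |f_k|^2 and
    c = sum_k df_k(v) conj(f_k), which is positive exactly when some
    combination of the f_k vanishes at the point but has nonzero derivative
    along v (levi_gt0P).  Hence, when kappa > 0, log kappa is in H_omega if and
    only if V is rather ample (nf_levi_gt0, nf_rather_ample).  This equivalence
    is what identifies limits: a semidefinite form whose kappa is exp u with u
    in H_omega is automatically in A_E (bergman_H_omega).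

    Finite dimension of O(E) follows from compactness of X by the argument of
    Siegel and Serre: a section all of whose 2-jets vanish at the centres of
    finitely many small balls covering X is small, by the Schwarz lemma,
    compared with its own maximum, so it is zero (sections_finite_dim).  The
    Schwarz lemma itself is proved on complex lines, from a maximum principle
    on annuli.

    Injectivity: if kappa is the same for two forms, their difference D
    satisfies sum_ij D_ij f_i conj(f_j) = 0 on a chart.  Holomorphic and
    antiholomorphic derivatives can be taken independently (polarize_jets), so
    the jets separate, and unique continuation on the connected X
    (section_jets_eq0) gives D = 0.

    Continuity: in charts log kappa is the logarithm of a sum of smooth
    functions of z with coefficients continuous in G, so all its derivatives
    are jointly continuous in (G, z), and hence converge uniformly on compact
    sets (Phi_continuous).

    Properness and closure: along an ultrafilter of semidefinite forms for
    which kappa converges pointwise, the numbers G(ev_x, ev_y) stay bounded by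
    the Cauchy-Schwarz inequality, hence converge; the ev_x span O(E)^*
    (ev_span), so G converges (ultra_form_limit).  By the equivalence above the
    limit lies in A_E as soon as the limit of log kappa lies in H_omega
    (A_E_ultra_limit).  Properness follows, and so does the inclusion of the
    closure of FS(H_E) in Phi(A_E).  Conversely, adding to a form of A_E a
    small multiple of a definite one gives a definite form, that is, one that
    comes from H_E (definite_form_FS), and the sum converges to the given form.
*)

(** * Directional derivatives along lines *)

Section LineCalculus.
Variables (R : realType) (V : normedModType R).
Implicit Types (f g : V -> R) (v w z : V).

Lemma subr_swap (a b c d : R) : a - b - (c - d) = a - c - (b - d).
Proof. ring. Qed.

Lemma close_half (a b m e : R) :
  `|a - m| < e / 2 -> `|b - m| < e / 2 -> `|a - b| < e.
Proof.
move=> am bm; apply: (le_lt_trans (ler_distD m _ _)).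
by rewrite (distrC m b); move: am bm; lra.
Qed.

Lemma is_derive_line f z v (t d : R) :
  is_derive (t *: v + z) v f d <-> is_derive t 1 (fun s : R => f (s *: v + z)) d.
Proof.
have E : (fun h : R => h^-1 *: ((f \o shift (t *: v + z)) (h *: v) - f (t *: v + z)))
  = (fun h : R => h^-1 *: (((fun s : R => f (s *: v + z)) \o shift t) (h *: 1)
      - f (t *: v + z))).
  by apply/funext => h /=; rewrite scaler1 scalerDl addrA.
split=> -[df <-].
  by split; [rewrite /derivable -E|rewrite /derive -E].
by split; [rewrite /derivable E|rewrite /derive E].
Qed.

Lemma derivable_line f z v (t : R) :
  derivable f (t *: v + z) v ->
  is_derive t 1 (fun s : R => f (s *: v + z)) ('D_v f (t *: v + z)).
Proof. by move=> df; apply/is_derive_line; exact: derivableP. Qed.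

Lemma line_MVT f z v (a : R) : 0 < a ->
  (forall t, 0 <= t <= a -> derivable f (t *: v + z) v) ->
  exists2 c, 0 < c < a & f (a *: v + z) - f z = a * 'D_v f (c *: v + z).
Proof.
move=> a0 df.
have [||c cI E] := @MVT R (fun s : R => f (s *: v + z))
  (fun s : R => 'D_v f (s *: v + z)) 0 a a0.
- move=> t; rewrite in_itv /= => /andP[t0 ta]; apply: derivable_line.
  by apply: df; rewrite !ltW.
- apply: derivable_within_continuous => t; rewrite in_itv /= => ta.
  by have [] := derivable_line (df t ta).
exists c; first by move: cI; rewrite in_itv.
by rewrite mulrC -[X in _ * X]subr0 -E scale0r add0r.
Qed.

(** The increment may have either sign, so that difference quotients in the
    punctured neighbourhood of 0 can be handled without splitting it. *)
Lemma line_MVT_abs f z v (a : R) :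
  (forall t, `|t| <= `|a| -> derivable f (t *: v + z) v) ->
  exists2 c, `|c| <= `|a| & f (a *: v + z) - f z = a * 'D_v f (c *: v + z).
Proof.
move=> df; have [a0|a0|->] := ltgtP a 0; last first.
- by exists 0; rewrite ?scale0r ?add0r ?subrr ?mul0r.
- have [t /andP[t0 ta]|c /andP[c0 ca] E] := @line_MVT f z v a a0.
    by apply: df; rewrite !ger0_norm // ltW.
  by exists c => //; rewrite !gtr0_norm // ltW.
- have E0 : a *: v + z + (- a) *: v = z by rewrite scaleNr addrAC addrN add0r.
  have [t /andP[t0 ta]|c /andP[c0 ca] E] := @line_MVT f (a *: v + z) v (- a) (etrans (oppr_gt0 a) a0).
  + rewrite addrA -scalerDl; apply: df.
    by rewrite [leRHS]ltr0_norm // ler0_norm; lra.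
  + exists (c + a); first by rewrite [leRHS]ltr0_norm // ler0_norm; lra.
    move: E; rewrite [_ + (a *: v + z)]addrC E0 addrA -scalerDl => E.
    by rewrite -opprB E mulNr opprK.
Qed.

Lemma near_shift_line z v w (A : set V) : nbhs z A ->
  exists2 e : R, 0 < e & forall s t : R, `|s| <= e -> `|t| <= e ->
    A (s *: v + t *: w + z).
Proof.
move=> /nbhs_ballP[e /= e0 eA].
pose d := (`|v| + `|w| + 1).
have d0 : 0 < d by rewrite /d; have := normr_ge0 v; have := normr_ge0 w; lra.
exists (e / (2 * d)); first by rewrite divr_gt0 // mulr_gt0.
move=> s t se te; apply: eA.
rewrite -ball_normE /ball_ /= distrC addrK.
apply: (le_lt_trans (ler_normD _ _)); rewrite !normrZ.
have h2 : `|s| * `|v| <= e / (2 * d) * `|v| by apply: ler_wpM2r.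
have h3 : `|t| * `|w| <= e / (2 * d) * `|w| by apply: ler_wpM2r.
apply: (le_lt_trans (lerD h2 h3)); rewrite -mulrDr.
have : e / (2 * d) * (`|v| + `|w|) < e / (2 * d) * d.
  by rewrite ltr_pM2l ?divr_gt0 ?mulr_gt0 // /d; lra.
move=> /lt_le_trans; apply.
rewrite -mulrA invfM -[_ / d * d]mulrA mulVf ?gt_eqF // mulr1; lra.
Qed.

(** Directional derivatives are not additive in the direction in general. Here
    the increment along v + w is cut into one along v, which is handled by
    differentiability at z alone, and one along w, to which the mean value
    theorem applies; continuity of the derivative along w makes the latter
    converge. *)
Lemma is_deriveDv f z v w :
  derivable f z v -> (\forall y \near z, derivable f y w) ->
  {for z, continuous (fun y => 'D_w f y)} ->
  is_derive z (v + w) f ('D_v f z + 'D_w f z).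
Proof.
move=> dv dw cw.
suff H : (fun h : R => h^-1 *: ((f \o shift z) (h *: (v + w)) - f z)) @ 0^' -->
    'D_v f z + 'D_w f z.
  by split; [apply/cvg_ex; eexists; exact: H|exact: cvg_lim H].
apply/cvgrPdist_lt => e e0.
have e20 : 0 < e / 2 by rewrite divr_gt0.
have /cvgrPdist_lt/(_ _ e20) H1 : (fun h : R => h^-1 *: ((f \o shift z) (h *: v) - f z))
  @ 0^' --> 'D_v f z by exact: dv.
have H2 : \forall y \near z, derivable f y w /\ `|'D_w f z - 'D_w f y| < e / 2.
  by apply: filterI => //; move/cvgrPdist_lt : cw => /(_ _ e20).
have [d d0 dA] := @near_shift_line z v w _ H2.
near=> h.
have hd : `|h| <= d.
  near: h; exact: dnbhs0_le.
have h0 : h != 0 by near: h; exact: nbhs_dnbhs_neq.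
have [t th|c ch E] := @line_MVT_abs f (h *: v + z) w h.
  have [//|] := dA h t hd _; first exact: le_trans th hd.
  by rewrite -addrA addrCA.
have -> : h^-1 *: ((f \o shift z) (h *: (v + w)) - f z) =
    h^-1 *: ((f \o shift z) (h *: v) - f z) + 'D_w f (c *: w + (h *: v + z)).
  have -> : (f \o shift z) (h *: (v + w)) = f (h *: w + (h *: v + z)).
    by rewrite /= scalerDr addrA [h *: w + _]addrC.
  have -> : f (h *: w + (h *: v + z)) = h * 'D_w f (c *: w + (h *: v + z)) + f (h *: v + z).
    by rewrite -E subrK.
  rewrite /=; move: ('D_w f _) (f (h *: v + z)) (f z) => p q s.
  by rewrite -[LHS]/(h^-1 * _) -[h^-1 *: _]/(h^-1 * _); field.
rewrite opprD addrACA; apply: (le_lt_trans (ler_normD _ _)).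
rewrite (splitr e); apply: ltrD; first by near: h.
have [//|_] := dA h c hd _; first exact: le_trans ch hd.
by rewrite -addrA addrCA.
Unshelve. all: by end_near. Qed.

Lemma derive_mulv f z v (a : R) : derivable f z v ->
  is_derive z (a *: v) f (a * 'D_v f z).
Proof.
move=> df; have := @is_derive_line f z (a *: v) 0 (a * 'D_v f z).
rewrite scale0r add0r => ->.
have E : (fun s : R => f (s *: (a *: v) + z)) = (fun t : R => f (t *: v + z)) \o (fun s : R => s * a).
  by apply/funext => s /=; rewrite scalerA.
rewrite E.
have da : is_derive (0:R) 1 (fun s : R => s * a) a.
  have -> : (fun s : R => s * a) = a *: id by apply/funext => s /=; rewrite mulrC.
  by apply: is_derive_eq; rewrite /GRing.scale /= mulr1.
have db : is_derive ((fun s : R => s * a) 0) 1 (fun t : R => f (t *: v + z)) ('D_v f z).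
  by rewrite mul0r; apply/is_derive_line; rewrite scale0r add0r; exact: derivableP.
by have := @is_derive1_comp _ _ (fun s : R => s * a) _ _ _ db da; rewrite mulrC.
Qed.

Lemma is_derive_shift_fun f u z v d :
  is_derive z v (fun y => f (u + y)) d <-> is_derive (u + z) v f d.
Proof.
have E : (fun h : R => h^-1 *: (((fun y => f (u + y)) \o shift z) (h *: v) - f (u + z)))
  = (fun h : R => h^-1 *: ((f \o shift (u + z)) (h *: v) - f (u + z))).
  by apply/funext => h /=; rewrite addrCA.
split=> -[df <-].
  by split; [rewrite /derivable -E|rewrite /derive -E].
by split; [rewrite /derivable E|rewrite /derive E].
Qed.

(** Symmetry of second derivatives. The double difference of f over a small
    parallelogram is evaluated by the mean value theorem in the two possible
    orders; this gives values of both mixed derivatives at two nearby points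
    which coincide, and continuity does the rest. *)
Lemma derive_comm f z v w :
  (\forall y \near z, [/\ derivable f y v, derivable f y w,
     derivable ('D_v f) y w & derivable ('D_w f) y v]) ->
  {for z, continuous ('D_w ('D_v f))} -> {for z, continuous ('D_v ('D_w f))} ->
  'D_w ('D_v f) z = 'D_v ('D_w f) z.
Proof.
move=> D c1 c2; apply/eqP; rewrite -subr_eq0 -normr_le0 leNgt; apply/negP.
set e := `| _ - _ | => e0.
have e20 : 0 < e / 2 by rewrite divr_gt0.
have /cvgrPdist_lt/(_ _ e20) {}c1 := c1.
have /cvgrPdist_lt/(_ _ e20) {}c2 := c2.
have [h h0 hA] := @near_shift_line z v w _ (filterI D (filterI c1 c2)).
have hN t : `|t| <= `|h| -> `|t| <= h by rewrite (gtr0_norm (x := h)).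
have hh : `|h| <= h by rewrite gtr0_norm.
have h00 : `|0 : R| <= h by rewrite normr0 ltW.
have [t /hN th|c /hN ch E1] :=
    @line_MVT_abs (fun y => f (h *: w + y) - f y) z v h.
  apply: derivableB.
    have [[d1 _ _ _] _] := hA t h th hh; apply: (ex_derive (df := _)).
    apply/is_derive_shift_fun; rewrite addrCA addrA; exact: derivableP.
  have [[d1 _ _ _] _] := hA t 0 th h00.
  by move: d1; rewrite scale0r addr0.
have [t /hN th|d /hN dh E2] :=
    @line_MVT_abs (fun y => f (h *: v + y) - f y) z w h.
  apply: derivableB.
    have [[_ d1 _ _] _] := hA h t hh th; apply: (ex_derive (df := _)).
    apply/is_derive_shift_fun; rewrite addrA; exact: derivableP.
  have [[_ d1 _ _] _] := hA 0 t h00 th.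
  by move: d1; rewrite scale0r add0r.
have D1 : 'D_v (fun y => f (h *: w + y) - f y) (c *: v + z) =
    'D_v f (h *: w + (c *: v + z)) - 'D_v f (c *: v + z).
  have [[d1 _ _ _] _] := hA c h ch hh.
  have [[d2 _ _ _] _] := hA c 0 ch h00; rewrite scale0r addr0 in d2.
  rewrite -addrA addrCA in d1.
  have [d3 e3] := (is_derive_shift_fun _ _ _ _ _).2 (derivableP d1).
  by rewrite (deriveB d3 d2) e3.
have D2 : 'D_w (fun y => f (h *: v + y) - f y) (d *: w + z) =
    'D_w f (h *: v + (d *: w + z)) - 'D_w f (d *: w + z).
  have [[_ d1 _ _] _] := hA h d hh dh.
  have [[_ d2 _ _] _] := hA 0 d h00 dh; rewrite scale0r add0r in d2.
  rewrite -addrA in d1.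
  have [d3 e3] := (is_derive_shift_fun _ _ _ _ _).2 (derivableP d1).
  by rewrite (deriveB d3 d2) e3.
have [t /hN th|c' /hN ch' E3] := @line_MVT_abs ('D_v f) (c *: v + z) w h.
  have [[_ _ d1 _] _] := hA c t ch th.
  by move: d1; rewrite -addrA addrCA.
have [t /hN th|d' /hN dh' E4] := @line_MVT_abs ('D_w f) (d *: w + z) v h.
  have [[_ _ _ d1] _] := hA t d th dh.
  by move: d1; rewrite -addrA.
have E : 'D_w ('D_v f) (c *: v + c' *: w + z) = 'D_v ('D_w f) (d' *: v + d *: w + z).
  (* Both sides times h^2 are the same double difference of f. *)
  apply: (mulfI (lt0r_neq0 h0)); apply: (mulfI (lt0r_neq0 h0)).
  rewrite -addrA addrCA -[d' *: v + _ + z]addrA.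
  have := etrans E1 (congr1 ( *%R h) (etrans D1 E3)).
  have := etrans E2 (congr1 ( *%R h) (etrans D2 E4)).
  have -> : h *: w + (h *: v + z) = h *: v + (h *: w + z) by rewrite addrCA.
  move=> X2 X1; apply: etrans (etrans (esym X1) _) X2.
  exact: subr_swap.
have [_ [N1 _]] := hA _ _ ch ch'; have [_ [_ N2]] := hA _ _ dh' dh.
have : e < e; last by rewrite ltxx.
rewrite -{}E in N2; exact: close_half N1 N2.
Qed.

(** If the second derivative were positive, the first derivative, which
    vanishes at the maximum, would be positive a little further along the line,
    and by the mean value theorem f would exceed its maximum there. *)
Lemma derive2_at_max f z v :
  (\forall y \near z, derivable f y v) -> derivable ('D_v f) z v ->
  (\forall t \near (0 : R), f (t *: v + z) <= f z) ->
  'D_v ('D_v f) z <= 0.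
Proof.
move=> Df D2 fm; rewrite leNgt; apply/negP => pos.
have [r r0 rA] := @near_shift_line z v 0 _ Df.
have [q q0 qA] : exists2 q : R, 0 < q & forall t, `|t| <= q -> f (t *: v + z) <= f z.
  move/nbhs_ballP : fm => [q /= q0 qA]; exists (q / 2); first by rewrite divr_gt0.
  move=> t tq; apply: qA; rewrite -ball_normE /ball_ /= sub0r normrN.
  by apply: le_lt_trans tq _; lra.
have rD t : `|t| <= r -> derivable f (t *: v + z) v.
  by move=> tr; have := rA t 0 tr; rewrite scale0r addr0; apply; rewrite normr0 ltW.
have D0 : 'D_v f z = 0.
  pose m := Num.min r q; have m0 : 0 < m by rewrite lt_min r0.
  have Dt t : `|t| < m -> derivable f (t *: v + z) v.
    by rewrite lt_min => /andP[/ltW/rD].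
  have H : is_derive (0:R) 1 (fun t : R => f (t *: v + z)) 0.
    apply: (@derive1_at_max _ _ (- m) m).
    - by lra.
    - move=> t; rewrite in_itv /= => /andP[mt tm].
      have [|//] := @derivable_line f z v t; apply: Dt; rewrite ltr_norml.
      by apply/andP; split.
    - by rewrite in_itv /=; apply/andP; split => //; lra.
    - move=> t; rewrite in_itv /= => /andP[mt tm]; rewrite scale0r add0r; apply: qA.
      have : `|t| < m by rewrite ltr_norml; apply/andP; split.
      by rewrite lt_min => /andP[_ /ltW].
  move/is_derive_line : H; rewrite scale0r add0r => H; exact: derive_val.
have /cvgrPdist_lt/(_ _ pos) : (fun h : R => h^-1 *: (('D_v f \o shift z) (h *: v) - 'D_v f z))
  @ 0^' --> 'D_v ('D_v f) z by exact: D2.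
move=> /nbhs_ballP[p /= p0 pA].
pose m := Num.min (p / 2) (Num.min r q).
have m0 : 0 < m by rewrite !lt_min r0 q0 divr_gt0.
have mp : m <= p / 2 by rewrite ge_min lexx.
have mr : m <= r by rewrite !ge_min lexx orbT.
have mq : m <= q by rewrite !ge_min lexx !orbT.
have [t /andP[t0 tm]|c /andP[c0 cm] E] := @line_MVT f z v m m0.
  by apply: rD; rewrite ger0_norm //; apply: le_trans mr.
have : f (m *: v + z) <= f z by apply: qA; rewrite gtr0_norm.
rewrite -subr_le0 E pmulr_rle0 // => Dc.
have := pA c; rewrite -ball_normE /ball_ /= sub0r normrN gtr0_norm //.
move=> /(_ _ _)/wrap[]; [lra|by rewrite gt_eqF|].
have : c^-1 *: ('D_v f (c *: v + z) - 'D_v f z) <= 0.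
  by rewrite D0 subr0 [_ <= _]pmulr_rle0 // invr_gt0.
move: (c^-1 *: _) ('D_v ('D_v f) z) => x y xle0.
by rewrite ltr_norml => /andP[_]; lra.
Qed.

Lemma is_derive_ln f z v : derivable f z v -> 0 < f z ->
  is_derive z v (fun y => ln (f y)) ((f z)^-1 * 'D_v f z).
Proof.
move=> df f0.
have := is_derive_line (fun y => ln (f y)) z v 0 ((f z)^-1 * 'D_v f z).
rewrite scale0r add0r => -[_]; apply.
have H1 : is_derive (0:R) 1 (fun t : R => f (t *: v + z)) ('D_v f z).
  by apply/is_derive_line; rewrite scale0r add0r; exact: derivableP.
have H2 : is_derive ((fun t : R => f (t *: v + z)) 0) 1 (@ln R) (f z)^-1.
  by rewrite scale0r add0r; exact: is_derive1_ln.
exact: (is_derive1_comp (g := fun t : R => f (t *: v + z)) H2 H1).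
Qed.
End LineCalculus.

(** * Smooth families of functions *)

Section SmoothFamilies.
Variables (R : realType) (n : nat) (P : topologicalType).
Variables (Q : set P) (W : set (Cn R n)).
Hypotheses (oQ : open Q) (oW : open W).
Local Notation Cn := (Cn R n).
Implicit Types F G : P -> Cn -> R.

Definition jointly_continuous F := forall p z, Q p -> W z ->
  {for (p, z), continuous (fun q : P * Cn => F q.1 q.2)}.

(** The parameter p only enters continuously. Quantifying over the family as a
    whole, and not over each member, is what makes uniform convergence of all
    derivatives on compact sets a consequence of joint continuity; the
    recursion on k is what allows the product, inverse and logarithm rules to
    be proved by induction. *)
Fixpoint Ck_family k F : Prop :=
  jointly_continuous F /\ (if k is k'.+1 then
    forall v, (forall p z, Q p -> W z -> derivable (F p) z v) /\
              Ck_family k' (fun p => 'D_v (F p)) else True).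

Definition smooth_family F := forall k, Ck_family k F.

Lemma near_QW p z : Q p -> W z -> \forall q \near (p, z), Q q.1 /\ W q.2.
Proof.
move=> Qp Wz; exists (Q, W) => //=.
by split; apply: open_nbhs_nbhs.
Qed.

Lemma Ck_family_jcont k F : Ck_family k F -> jointly_continuous F.
Proof. by case: k => [|k] []. Qed.

Lemma Ck_family_eq k F G : (forall p z, Q p -> W z -> F p z = G p z) ->
  Ck_family k F -> Ck_family k G.
Proof.
elim: k F G => [|k IH] F G FG /= [cF dF].
all: have cG : jointly_continuous G.
1,3: move=> p z Qp Wz; have := cF p z Qp Wz;
     rewrite /prop_for /continuous_at /= FG //; apply: cvg_trans;
     apply: near_eq_cvg; apply: filterS (near_QW Qp Wz) => q [? ?];
     by rewrite FG.
  by [].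
split=> // v; have [dFv cFv] := dF v.
have E p z : Q p -> W z -> {near z, F p =1 G p}.
  move=> Qp Wz; have : nbhs z W by exact: open_nbhs_nbhs.
  by apply: filterS => y Wy; exact: FG.
split=> [p z Qp Wz|]; first by apply: (near_eq_derivable (E p z Qp Wz)); exact: dFv.
by apply: IH cFv => p z Qp Wz; apply: near_eq_derive; exact: E.
Qed.

Lemma Ck_familyW k F : Ck_family k.+1 F -> Ck_family k F.
Proof.
elim: k F => [|k IH] F [cF dF]; first by [].
split=> // v; have [dv cv] := dF v; split=> //; exact: IH.
Qed.

Lemma Ck_family_cst k (a : P -> R) :
  (forall p, Q p -> {for p, continuous a}) -> Ck_family k (fun p _ => a p).
Proof.
move=> ca; have cj (b : P -> R) : (forall p, Q p -> {for p, continuous b}) ->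
    jointly_continuous (fun p _ => b p).
  move=> cb p z Qp Wz; rewrite /prop_for /continuous_at /=.
  by apply: (@cvg_comp _ _ _ fst b); [exact: cvg_fst|exact: cb].
elim: k a ca => [|k IH] a ca; first by split => //; exact: cj.
split; first exact: cj.
move=> v; split=> [p z _ _|]; first exact: derivable_cst.
apply: (@Ck_family_eq _ (fun _ _ => 0)) => [p z _ _|].
  by rewrite derive_cst.
by apply: IH => p _; exact: cvg_cst.
Qed.

Lemma Ck_family_smooth_on k f : smooth_on W f -> Ck_family k (fun _ => f).
Proof.
move=> sf; suff H vs : Ck_family k (fun _ => iterD vs f) by exact: (H [::]).
elim: k vs => [|k IH] vs.
all: have cj : jointly_continuous (fun _ => iterD vs f).
1,3: move=> p z Qp Wz; rewrite /prop_for /continuous_at /=;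
     by apply: (@cvg_comp _ _ _ snd (iterD vs f));
       [exact: cvg_snd|case: (sf vs z Wz)].
  by [].
split=> // v; split=> [p z _ Wz|]; first by case: (sf vs z Wz) => _; exact.
exact: (IH (v :: vs)).
Qed.

Lemma smooth_family_iterD F vs : smooth_family F ->
  smooth_family (fun p => iterD vs (F p)).
Proof.
move=> sF; elim: vs => [//|v vs IH] k /=.
by have /= [_ /(_ v)[]] := IH k.+1.
Qed.

Lemma smooth_family_smooth_on F p : smooth_family F -> Q p -> smooth_on W (F p).
Proof.
move=> sF Qp vs z Wz; have sD := smooth_family_iterD vs sF; split.
  have := Ck_family_jcont (sD 0) Qp Wz; rewrite /prop_for /continuous_at /=.
  move=> H; have C : (p, y) @[y --> z] --> (p, z).
    move=> A [[B D] /= [Bp Dz] BDA]; rewrite nbhs_simpl /=.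
    by apply: filterS Dz => y Dy; apply: BDA; split=> //=; exact: nbhs_singleton.
  exact: cvg_comp C H.
by move=> v; have /= [_ /(_ v)[+ _]] := sD 1; apply.
Qed.

Lemma jointly_continuousD F G : jointly_continuous F -> jointly_continuous G -> jointly_continuous (fun p z => F p z + G p z).
Proof. by move=> cF cG p z Qp Wz; apply: cvgD; [exact: cF|exact: cG]. Qed.

Lemma jointly_continuousM F G : jointly_continuous F -> jointly_continuous G -> jointly_continuous (fun p z => F p z * G p z).
Proof. by move=> cF cG p z Qp Wz; apply: cvgM; [exact: cF|exact: cG]. Qed.

Lemma Ck_familyD k F G : Ck_family k F -> Ck_family k G ->
  Ck_family k (fun p z => F p z + G p z).
Proof.
elim: k F G => [|k IH] F G /= [cF dF] [cG dG]; split=> //; try exact: jointly_continuousD.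
move=> v; have [dFv cFv] := dF v; have [dGv cGv] := dG v.
split=> [p z Qp Wz|]; first by apply: derivableD; [exact: dFv|exact: dGv].
apply: Ck_family_eq (IH _ _ cFv cGv) => p z Qp Wz.
by rewrite deriveD //; [exact: dFv|exact: dGv].
Qed.

Lemma Ck_familyM k F G : Ck_family k F -> Ck_family k G ->
  Ck_family k (fun p z => F p z * G p z).
Proof.
elim: k F G => [|k IH] F G /= fF fG.
  by split=> //; apply: jointly_continuousM; [case: fF|case: fG].
have [cF dF] := fF; have [cG dG] := fG.
split=> [|v]; first exact: jointly_continuousM.
have [dFv cFv] := dF v; have [dGv cGv] := dG v.
split=> [p z Qp Wz|]; first by apply: derivableM; [exact: dFv|exact: dGv].
have FG := Ck_familyD (IH _ _ (Ck_familyW fF) cGv) (IH _ _ (Ck_familyW fG) cFv).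
apply: Ck_family_eq FG => p z Qp Wz.
by rewrite deriveM //; [exact: dFv|exact: dGv].
Qed.

Lemma Ck_familyV k F : (forall p z, Q p -> W z -> F p z != 0) ->
  Ck_family k F -> Ck_family k (fun p z => (F p z)^-1).
Proof.
move=> F0; have cV F' : (forall p z, Q p -> W z -> F' p z != 0) -> jointly_continuous F' ->
    jointly_continuous (fun p z => (F' p z)^-1).
  by move=> F'0 cF p z Qp Wz; apply: cvgV; [exact: F'0|exact: cF].
elim: k F F0 => [|k IH] F F0 fF; first by split=> //; apply: cV => //; case: fF.
have [cF dF] := fF; split=> [|v]; first exact: cV.
have [dFv cFv] := dF v; have iF := IH _ F0 (Ck_familyW fF).
split=> [p z Qp Wz|]; first by apply: derivableV; [exact: F0|exact: dFv].
have c1 : Ck_family k (fun _ _ => -1) by apply: (Ck_family_cst k (a := fun=> -1)) => p _; exact: cvg_cst.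
apply: Ck_family_eq (Ck_familyM (Ck_familyM c1 (Ck_familyM iF iF)) cFv) => p z Qp Wz.
rewrite deriveV; [|exact: F0|exact: dFv].
by rewrite mulN1r -expr2 exprVn.
Qed.

Lemma Ck_family_ln k F : (forall p z, Q p -> W z -> 0 < F p z) ->
  Ck_family k F -> Ck_family k (fun p z => ln (F p z)).
Proof.
move=> F0 fF; have cL : jointly_continuous (fun p z => ln (F p z)).
  move=> p z Qp Wz.
  have := @cvg_comp _ _ _ (fun q : P * Cn => F q.1 q.2) (@ln R) _ _ _
    (Ck_family_jcont fF Qp Wz).
  apply; exact/continuous_ln/F0.
case: k fF => [|k] fF; first by split.
have [cF dF] := fF; split=> // v; have [dFv cFv] := dF v.
have H p z : Q p -> W z -> is_derive z v (fun y => ln (F p y)) ((F p z)^-1 * 'D_v (F p) z).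
  by move=> Qp Wz; apply: is_derive_ln; [exact: dFv|exact: F0].
split=> [p z Qp Wz|]; first by have [] := H p z Qp Wz.
have iF : Ck_family k (fun p z => (F p z)^-1).
  by apply: Ck_familyV (Ck_familyW fF) => p z Qp Wz; rewrite gt_eqF // F0.
apply: Ck_family_eq (Ck_familyM iF cFv) => p z Qp Wz.
by have [_ ->] := H p z Qp Wz.
Qed.

Lemma smooth_family_sum (I : Type) (r : seq I) (F : I -> P -> Cn -> R) :
  (forall i, smooth_family (F i)) ->
  smooth_family (fun p z => \sum_(i <- r) F i p z).
Proof.
move=> sF k; elim: r => [|i r IH].
  apply: (@Ck_family_eq _ (fun _ _ => 0)) => [p z _ _|]; first by rewrite big_nil.
  by apply: (Ck_family_cst k (a := fun=> 0)) => p _; exact: cvg_cst.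
apply: Ck_family_eq (Ck_familyD (sF i k) IH) => p z _ _.
by rewrite big_cons.
Qed.

End SmoothFamilies.

(** * Smooth functions *)

Section SmoothFunctions.
Variables (R : realType) (n : nat) (W : set (Cn R n)).
Hypothesis oW : open W.
Local Notation Cn := (Cn R n).
Implicit Types f g : Cn -> R.

Let oT : open [set: R] := openT.

(** A smooth function is a smooth family that does not depend on its parameter,
    so the closure properties of families carry over. *)
Lemma smooth_onP f :
  smooth_on W f <-> smooth_family [set: R] W (fun _ : R => f).
Proof.
split=> [sf k|sf]; first exact: Ck_family_smooth_on.
exact: (@smooth_family_smooth_on R n R setT W (fun=> f) 0 sf I).
Qed.

Lemma smooth_on_eq f g : (forall z, W z -> f z = g z) -> smooth_on W f -> smooth_on W g.
Proof.
by move=> fg /smooth_onP sf; apply/smooth_onP => k; apply: (Ck_family_eq oT oW _ (sf k)) => p z _; exact: fg.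
Qed.

Lemma smooth_on_cst (a : R) : smooth_on W (fun=> a).
Proof.
apply/smooth_onP => k; apply: (Ck_family_cst oT oW k (a := fun=> a)) => p _.
exact: cvg_cst.
Qed.

Lemma smooth_onD f g : smooth_on W f -> smooth_on W g -> smooth_on W (fun z => f z + g z).
Proof.
by move=> /smooth_onP sf /smooth_onP sg; apply/smooth_onP => k; exact: (Ck_familyD oT oW).
Qed.

Lemma smooth_onM f g : smooth_on W f -> smooth_on W g -> smooth_on W (fun z => f z * g z).
Proof.
by move=> /smooth_onP sf /smooth_onP sg; apply/smooth_onP => k; exact: (Ck_familyM oT oW).
Qed.

Lemma smooth_onV f : (forall z, W z -> f z != 0) -> smooth_on W f ->
  smooth_on W (fun z => (f z)^-1).
Proof.
by move=> f0 /smooth_onP sf; apply/smooth_onP => k; apply: (Ck_familyV oT oW) => // p z _; exact: f0.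
Qed.

Lemma smooth_on_ln f : (forall z, W z -> 0 < f z) -> smooth_on W f ->
  smooth_on W (fun z => ln (f z)).
Proof.
by move=> f0 /smooth_onP sf; apply/smooth_onP => k; apply: (Ck_family_ln oT oW) => // p z _; exact: f0.
Qed.

Lemma smooth_on_D f v : smooth_on W f -> smooth_on W ('D_v f).
Proof.
move=> sf vs z Wz; have := sf (rcons vs v) z Wz.
suff -> : iterD (rcons vs v) f = iterD vs ('D_v f) by [].
by elim: vs => //= w vs ->.
Qed.

Lemma smooth_on_cont f z : smooth_on W f -> W z -> {for z, continuous f}.
Proof. by move=> sf /(sf [::])[]. Qed.

Lemma smooth_on_near_derivable f z v : smooth_on W f -> W z ->
  \forall y \near z, derivable f y v.
Proof.
move=> sf Wz; have : nbhs z W by exact: open_nbhs_nbhs.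
by apply: filterS => y; exact: smooth_on_derivable.
Qed.

Lemma smooth_on_deriveDv f z v w : smooth_on W f -> W z ->
  'D_(v + w) f z = 'D_v f z + 'D_w f z.
Proof.
move=> sf Wz; have [] // := @is_deriveDv _ _ f z v w.
- exact: smooth_on_derivable sf Wz.
- exact: smooth_on_near_derivable.
- by apply: smooth_on_cont Wz; exact: smooth_on_D.
Qed.

Lemma smooth_on_deriveZv f z v (a : R) : smooth_on W f -> W z ->
  'D_(a *: v) f z = a * 'D_v f z.
Proof.
move=> sf Wz; have [] // := @derive_mulv _ _ f z v a.
exact: smooth_on_derivable sf Wz.
Qed.

Lemma smooth_on_derive_comm f z v w : smooth_on W f -> W z ->
  'D_w ('D_v f) z = 'D_v ('D_w f) z.
Proof.
move=> sf Wz; apply: derive_comm.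
- have : nbhs z W by exact: open_nbhs_nbhs.
  apply: filterS => y Wy; split; apply: smooth_on_derivable Wy => //;
  exact: smooth_on_D.
- by apply: smooth_on_cont Wz; do 2!apply: smooth_on_D.
- by apply: smooth_on_cont Wz; do 2!apply: smooth_on_D.
Qed.

End SmoothFunctions.

(** * Complex numbers *)

Section ComplexNumbers.
Variable R : realType.
Local Notation C := (cplx R).
Implicit Types x y : C.

Definition RC (a : R) : C := Complex a 0.
Definition sqn x : R := re x * re x + im x * im x.

Lemma cplx_eq x y : re x = re y -> im x = im y -> x = y.
Proof. by case: x y => [a b] [c d]; rewrite /re /im /= => -> ->. Qed.
Lemma reD x y : re (x + y) = re x + re y. Proof. by case: x y => [a b] [c d]. Qed.
Lemma imD x y : im (x + y) = im x + im y. Proof. by case: x y => [a b] [c d]. Qed.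
Lemma reN x : re (- x) = - re x. Proof. by case: x. Qed.
Lemma imN x : im (- x) = - im x. Proof. by case: x. Qed.
Lemma reM x y : re (x * y) = re x * re y - im x * im y.
Proof. by case: x y => [a b] [c d]. Qed.
Lemma imM x y : im (x * y) = re x * im y + im x * re y.
Proof. by case: x y => [a b] [c d]. Qed.
Lemma re0 : re (0 : C) = 0. Proof. by []. Qed.
Lemma im0 : im (0 : C) = 0. Proof. by []. Qed.
Lemma re1 : re (1 : C) = 1. Proof. by []. Qed.
Lemma im1 : im (1 : C) = 0. Proof. by []. Qed.
Lemma re_RC a : re (RC a) = a. Proof. by []. Qed.
Lemma im_RC a : im (RC a) = 0. Proof. by []. Qed.
Lemma reJ x : re x^* = re x. Proof. by case: x. Qed.
Lemma imJ x : im x^* = - im x. Proof. by case: x. Qed.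
Lemma reI : re ('i : C) = 0. Proof. by rewrite -complexiE. Qed.
Lemma imI : im ('i : C) = 1. Proof. by rewrite -complexiE. Qed.
Lemma RC0 : RC 0 = 0. Proof. by []. Qed.
Lemma RC1 : RC 1 = 1. Proof. by []. Qed.
Definition reimE := (reD, imD, reN, imN, reM, imM, re0, im0, re1, im1, re_RC,
  im_RC, reJ, imJ, reI, imI).
Lemma RCD a b : RC (a + b) = RC a + RC b.
Proof. by apply: cplx_eq; rewrite !reimE ?addr0. Qed.
Lemma RCM a b : RC (a * b) = RC a * RC b.
Proof. by apply: cplx_eq; rewrite !reimE; ring. Qed.
Lemma RCV a : RC a^-1 = (RC a)^-1.
Proof.
have [->|a0] := eqVneq a 0; first by rewrite invr0 RC0 invr0.
apply: (@mulrI _ (RC a)).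
  by rewrite unitfE; apply/eqP => /(congr1 (@re R)); rewrite !reimE; exact/eqP.
rewrite -RCM mulfV // mulfV //.
by apply/eqP => /(congr1 (@re R)); rewrite !reimE; exact/eqP.
Qed.
Lemma RC_inj : injective RC. Proof. by move=> a b [->]. Qed.
Lemma RC_eq0 a : (RC a == 0) = (a == 0).
Proof. by apply/eqP/eqP => [[]|->]. Qed.
Lemma mulr_conj x : x * x^* = RC (sqn x).
Proof. by apply: cplx_eq; rewrite !reimE /sqn; ring. Qed.
Lemma sqn_ge0 x : 0 <= sqn x.
Proof. by rewrite addr_ge0 // -expr2 sqr_ge0. Qed.
Lemma sqn_eq0 x : (sqn x == 0) = (x == 0).
Proof.
apply/eqP/eqP => [|->]; last by rewrite /sqn !reimE mulr0 addr0.
have := sqr_ge0 (re x); have := sqr_ge0 (im x); rewrite !expr2 /sqn => h1 h2 h3.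
have /eqP : re x * re x = 0 by lra.
have /eqP : im x * im x = 0 by lra.
rewrite !mulf_eq0 !orbb => /eqP ix /eqP rx.
by apply: cplx_eq; rewrite !reimE.
Qed.
Lemma sqn_gt0 x : (0 < sqn x) = (x != 0).
Proof. by rewrite lt0r sqn_ge0 andbT sqn_eq0. Qed.
Lemma sqnM x y : sqn (x * y) = sqn x * sqn y.
Proof. by rewrite /sqn !reimE; ring. Qed.
Lemma sqn1 : sqn 1 = 1. Proof. by rewrite /sqn !reimE; ring. Qed.
Lemma sqnX x k : sqn (x ^+ k) = sqn x ^+ k.
Proof. by elim: k => [|k IH]; rewrite ?expr0 ?sqn1 // !exprS sqnM IH. Qed.
Lemma sqnV x : sqn x^-1 = (sqn x)^-1.
Proof.
have [->|x0] := eqVneq x 0; first by rewrite invr0 /sqn !reimE mulr0 addr0 invr0.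
apply: (@mulfI _ (sqn x)); first by rewrite sqn_eq0.
by rewrite -sqnM !mulfV ?sqn1 // sqn_eq0.
Qed.
Lemma invc_conj x : x^-1 = x^* * RC (sqn x)^-1.
Proof.
have [->|x0] := eqVneq x 0; first by rewrite conjC0 mul0r invr0.
apply: (mulfI x0); rewrite mulfV // mulrA mulr_conj -RCM mulfV ?RC1 //.
by rewrite sqn_eq0.
Qed.
Lemma ge0_RC (z : C) : (0 <= z) = (im z == 0) && (0 <= re z).
Proof. by case: z => a b; rewrite /re /im /= lecE /= eq_sym. Qed.
Lemma gt0_RC (z : C) : (0 < z) = (im z == 0) && (0 < re z).
Proof. by case: z => a b; rewrite /re /im /= ltcE /= eq_sym. Qed.
Lemma re_sum (I : Type) (r : seq I) (P : pred I) (F : I -> C) :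
  re (\sum_(i <- r | P i) F i) = \sum_(i <- r | P i) re (F i).
Proof. by apply: (big_morph _ reD re0). Qed.
Lemma RC_sum (I : Type) (r : seq I) (P : pred I) (F : I -> R) :
  RC (\sum_(i <- r | P i) F i) = \sum_(i <- r | P i) RC (F i).
Proof. by apply: (big_morph _ RCD RC0). Qed.
End ComplexNumbers.

Section ProductRules.
Variables (R : realType) (V : normedModType R).
Implicit Types (a b c d : V -> R) (z v : V).

Lemma derive_det a b c d z v : derivable a z v -> derivable b z v ->
  derivable c z v -> derivable d z v ->
  'D_v (fun y => a y * b y - c y * d y) z =
  ('D_v a z * b z + a z * 'D_v b z) - ('D_v c z * d z + c z * 'D_v d z).
Proof.
move=> da db dc dd.
rewrite (deriveB (derivableM da db) (derivableM dc dd)) (deriveM da db) (deriveM dc dd).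
move: ('D_v _ _) ('D_v _ _) ('D_v _ _) ('D_v _ _) => p q r s.
by rewrite /GRing.scale /=; ring.
Qed.

Lemma derive_perm a b c d z v : derivable a z v -> derivable b z v ->
  derivable c z v -> derivable d z v ->
  'D_v (fun y => a y * b y + c y * d y) z =
  ('D_v a z * b z + a z * 'D_v b z) + ('D_v c z * d z + c z * 'D_v d z).
Proof.
move=> da db dc dd.
rewrite (deriveD (derivableM da db) (derivableM dc dd)) (deriveM da db) (deriveM dc dd).
move: ('D_v _ _) ('D_v _ _) ('D_v _ _) ('D_v _ _) => p q r s.
by rewrite /GRing.scale /=; ring.
Qed.

End ProductRules.

(** * Calculus of complex valued functions *)

Section ComplexCalculus.
Variables (R : realType) (n : nat) (W : set (Cn R n)).
Hypothesis oW : open W.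
Local Notation C := (cplx R).
Local Notation Cn := (Cn R n).
Implicit Types (f g : Cn -> C) (z v w : Cn).

Definition csmooth f := smooth_on W (@re R \o f) /\ smooth_on W (@im R \o f).

Lemma csmooth_eq f g : (forall z, W z -> f z = g z) -> csmooth f -> csmooth g.
Proof.
move=> fg [rf mf]; split; [apply: smooth_on_eq rf|apply: smooth_on_eq mf] => //.
all: by move=> z Wz /=; rewrite fg.
Qed.

Lemma csmooth_cst (a : C) : csmooth (fun=> a).
Proof. by split; exact: smooth_on_cst. Qed.

Lemma csmoothD f g : csmooth f -> csmooth g -> csmooth (fun z => f z + g z).
Proof.
move=> [rf mf] [rg mg]; split.
  by apply: smooth_on_eq (smooth_onD oW rf rg) => // z _ /=; rewrite reD.
by apply: smooth_on_eq (smooth_onD oW mf mg) => // z _ /=; rewrite imD.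
Qed.

Lemma csmoothM f g : csmooth f -> csmooth g -> csmooth (fun z => f z * g z).
Proof.
move=> [rf mf] [rg mg]; have m1 := smooth_on_cst oW (-1); split.
  apply: smooth_on_eq (smooth_onD oW (smooth_onM oW rf rg)
     (smooth_onM oW m1 (smooth_onM oW mf mg))) => // z _ /=.
  by rewrite reM mulN1r.
apply: smooth_on_eq (smooth_onD oW (smooth_onM oW rf mg) (smooth_onM oW mf rg)) => // z _ /=.
by rewrite imM.
Qed.

Lemma csmoothJ f : csmooth f -> csmooth (fun z => (f z)^*).
Proof.
move=> [rf mf]; have m1 := smooth_on_cst oW (-1); split.
  by apply: smooth_on_eq rf => // z _ /=; rewrite reJ.
by apply: smooth_on_eq (smooth_onM oW m1 mf) => // z _ /=; rewrite imJ mulN1r.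
Qed.

Lemma csmooth_RC (f : Cn -> R) : smooth_on W f -> csmooth (fun z => RC (f z)).
Proof.
by move=> sf; split; [apply: smooth_on_eq sf|apply: smooth_on_eq (smooth_on_cst oW 0)].
Qed.

Lemma smooth_sqn f : csmooth f -> smooth_on W (fun z => sqn (f z)).
Proof.
move=> [rf mf]; exact: (smooth_onD oW (smooth_onM oW rf rf) (smooth_onM oW mf mf)).
Qed.

Lemma csmoothV f : (forall z, W z -> f z != 0) -> csmooth f ->
  csmooth (fun z => (f z)^-1).
Proof.
move=> f0 sf; have s2 := smooth_sqn sf.
have s3 : smooth_on W (fun z => (sqn (f z))^-1).
  by apply: (smooth_onV oW) s2 => z Wz; rewrite sqn_eq0 f0.
apply: csmooth_eq (csmoothM (csmoothJ sf) (csmooth_RC s3)) => z Wz.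
by rewrite -invc_conj.
Qed.

Lemma csmooth_pd f v : csmooth f -> csmooth (pd v f).
Proof. by move=> [rf mf]; split; apply: smooth_on_D. Qed.

Lemma csmooth_sum (I : Type) (r : seq I) (F : I -> Cn -> C) :
  (forall i, csmooth (F i)) -> csmooth (fun z => \sum_(i <- r) F i z).
Proof.
move=> sF; elim: r => [|i r IH].
  by apply: csmooth_eq (csmooth_cst 0) => z _; rewrite big_nil.
by apply: csmooth_eq (csmoothD (sF i) IH) => z _; rewrite big_cons.
Qed.

Lemma pd_eq f g v z : (forall y, W y -> f y = g y) -> W z -> pd v f z = pd v g z.
Proof.
move=> fg Wz; have N : nbhs z W by exact: open_nbhs_nbhs.
by apply: cplx_eq; apply: near_eq_derive; apply: filterS N => y Wy /=; rewrite fg.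
Qed.

Lemma pd_cst (a : C) v z : pd v (fun=> a) z = 0.
Proof. by apply: cplx_eq; rewrite /re /im /=; exact: derive_cst. Qed.

Let dre f z v : csmooth f -> W z -> derivable (@re R \o f) z v.
Proof. by move=> [rf _]; exact: smooth_on_derivable. Qed.
Let dim f z v : csmooth f -> W z -> derivable (@im R \o f) z v.
Proof. by move=> [_ mf]; exact: smooth_on_derivable. Qed.

Lemma re_pd f v z : re (pd v f z) = 'D_v (@re R \o f) z. Proof. by []. Qed.
Lemma im_pd f v z : im (pd v f z) = 'D_v (@im R \o f) z. Proof. by []. Qed.

Lemma pdD f g v z : csmooth f -> csmooth g -> W z ->
  pd v (fun y => f y + g y) z = pd v f z + pd v g z.
Proof.
move=> sf sg Wz; apply: cplx_eq; rewrite !(re_pd, im_pd, reD, imD).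
  rewrite -(deriveD (@dre f z v sf Wz) (@dre g z v sg Wz)).
  by congr (derive _ z v); apply/funext => y /=; exact: reD.
rewrite -(deriveD (@dim f z v sf Wz) (@dim g z v sg Wz)).
by congr (derive _ z v); apply/funext => y /=; exact: imD.
Qed.

Lemma pdM f g v z : csmooth f -> csmooth g -> W z ->
  pd v (fun y => f y * g y) z = pd v f z * g z + f z * pd v g z.
Proof.
move=> sf sg Wz.
have [rf mf rg mg] := And4 (@dre f z v sf Wz) (@dim f z v sf Wz) (@dre g z v sg Wz) (@dim g z v sg Wz).
apply: cplx_eq; rewrite !(reD, imD, reM, imM, re_pd, im_pd).
  apply: etrans (etrans (derive_det rf rg mf mg) _).
    by congr (derive _ z v); apply/funext => y /=; exact: reM.
  move: ('D_v _ _) ('D_v _ _) ('D_v _ _) ('D_v _ _) => p q r s /=; ring.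
apply: etrans (etrans (derive_perm rf mg mf rg) _).
  by congr (derive _ z v); apply/funext => y /=; exact: imM.
move: ('D_v _ _) ('D_v _ _) ('D_v _ _) ('D_v _ _) => p q r s /=; ring.
Qed.

Lemma pdJ f v z : csmooth f -> W z -> pd v (fun y => (f y)^*) z = (pd v f z)^*.
Proof.
move=> sf Wz; apply: cplx_eq; rewrite !(reJ, imJ, re_pd, im_pd).
  by congr (derive _ z v); apply/funext => y /=; rewrite reJ.
rewrite -(deriveN (@dim f z v sf Wz)).
by congr (derive _ z v); apply/funext => y /=; exact: imJ.
Qed.

Lemma pd_RC (f : Cn -> R) v z : pd v (fun y => RC (f y)) z = RC ('D_v f z).
Proof.
apply: cplx_eq; rewrite !(re_pd, im_pd, re_RC, im_RC).
  by [].
by rewrite (_ : _ \o _ = cst 0) ?derive_cst.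
Qed.

Lemma pd_sum (I : Type) (r : seq I) (F : I -> Cn -> C) v z :
  (forall i, csmooth (F i)) -> W z ->
  pd v (fun y => \sum_(i <- r) F i y) z = \sum_(i <- r) pd v (F i) z.
Proof.
move=> sF Wz; elim: r => [|i r IH].
  rewrite big_nil (@pd_eq _ (fun=> 0)) ?pd_cst // => y _; exact: big_nil.
rewrite big_cons -IH -pdD //; last exact: csmooth_sum.
by apply: pd_eq => // y _; rewrite big_cons.
Qed.

Lemma pdDv f v w z : csmooth f -> W z -> pd (v + w) f z = pd v f z + pd w f z.
Proof.
by move=> [rf mf] Wz; apply: cplx_eq; rewrite !(reD, imD, re_pd, im_pd);
   exact: (smooth_on_deriveDv oW).
Qed.

Lemma pdZv f (a : R) v z : csmooth f -> W z -> pd (a *: v) f z = RC a * pd v f z.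
Proof.
move=> [rf mf] Wz; apply: cplx_eq; rewrite !(reM, imM, re_RC, im_RC, re_pd, im_pd) mul0r ?subr0 ?addr0.
  exact: (smooth_on_deriveZv _ _ rf Wz).
exact: (smooth_on_deriveZv _ _ mf Wz).
Qed.

Lemma pd_sumv (I : Type) (r : seq I) (v : I -> Cn) f z : csmooth f -> W z ->
  pd (\sum_(i <- r) v i) f z = \sum_(i <- r) pd (v i) f z.
Proof.
move=> sf Wz; elim: r => [|i r IH]; last by rewrite !big_cons pdDv // IH.
by rewrite !big_nil -(scale0r (0 : Cn)) pdZv // RC0 mul0r.
Qed.

Lemma pd_comm f v w z : csmooth f -> W z -> pd w (pd v f) z = pd v (pd w f) z.
Proof.
move=> [rf mf] Wz; apply: cplx_eq.
  exact: (smooth_on_derive_comm oW v w rf Wz).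
exact: (smooth_on_derive_comm oW v w mf Wz).
Qed.

Lemma dzM j f g z : csmooth f -> csmooth g -> W z ->
  dz j (fun y => f y * g y) z = dz j f z * g z + f z * dz j g z.
Proof.
move=> sf sg Wz; rewrite /dz !pdM //.
move: ('i) (pd _ _ _) (pd _ _ _) (pd _ _ _) (pd _ _ _) => I p q r s.
by field.
Qed.

Lemma dz_eq j f g z : (forall y, W y -> f y = g y) -> W z -> dz j f z = dz j g z.
Proof. by move=> fg Wz; rewrite /dz !(pd_eq _ fg). Qed.

Lemma dzbar_eq j f g z : (forall y, W y -> f y = g y) -> W z -> dzbar j f z = dzbar j g z.
Proof. by move=> fg Wz; rewrite /dzbar !(pd_eq _ fg). Qed.

Lemma dzbarM j f g z : csmooth f -> csmooth g -> W z ->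
  dzbar j (fun y => f y * g y) z = dzbar j f z * g z + f z * dzbar j g z.
Proof.
move=> sf sg Wz; rewrite /dzbar !pdM //.
move: ('i) (pd _ _ _) (pd _ _ _) (pd _ _ _) (pd _ _ _) => I p q r s.
by field.
Qed.

Lemma dz_sum j (I : Type) (r : seq I) (F : I -> Cn -> C) z :
  (forall i, csmooth (F i)) -> W z ->
  dz j (fun y => \sum_(i <- r) F i y) z = \sum_(i <- r) dz j (F i) z.
Proof.
move=> sF Wz; rewrite /dz !pd_sum //.
by rewrite mulr_sumr -sumrB mulr_suml.
Qed.

Lemma dzbar_sum j (I : Type) (r : seq I) (F : I -> Cn -> C) z :
  (forall i, csmooth (F i)) -> W z ->
  dzbar j (fun y => \sum_(i <- r) F i y) z = \sum_(i <- r) dzbar j (F i) z.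
Proof.
move=> sF Wz; rewrite /dzbar !pd_sum //.
by rewrite mulr_sumr -big_split mulr_suml.
Qed.

Lemma conj_half (x : C) : (x / 2%:R)^* = x^* / 2%:R.
Proof. by rewrite rmorphM /= fmorphV rmorph_nat. Qed.

Lemma conj_i : ('i : C)^* = - 'i.
Proof. exact: conjCi. Qed.

Lemma dzJ j f z : csmooth f -> W z -> dz j (fun y => (f y)^*) z = (dzbar j f z)^*.
Proof.
move=> sf Wz; rewrite /dz /dzbar !pdJ // conj_half rmorphD rmorphM /= conj_i.
by rewrite mulNr.
Qed.

Lemma dzbarJ j f z : csmooth f -> W z -> dzbar j (fun y => (f y)^*) z = (dz j f z)^*.
Proof.
move=> sf Wz; rewrite /dz /dzbar !pdJ // conj_half rmorphB rmorphM /= conj_i.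
by rewrite mulNr opprK.
Qed.

End ComplexCalculus.

(** * Holomorphic functions *)

Section Holomorphic.
Variables (R : realType) (n : nat).
Local Notation C := (cplx R).
Local Notation Cn := (Cn R n).
Implicit Types (W : set Cn) (f g : Cn -> C) (z v w : Cn).

Lemma hol_csmooth W f : holomorphic_on W f -> csmooth W f.
Proof. by case. Qed.

Lemma hol_eq W f g : open W -> (forall z, W z -> f z = g z) ->
  holomorphic_on W f -> holomorphic_on W g.
Proof.
move=> oW fg hf; have [_ _ d0] := hf.
have [rg mg] := csmooth_eq oW fg (hol_csmooth hf); split=> // j z Wz.
by rewrite -(dzbar_eq oW j fg) // d0.
Qed.

Lemma hol_cst W (a : C) : open W -> holomorphic_on W (fun=> a).
Proof.
move=> oW; have [h1 h2] := csmooth_cst oW a; split=> // j z _.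
by rewrite /dzbar !pd_cst mulr0 addr0 mul0r.
Qed.

Lemma holM W f g : open W -> holomorphic_on W f -> holomorphic_on W g ->
  holomorphic_on W (fun z => f z * g z).
Proof.
move=> oW hf hg; have [sf sg] := (hol_csmooth hf, hol_csmooth hg).
have [r m] := csmoothM oW sf sg; split=> // j z Wz.
have [_ _ f0] := hf; have [_ _ g0] := hg.
by rewrite (@dzbarM _ _ W) // f0 // g0 // mul0r mulr0 addr0.
Qed.

Lemma holX W f k : open W -> holomorphic_on W f -> holomorphic_on W (fun z => f z ^+ k).
Proof.
move=> oW hf; elim: k => [|k IH]; first exact: hol_cst.
by apply: (hol_eq oW _ (holM oW hf IH)) => z _; rewrite exprS.
Qed.

Lemma holV W f : open W -> (forall z, W z -> f z != 0) -> holomorphic_on W f ->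
  holomorphic_on W (fun z => (f z)^-1).
Proof.
move=> oW f0 hf; have sf := hol_csmooth hf; have [_ _ df] := hf.
have sV := csmoothV oW f0 sf; have [r m] := sV; split=> // j z Wz.
have : dzbar j (fun y => f y * (f y)^-1) z = 0.
  rewrite (dzbar_eq oW j (g := fun=> 1)) // => [|y Wy]; last by rewrite mulfV ?f0.
  by rewrite /dzbar !pd_cst mulr0 addr0 mul0r.
rewrite (@dzbarM _ _ W) // df // mul0r add0r => /eqP.
by rewrite mulf_eq0 (negbTE (f0 _ Wz)) => /eqP.
Qed.

(** Multiplication by i on C^n. *)
Definition imul v : Cn := (- v.2, v.1).

Lemma Cn_decomp v :
  v = \sum_(j < n) (v.1 0 j *: e_re R j) + \sum_(j < n) (v.2 0 j *: e_im R j).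
Proof.
have E1 (I : finType) (F : I -> Cn) : (\sum_i F i).1 = \sum_i (F i).1.
  by apply: (big_morph (fun x : Cn => x.1)).
have E2 (I : finType) (F : I -> Cn) : (\sum_i F i).2 = \sum_i (F i).2.
  by apply: (big_morph (fun x : Cn => x.2)).
rewrite [LHS]surjective_pairing [RHS]surjective_pairing /= !E1 !E2 /=.
rewrite [X in (_ + X, _)]big1 => [|i _]; last by rewrite scaler0.
rewrite [X in (_, X + _)]big1 => [|i _]; last by rewrite scaler0.
by rewrite addr0 add0r -!row_sum_delta.
Qed.

Lemma imul_decomp v :
  imul v = \sum_(j < n) (v.1 0 j *: e_im R j) + \sum_(j < n) ((- v.2 0 j) *: e_re R j).
Proof.
rewrite {1}(Cn_decomp (imul v)) addrC /imul /=; congr (_ + _).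
by apply: eq_bigr => j _; rewrite mxE.
Qed.

Lemma pd_Cn W f v z : open W -> csmooth W f -> W z ->
  pd v f z = \sum_(j < n) RC (v.1 0 j) * pd (e_re R j) f z +
             \sum_(j < n) RC (v.2 0 j) * pd (e_im R j) f z.
Proof.
move=> oW sf Wz; rewrite {1}(Cn_decomp v) (pdDv oW _ _ sf Wz) !(pd_sumv oW _ _ sf Wz).
by congr (_ + _); apply: eq_bigr => j _; rewrite (pdZv _ _ sf Wz).
Qed.

Lemma hol_pd_im W f j z : holomorphic_on W f -> W z ->
  pd (e_im R j) f z = 'i * pd (e_re R j) f z.
Proof.
move=> [_ _ d0] Wz; have := d0 j z Wz; rewrite /dzbar.
move=> /eqP; rewrite mulf_eq0 invr_eq0 pnatr_eq0 orbF addrC => /eqP E.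
apply: (mulfI (neq0Ci _)); rewrite mulrA -expr2 sqrCi mulN1r.
by apply/eqP; rewrite -subr_eq0 opprK E.
Qed.

Lemma hol_pd_imul W f v z : open W -> holomorphic_on W f -> W z ->
  pd (imul v) f z = 'i * pd v f z.
Proof.
move=> oW hf Wz; have sf := hol_csmooth hf.
rewrite (pd_Cn v oW sf Wz) imul_decomp (pdDv oW _ _ sf Wz) !(pd_sumv oW _ _ sf Wz).
rewrite mulrDr !mulr_sumr; apply: congr2; apply: eq_bigr => j _.
  by rewrite (pdZv _ _ sf Wz) (hol_pd_im _ hf Wz) mulrCA.
rewrite (pdZv _ _ sf Wz) (hol_pd_im _ hf Wz).
move: (pd _ _ _) => p; have -> : RC (- v.2 0 j) = ('i * 'i) * RC (v.2 0 j).
  by rewrite -expr2 sqrCi mulN1r; apply: cplx_eq; rewrite !reimE ?oppr0.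
by rewrite -!mulrA; congr ('i * _); rewrite mulrCA.
Qed.

Lemma hol_dz W f j z : holomorphic_on W f -> W z -> dz j f z = pd (e_re R j) f z.
Proof.
move=> hf Wz; rewrite /dz (hol_pd_im _ hf Wz) mulrA -expr2 sqrCi.
by rewrite mulN1r opprK; field.
Qed.

(** Derivatives commute, so the Cauchy-Riemann equations for f differentiate to
    those for its derivative. *)
Lemma hol_pd W f v : open W -> holomorphic_on W f -> holomorphic_on W (pd v f).
Proof.
move=> oW hf; have sf := hol_csmooth hf.
have [r m] := csmooth_pd v sf; split=> // j z Wz.
rewrite /dzbar !(pd_comm oW v _ sf Wz).
rewrite (pd_eq oW v (f := pd (e_im R j) f) (g := fun y => 'i * pd (e_re R j) f y)) // => [|y Wy]; last first.
  exact: hol_pd_im hf Wy.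
have s1 := csmooth_pd (e_re R j) sf.
rewrite (pdM v (csmooth_cst oW 'i) s1 Wz) pd_cst mul0r add0r.
by rewrite mulrA -expr2 sqrCi mulN1r subrr mul0r.
Qed.

Lemma hol_dz_hol W f j : open W -> holomorphic_on W f -> holomorphic_on W (dz j f).
Proof.
move=> oW hf; apply: (hol_eq oW _ (hol_pd (e_re R j) oW hf)) => z Wz.
by rewrite (hol_dz _ hf Wz).
Qed.

(** Up to the factor 4, the operator d dbar in the complex line spanned by v.
    *)
Definition laplace v (u : Cn -> R) z := 'D_v ('D_v u) z + 'D_(imul v) ('D_(imul v) u) z.

Lemma derive_sqn W f v z : open W -> csmooth W f -> W z ->
  'D_v (fun y => sqn (f y)) z = 2 * re (pd v f z * (f z)^*).
Proof.
move=> oW sf Wz.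
apply: RC_inj; rewrite -pd_RC (pd_eq oW v (g := fun y => f y * (f y)^*)) => [|y _|//]; last first.
  by rewrite mulr_conj.
rewrite (pdM v sf (csmoothJ oW sf) Wz) (pdJ v sf Wz).
by apply: cplx_eq; rewrite !reimE; ring.
Qed.

(** The square modulus of a holomorphic function is subharmonic on every
    complex line: the pure second derivatives cancel because differentiating
    twice along i v is minus differentiating twice along v. *)
Lemma laplace_sqn W f v z : open W -> holomorphic_on W f -> W z ->
  laplace v (fun y => sqn (f y)) z = 4 * sqn (pd v f z).
Proof.
move=> oW hf Wz; have sf := hol_csmooth hf.
have dd w y : W y -> 'D_w ('D_w (fun y => sqn (f y))) y =
   2 * re (pd w (pd w f) y * (f y)^* + pd w f y * (pd w f y)^*).
  move=> Wy; have N : nbhs y W by exact: open_nbhs_nbhs.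
  have E : \near y, 'D_w (fun y => sqn (f y)) y = 2 * re (pd w f y * (f y)^*).
    by apply: filterS N => x Wx; exact: (derive_sqn w oW sf Wx).
  apply: etrans (near_eq_derive w E) _.
  have s1 := csmoothM oW (csmooth_pd w sf) (csmoothJ oW sf).
  have dr := @smooth_on_derivable _ _ _ _ y w s1.1 Wy.
  apply: etrans (_ : _ = 'D_w (2 \*: (@re R \o (fun y => pd w f y * (f y)^*))) y) _ => //.
  rewrite (deriveZ 2 dr).
  rewrite -[LHS]/(2 * re (pd w (fun y => pd w f y * (f y)^*) y)).
  by rewrite (pdM w (csmooth_pd w sf) (csmoothJ oW sf) Wy) (pdJ w sf Wy).
have E1 := hol_pd_imul v oW hf Wz.
have E2 : pd v (pd (imul v) f) z = 'i * pd v (pd v f) z.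
  apply: etrans (pd_eq oW v (g := fun y => 'i * pd v f y) _ Wz) _ => [y Wy|].
    exact: hol_pd_imul hf Wy.
  apply: etrans (pdM v (csmooth_cst oW 'i) (csmooth_pd v sf) Wz) _.
  by rewrite pd_cst mul0r add0r.
have E3 := etrans (hol_pd_imul v oW (hol_pd (imul v) oW hf) Wz) (congr1 ( *%R 'i) E2).
apply: etrans (congr2 +%R (dd v z Wz) (dd (imul v) z Wz)) _.
rewrite {}E1 {}E3; move: (pd v (pd v f) z) (pd v f z) (f z) => a b c.
by rewrite /sqn !reimE; ring.
Qed.

End Holomorphic.

(** * Coordinate functions *)

Section LinearFunctions.
Variables (R : realType) (n : nat).
Local Notation C := (cplx R).
Local Notation Cn := (Cn R n).

Lemma linear_smooth (W : set Cn) (l : Cn -> R) : open W -> continuous l ->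
  (forall (h : R) v z, l (h *: v + z) = h * l v + l z) -> smooth_on W l.
Proof.
move=> oW cl ll.
have H v z : is_derive z v l (l v).
  have E : {near (0 : R)^', (fun=> l v) =1
      (fun h : R => h^-1 *: ((l \o shift z) (h *: v) - l z))}.
    near=> h; rewrite /= ll addrK /GRing.scale /= mulKf //.
    by near: h; exact: nbhs_dnbhs_neq.
  have L : (fun h : R => h^-1 *: ((l \o shift z) (h *: v) - l z)) @ 0^' --> l v.
    by apply: cvg_trans (near_eq_cvg E) _; exact: cvg_cst.
  by split; [apply/cvg_ex; exists (l v)|exact: cvg_lim L].
apply/smooth_onP => -[|k]; split=> //.
- by move=> p z _ _; apply: (@cvg_comp _ _ _ snd l); [exact: cvg_snd|exact: cl].
- by move=> p z _ _; apply: (@cvg_comp _ _ _ snd l); [exact: cvg_snd|exact: cl].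
move=> v; split=> [p z _ _|]; first by have [] := H v z.
apply: (Ck_family_eq openT oW (F := fun _ _ => l v)) => [p z _ _|].
  by have [_ ->] := H v z.
by apply: (Ck_family_cst openT oW k (a := fun=> l v)) => p _; exact: cvg_cst.
Unshelve. all: by end_near. Qed.

Lemma derive_linear (l : Cn -> R) v z :
  (forall (h : R) v z, l (h *: v + z) = h * l v + l z) -> 'D_v l z = l v.
Proof.
move=> ll; have E : {near (0 : R)^', (fun=> l v) =1
    (fun h : R => h^-1 *: ((l \o shift z) (h *: v) - l z))}.
  near=> h; rewrite /= ll addrK /GRing.scale /= mulKf //.
  by near: h; exact: nbhs_dnbhs_neq.
apply: cvg_lim => //; apply: cvg_trans (near_eq_cvg E) _; exact: cvg_cst.
Unshelve. all: by end_near. Qed.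

Lemma zcoord_lin j (a : R) (v z : Cn) : zcoord j (a *: v + z) = RC a * zcoord j v + zcoord j z.
Proof.
by apply: cplx_eq; rewrite !reimE /zcoord /re /im /= !mxE; ring.
Qed.

Lemma zcoord_csmooth (W : set Cn) j : open W -> csmooth W (zcoord j).
Proof.
move=> oW; split; apply: linear_smooth => //.
- move=> z; apply: (@cvg_comp _ _ _ fst (fun x : 'rV[R]_n => x 0 j)); first exact: cvg_fst.
  exact: coord_continuous.
- by move=> h v z; rewrite /= !mxE.
- move=> z; apply: (@cvg_comp _ _ _ snd (fun x : 'rV[R]_n => x 0 j)); first exact: cvg_snd.
  exact: coord_continuous.
- by move=> h v z; rewrite /= !mxE.
Qed.

Lemma pd_zcoord j (v z : Cn) : pd v (zcoord j) z = zcoord j v.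
Proof.
apply: cplx_eq; rewrite ?re_pd ?im_pd; apply: derive_linear => h w y /=.
  by rewrite !mxE.
by rewrite !mxE.
Qed.

Lemma zcoord_imul j (v : Cn) : zcoord j (imul v) = 'i * zcoord j v.
Proof.
by apply: cplx_eq; rewrite !reimE /zcoord /re /im /= ?mxE; ring.
Qed.

Lemma imul_e_re j : imul (e_re R j) = e_im R j :> Cn.
Proof. by rewrite /imul /e_re /e_im /= oppr0. Qed.

Lemma zcoord_hol (W : set Cn) j : open W -> holomorphic_on W (zcoord j).
Proof.
move=> oW; have [r m] := zcoord_csmooth j oW; split=> // k z Wz.
by rewrite /dzbar !pd_zcoord -imul_e_re zcoord_imul mulrA -expr2 sqrCi mulN1r subrr mul0r.
Qed.

Lemma zcoord_eq0 (v : Cn) : v != 0 -> exists j, zcoord j v != 0.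
Proof.
move=> v0; apply/existsP; rewrite -negb_forall; apply/negP => /forallP H.
move/eqP: v0; apply; rewrite [v]surjective_pairing; congr pair; apply/rowP => j.
  by have /eqP := H j; rewrite /zcoord !mxE => -[].
by have /eqP := H j; rewrite /zcoord !mxE => -[].
Qed.

Lemma holD (W : set Cn) (f g : Cn -> C) : open W -> holomorphic_on W f -> holomorphic_on W g ->
  holomorphic_on W (fun z => f z + g z).
Proof.
move=> oW hf hg; apply: (hol_eq oW _ (holomorphic_on_lin 1 oW hf hg)) => z _.
by rewrite mul1r.
Qed.

End LinearFunctions.

(** * The maximum principle on an annulus in a complex line *)

Section MaximumPrinciple.
Variables (R : realType) (n : nat).
Local Notation C := (cplx R).
Local Notation Cn := (Cn R n).

(** The point z0 + (a + i b) v of the complex line, for p = (a, b). *)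
Definition line_point (z0 v : Cn) (p : R * R) : Cn := p.1 *: v + p.2 *: imul v + z0.
Definition annulus (r s : R) : set (R * R) :=
  [set p | r <= p.1 * p.1 + p.2 * p.2 <= s].

Lemma continuous_pair (f g : R -> R) : continuous f -> continuous g ->
  continuous (fun t => (f t, g t)).
Proof.
move=> coef cg t A [[B D] /= [Bt Dt] BDA]; rewrite nbhs_simpl /=.
have cB : nbhs t (f @^-1` B) := coef t B Bt.
have cD : nbhs t (g @^-1` D) := cg t D Dt.
by apply: filterS2 cB cD => s Bs Ds; apply: BDA; split.
Qed.

Lemma norm2_continuous : continuous (fun p : R * R => p.1 * p.1 + p.2 * p.2).
Proof.
by move=> p; apply: cvgD; apply: cvgM; first [exact: cvg_fst|exact: cvg_snd].
Qed.

Lemma laplace_contra (x y a b c d e p : R) : x = a + e * b -> y = c + e * d ->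
  a + c = 4 * p -> b + d = 4 * 1 -> 0 <= p -> 0 < e -> x <= 0 -> y <= 0 -> False.
Proof.
move=> -> -> h1 h2 p0 e0 x0 y0.
have : a + e * b + (c + e * d) = (a + c) + e * (b + d) by ring.
by rewrite h1 h2; lra.
Qed.

Lemma compact_annulus r s : compact (annulus r s).
Proof.
pose m := s + 1.
have K : compact (`[- m, m] `*` `[- m, m]).
  by apply: compact_setX; exact: segment_compact.
apply: (subclosed_compact _ K).
  rewrite (_ : annulus r s = (fun p : R * R => p.1 * p.1 + p.2 * p.2) @^-1` `[r, s]).
    apply: closed_comp; last exact: interval_closed.
    by move=> p _; exact: norm2_continuous.
  by apply/seteqP; split=> p /=; rewrite /annulus /= in_itv.
have S (x y : R) : x * x + y * y <= s -> - m <= x <= m.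
  move=> xy; have s0 : 0 <= s.
    by apply: le_trans xy; rewrite addr_ge0 // -expr2 sqr_ge0.
  have : x * x <= s by apply: le_trans xy; rewrite lerDl -expr2 sqr_ge0.
  rewrite /m => xs; apply/andP; split; nra.
move=> [x y]; rewrite /annulus /= !in_itv /= => /andP[_ xy]; split; first exact: S xy.
by apply: S; rewrite addrC; exact: xy.
Qed.

Lemma line_point_continuous z0 v : continuous (line_point z0 v).
Proof.
move=> p; apply: cvgD; last exact: cvg_cst.
by apply: cvgD; apply: cvgZr_tmp; first [exact: cvg_fst|exact: cvg_snd].
Qed.

Lemma line_point_step z0 v (a b t : R) : t *: v + line_point z0 v (a, b) = line_point z0 v (t + a, b).
Proof. by rewrite /line_point /= scalerDl !addrA. Qed.
Lemma line_point_istep z0 v (a b t : R) : t *: imul v + line_point z0 v (a, b) = line_point z0 v (a, t + b).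
Proof. by rewrite /line_point /= scalerDl !addrA [_ + a *: v]addrC. Qed.

(** The square modulus of f is only subharmonic, so an interior maximum is not
    immediately absurd; e |l|^2, with l the coordinate on the line, makes it
    strictly subharmonic. If f exceeded the bound B at p, then for e small
    enough |f|^2 + e |l|^2 would still have an interior maximum, where its
    second derivatives along v and i v are nonpositive although their sum is
    positive. *)
Lemma annulus_max (W : set Cn) (f l : Cn -> C) z0 v (r s B : R) :
  open W -> holomorphic_on W f -> holomorphic_on W l ->
  (forall z, W z -> pd v l z = 1) -> (forall p, sqn (l (line_point z0 v p)) = p.1 * p.1 + p.2 * p.2) ->
  (forall p, annulus r s p -> W (line_point z0 v p)) ->
  (forall p : R * R, p.1 * p.1 + p.2 * p.2 = r \/ p.1 * p.1 + p.2 * p.2 = s ->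
     sqn (f (line_point z0 v p)) <= B) ->
  forall p, annulus r s p -> sqn (f (line_point z0 v p)) <= B.
Proof.
move=> oW hf hl dl ln AW bd p Ap.
have sf := smooth_sqn oW (hol_csmooth hf).
have sl := smooth_sqn oW (hol_csmooth hl).
have [s0|s0] := leP s 0.
  apply: bd; right; move: Ap => /andP[_ ps]; apply/eqP; rewrite eq_le ps /=.
  by apply: (le_trans s0); rewrite addr_ge0 // -expr2 sqr_ge0.
rewrite leNgt; apply/negP => Bf.
(* Half of the excess of f over B, spread over |l|^2 <= s, so that the
   perturbation cannot move the maximum to the boundary. *)
pose e := (sqn (f (line_point z0 v p)) - B) / (2 * s).
have e0 : 0 < e by rewrite divr_gt0 ?subr_gt0 ?mulr_gt0.
pose u z := sqn (f z) + e * sqn (l z).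
have su : smooth_on W u := smooth_onD oW sf (smooth_onM oW (smooth_on_cst oW e) sl).
have cu : {within annulus r s, continuous (u \o line_point z0 v)}.
  apply: continuous_in_subspaceT => q /set_mem Aq.
  apply: continuous_comp; first exact: line_point_continuous.
  by apply: smooth_on_cont su _; exact: AW.
have [|q /set_mem Aq qmax] := @compact_EVT_max _ _ _ _ _ (@compact_annulus r s) cu.
  by exists p.
have up : B + e * s < u (line_point z0 v p).
  have : 0 <= e * sqn (l (line_point z0 v p)) by rewrite mulr_ge0 ?sqn_ge0 // ltW.
  have : e * s = (sqn (f (line_point z0 v p)) - B) / 2.
    by rewrite /e; field; rewrite gt_eqF.
  by rewrite /u => -> h; lra.
have uq : u (line_point z0 v p) <= u (line_point z0 v q) by apply: qmax; exact/mem_set.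
have bq : sqn (f (line_point z0 v q)) <= B -> False.
  move=> fq; have : u (line_point z0 v q) <= B + e * s.
    rewrite /u lerD // ler_pM2l // ln; by move: Aq => /andP[].
  by lra.
have [rq sq] := andP Aq.
have {}rq : r < q.1 * q.1 + q.2 * q.2.
  rewrite lt_neqAle rq andbT; apply/eqP => E; apply: bq; apply: bd; left; exact: esym.
have {}sq : q.1 * q.1 + q.2 * q.2 < s.
  by rewrite lt_neqAle sq andbT; apply/eqP => E; apply: bq; apply: bd; right.
have Wq : W (line_point z0 v q) by exact: AW.
have D (w : Cn) (g : R -> R * R) : g 0 = q -> continuous g ->
    (forall t, t *: w + line_point z0 v q = line_point z0 v (g t)) ->
    'D_w ('D_w u) (line_point z0 v q) <= 0.
  move=> g0 cg gE; apply: derive2_at_max.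
  - exact: (smooth_on_near_derivable oW).
  - exact: (@smooth_on_derivable _ _ W ('D_w u) _ w (smooth_on_D w su) Wq).
  - have N : \forall t \near (0 : R), annulus r s (g t).
      have c0 : (fun t : R => (g t).1 * (g t).1 + (g t).2 * (g t).2) @ (0 : R)
          --> q.1 * q.1 + q.2 * q.2.
        have := cvg_comp _ _ (cg (0:R)) (@norm2_continuous (g 0)); rewrite g0; exact.
      have h1 := cvgr_gt _ c0 _ rq; have h2 := cvgr_lt _ c0 _ sq.
      by apply: filterS2 (h1 _) (h2 _) => t {}h1 {}h2; rewrite /annulus /= !ltW.
    apply: filterS N => t At; rewrite gE; apply: qmax; exact/mem_set.
have D1 : 'D_v ('D_v u) (line_point z0 v q) <= 0.
  apply: (D v (fun t => (t + q.1, q.2))).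
  - by rewrite add0r -surjective_pairing.
  - apply: continuous_pair => t; last exact: cvg_cst.
    by apply: cvgD; [exact: cvg_id|exact: cvg_cst].
  - by move=> t; rewrite [q in LHS]surjective_pairing line_point_step.
have D2 : 'D_(imul v) ('D_(imul v) u) (line_point z0 v q) <= 0.
  apply: (D (imul v) (fun t => (q.1, t + q.2))).
  - by rewrite add0r -surjective_pairing.
  - apply: continuous_pair => t; first exact: cvg_cst.
    by apply: cvgD; [exact: cvg_id|exact: cvg_cst].
  - by move=> t; rewrite [q in LHS]surjective_pairing line_point_istep.
have DD w : 'D_w ('D_w u) (line_point z0 v q) = 'D_w ('D_w (fun z => sqn (f z))) (line_point z0 v q)
      + e * 'D_w ('D_w (fun z => sqn (l z))) (line_point z0 v q).
    have Eu : u = 1 \*: (fun z => sqn (f z)) + e \*: (fun z => sqn (l z)).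
      by apply/funext => z; rewrite /u -[RHS]/(1 * sqn (f z) + e * sqn (l z)) mul1r.
    have := @iterD_lin R n W (fun z => sqn (f z)) (fun z => sqn (l z)) 1 e oW sf sl
      [:: w; w] _ Wq; rewrite -Eu /=; move: ('D_w _ _) ('D_w _ _) ('D_w _ _) => x y t ->.
    by rewrite mul1r.
have Ll := laplace_sqn v oW hl Wq; rewrite dl // sqn1 in Ll.
exact: (laplace_contra (DD v) (DD (imul v)) (laplace_sqn v oW hf Wq) Ll (sqn_ge0 _) e0 D1 D2).
Qed.

End MaximumPrinciple.

Lemma holomorphic_onS (R : realType) (n : nat) (W W' : set (Cn R n)) (f : Cn R n -> cplx R) :
  W' `<=` W -> holomorphic_on W f -> holomorphic_on W' f.
Proof.
by move=> S [r m d]; split=> [vs z /S|vs z /S|j z /S]; [exact: r|exact: m|exact: d].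
Qed.

(** * The Schwarz lemma *)

Section Schwarz.
Variables (R : realType) (n : nat).
Local Notation C := (cplx R).
Local Notation Cn := (Cn R n).

Definition axis (k : 'I_n + 'I_n) : Cn :=
  match k with inl j => e_re R j | inr j => e_im R j end.

Definition flat (m : nat) (g : Cn -> R) (z0 : Cn) :=
  forall ws : seq ('I_n + 'I_n), (size ws < m)%N -> iterD (map axis ws) g z0 = 0.

Lemma norm_coord1 (v : Cn) j : `|v.1 0 j| <= `|v|.
Proof.
rewrite prod_normE; apply: (@le_trans _ _ `|v.1|); last by rewrite le_max lexx.
by rewrite [leRHS]/Num.norm /= mx_normrE; exact: (le_bigmax _ (fun ij => `|v.1 ij.1 ij.2|) (0, j)).
Qed.

Lemma norm_coord2 (v : Cn) j : `|v.2 0 j| <= `|v|.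
Proof.
rewrite prod_normE; apply: (@le_trans _ _ `|v.2|); last by rewrite le_max lexx orbT.
by rewrite [leRHS]/Num.norm /= mx_normrE; exact: (le_bigmax _ (fun ij => `|v.2 ij.1 ij.2|) (0, j)).
Qed.

Lemma norm_imul (v : Cn) : `|imul v| = `|v|.
Proof. by rewrite !prod_normE /= normrN maxC. Qed.

Lemma derive_Cn (W : set Cn) (g : Cn -> R) (v z : Cn) : open W -> smooth_on W g -> W z ->
  'D_v g z = \sum_(j < n) v.1 0 j * 'D_(e_re R j) g z + \sum_(j < n) v.2 0 j * 'D_(e_im R j) g z.
Proof.
move=> oW sg Wz; have sc := csmooth_RC oW sg.
apply: (@RC_inj R); rewrite -pd_RC (pd_Cn v oW sc Wz) RCD !RC_sum.
by congr (_ + _); apply: eq_bigr => j _; rewrite pd_RC RCM.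
Qed.

(** Taylor estimate by induction on the order: the first derivatives vanish to
    order m - 1, and the mean value theorem gains one power of the distance. *)
Lemma flat_bound m (W : set Cn) (g : Cn -> R) z0 : open W -> smooth_on W g -> W z0 ->
  flat m g z0 -> exists2 c, 0 <= c & \forall y \near z0, `|g y| <= c * `|y - z0| ^+ m.
Proof.
move=> oW; elim: m g => [|m IH] g sg Wz fg.
  exists (`|g z0| + 1); first by rewrite addr_ge0.
  have /cvgrPdist_lt/(_ _ ltr01) := smooth_on_cont sg Wz.
  apply: filterS => y gy; rewrite expr0 mulr1.
  have := ler_normD (g z0) (g y - g z0); rewrite [g z0 + _]addrC subrK distrC => h.
  by move: gy; rewrite distrC => gy; have := ler_distD (g z0) (g y) 0; rewrite !subr0; lra.
have g0 : g z0 = 0 by exact: (fg [::]).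
have H k : exists c, 0 <= c /\ \forall y \near z0, `|'D_(axis k) g y| <= c * `|y - z0| ^+ m.
  have [|||c c0 Hc] := IH ('D_(axis k) g); [exact: smooth_on_D|by []| |by exists c].
  move=> ws sws; have := fg (rcons ws k); rewrite size_rcons => /(_ sws).
  by rewrite map_rcons; suff -> : forall vs w, iterD (rcons vs w) g = iterD vs ('D_w g)
    by []; elim=> //= v vs E w; rewrite E.
have [c Hc] := choice H.
have cs0 : 0 <= \sum_k c k by apply: sumr_ge0 => k _; case: (Hc k).
exists (\sum_k c k); first by [].
have N : \forall y \near z0, W y /\ forall k, `|'D_(axis k) g y| <= c k * `|y - z0| ^+ m.
  apply: filterI; first exact: open_nbhs_nbhs.
  pose T k : set Cn := [set y | `|'D_(axis k) g y| <= c k * `|y - z0| ^+ m].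
  have HT k : nbhs z0 (T k) by case: (Hc k).
  exact: (@filter_forall Cn _ T (nbhs z0) _ HT).
have /nbhs_ballP[e /= e0 eN] := N.
apply/nbhs_ballP; exists e => //= y; rewrite -ball_normE /ball_ /= => ye.
pose v := y - z0.
have seg t : `|t| <= 1 -> W (t *: v + z0) /\ forall k, `|'D_(axis k) g (t *: v + z0)| <= c k * `|v| ^+ m.
  move=> t1; have tv : `|t *: v| <= `|v| by rewrite normrZ ler_piMl.
  have [|Wt Dt] := eN (t *: v + z0).
    rewrite -ball_normE /ball_ /= distrC addrK; apply: le_lt_trans tv _.
    by rewrite /v distrC.
  split=> // k; apply: le_trans (Dt k) _; rewrite addrK.
  by apply: ler_wpM2l; [case: (Hc k)|rewrite lerXn2r ?nnegrE].
have [t t1|t t1] := @line_MVT_abs _ _ g z0 v 1.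
  by apply: (@smooth_on_derivable _ _ W g _ v sg); case: (seg t) => //; rewrite normr1 in t1.
rewrite normr1 in t1; have [Wt Dt] := seg t t1.
rewrite scale1r /v subrK g0 subr0 mul1r => ->; rewrite -/v (derive_Cn _ oW sg Wt).
have -> : \sum_k c k = \sum_(j < n) c (inl j) + \sum_(j < n) c (inr j) by rewrite big_sumType.
apply: (le_trans (ler_normD _ _)); rewrite mulrDl; apply: lerD.
  apply: (le_trans (ler_norm_sum _ _ _)); rewrite mulr_suml; apply: ler_sum => j _.
  rewrite normrM mulrC exprSr mulrA.
  by apply: ler_pM => //; [exact: (Dt (inl j))|exact: norm_coord1].
apply: (le_trans (ler_norm_sum _ _ _)); rewrite mulr_suml; apply: ler_sum => j _.
rewrite normrM mulrC exprSr mulrA.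
by apply: ler_pM => //; [exact: (Dt (inr j))|exact: norm_coord2].
Qed.

Definition cflat m (f : Cn -> C) z0 := flat m (@re R \o f) z0 /\ flat m (@im R \o f) z0.

Lemma cflat_bound m (W : set Cn) (f : Cn -> C) z0 : open W -> csmooth W f -> W z0 ->
  cflat m f z0 -> exists2 c, 0 <= c & \forall y \near z0, sqn (f y) <= c * (`|y - z0| ^+ m) ^+ 2.
Proof.
move=> oW [sr si] Wz [fr fi].
have [a a0 Ha] := flat_bound oW sr Wz fr; have [b b0 Hb] := flat_bound oW si Wz fi.
exists (a ^+ 2 + b ^+ 2); first by rewrite addr_ge0 ?sqr_ge0.
near=> y; rewrite /sqn -!expr2 -(real_normK (num_real (re _))) -(real_normK (num_real (im _))).
rewrite mulrDl -!exprMn; apply: lerD; rewrite lerXn2r ?nnegrE ?mulr_ge0 ?exprn_ge0 //.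
  by near: y.
by near: y.
Unshelve. all: by end_near. Qed.

Lemma line_point_norm (v z0 : Cn) (p : R * R) : p.1 * p.1 + p.2 * p.2 <= 4 ->
  `|line_point z0 v p - z0| <= 4 * `|v|.
Proof.
move=> p4; rewrite /line_point addrK; apply: (le_trans (ler_normD _ _)).
rewrite !normrZ norm_imul -mulrDl; apply: ler_wpM2r => //.
have a2 : `|p.1| <= 2 by rewrite ler_norml; apply/andP; split; nra.
have b2 : `|p.2| <= 2 by rewrite ler_norml; apply/andP; split; nra.
lra.
Qed.

Lemma line_point_small (v z0 : Cn) (p : R * R) (d : R) : 0 <= d -> p.1 * p.1 + p.2 * p.2 <= d * d ->
  `|line_point z0 v p - z0| <= 2 * d * `|v|.
Proof.
move=> d0 p4; rewrite /line_point addrK; apply: (le_trans (ler_normD _ _)).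
rewrite !normrZ norm_imul -mulrDl; apply: ler_wpM2r => //.
have a2 : `|p.1| <= d by rewrite ler_norml; apply/andP; split; nra.
have b2 : `|p.2| <= d by rewrite ler_norml; apply/andP; split; nra.
lra.
Qed.

(** On the complex line through z0 and y, with coordinate l that is 0 at z0 and
    1 at y, the maximum principle is applied to f / l^k on d <= |l| <= 2. On
    the outer circle it is bounded by M / 4^k; on the inner circle vanishing to
    order k + 1 leaves a bound that tends to 0 with d. Dividing by l^k only,
    one order less than what is available, avoids removing the singularity at
    z0. *)
Lemma schwarz (W : set Cn) (f : Cn -> C) z0 (r M : R) k : open W -> holomorphic_on W f ->
  (forall y, `|y - z0| <= 4 * r -> W y /\ sqn (f y) <= M) -> cflat k.+1 f z0 ->
  forall y, `|y - z0| <= r -> sqn (f y) * 4 ^+ k <= M.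
Proof.
move=> oW hf fM ff y yr.
have r0 : 0 <= r by apply: le_trans yr.
have [Wz fz] : W z0 /\ sqn (f z0) <= M by apply: fM; rewrite subrr normr0 mulr_ge0.
have M0 : 0 <= M by apply: le_trans fz; exact: sqn_ge0.
have [yz|yz] := eqVneq y z0.
  have [fr fi] := ff; rewrite yz.
  have -> : f z0 = 0 by apply: cplx_eq; [exact: (fr [::])|exact: (fi [::])].
  by rewrite /sqn !reimE mulr0 addr0 mul0r.
pose v := y - z0; have v0 : v != 0 by rewrite subr_eq0.
have [j vj] := zcoord_eq0 v0.
pose l z := (zcoord j z - zcoord j z0) / zcoord j v.
have hl W' : open W' -> holomorphic_on W' l.
  move=> oW'; apply: (holM oW') (hol_cst _ oW').
  by apply: (holD oW') (hol_cst _ oW'); exact: zcoord_hol.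
have lc z : {for z, continuous (fun x => sqn (l x))}.
  apply: (smooth_on_cont (W := setT)) => //.
  by apply: smooth_sqn; [exact: openT|apply: hol_csmooth; apply: hl; exact: openT].
pose W' := W `&` [set z | l z != 0].
have oW' : open W'.
  apply: openI => //; rewrite (_ : mkset _ = (fun x => sqn (l x)) @^-1` [set t | 0 < t]).
    by apply: open_comp; [move=> z _; exact: lc|exact: open_gt].
  by apply/seteqP; split=> z /=; rewrite sqn_gt0.
have lpt p : l (line_point z0 v p) = Complex p.1 p.2.
  rewrite /l /line_point -addrA zcoord_lin zcoord_lin zcoord_imul addrA addrK mulrA -mulrDl mulfK //.
  by apply: cplx_eq; rewrite !reimE /re /im /=; ring.
have slpt p : sqn (l (line_point z0 v p)) = p.1 * p.1 + p.2 * p.2 by rewrite lpt.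
have hF : holomorphic_on W' (fun z => f z * (l z)^-1 ^+ k).
  apply: holM => //; first by apply: holomorphic_onS hf => z [].
  by apply: holX => //; apply: holV => // [z []//|]; exact: hl.
have dl z : W' z -> pd v l z = 1.
  move=> Wz'; rewrite /l.
  have h1 : csmooth W' (fun y : Cn => zcoord j y - zcoord j z0).
    by apply: csmoothD => //; [exact: zcoord_csmooth|exact: csmooth_cst].
  rewrite (pdM v h1 (csmooth_cst oW' _) Wz') pd_cst mulr0 addr0.
  rewrite (pdD v (zcoord_csmooth j oW') (csmooth_cst oW' _) Wz') pd_cst addr0.
  by rewrite pd_zcoord mulfV.
have [c c0 Hc] := cflat_bound oW (hol_csmooth hf) Wz ff.
have /nbhs_ballP[e /= e0 eH] := Hc.
have vr : `|v| <= r by [].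
have vp : 0 < `|v| by rewrite normr_gt0.
have key d : 0 < d -> d < 1 -> 2 * d * `|v| < e ->
    sqn (f y) <= Num.max (M / 4 ^+ k) (c * ((2 * `|v|) ^+ k.+1) ^+ 2 * d ^+ 2).
  move=> d0 d1 de.
  (* The annulus is measured in squared radii, so its outer radius is 2. *)
  have A1 : annulus (d * d) 4 ((1, 0) : R * R).
    by rewrite /annulus /= mulr1 mulr0 addr0; apply/andP; split; nra.
  have y1 : line_point z0 v (1, 0) = y by rewrite /line_point /= scale1r scale0r addr0 subrK.
  have := @annulus_max R n W' (fun z => f z * (l z)^-1 ^+ k) l z0 v (d * d) 4
    (Num.max (M / 4 ^+ k) (c * ((2 * `|v|) ^+ k.+1) ^+ 2 * d ^+ 2)) oW' hF (hl _ oW') dl slpt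
    _ _ (1, 0) A1.
  have -> : f (line_point z0 v (1, 0)) * (l (line_point z0 v (1, 0)))^-1 ^+ k = f y.
    have l1 : l (line_point z0 v (1, 0)) = 1 by rewrite lpt.
    by rewrite l1 y1 invr1 expr1n mulr1.
  apply.
    move=> p /andP[p1 p2]; have pr : `|line_point z0 v p - z0| <= 4 * r.
      by apply: le_trans (line_point_norm _ _ p2) _; rewrite ler_pM2l.
    split; first by case: (fM _ pr).
    by rewrite /= -sqn_gt0 slpt; apply: lt_le_trans p1; rewrite mulr_gt0.
  move=> p [pd|p4].
    rewrite le_max; apply/orP; right; rewrite sqnM sqnX sqnV slpt pd.
    have dd0 : 0 < d * d by rewrite mulr_gt0.
    rewrite exprVn ler_pdivrMr ?exprn_gt0 //.
    have pe : `|line_point z0 v p - z0| <= 2 * d * `|v|.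
      by apply: line_point_small; [exact: ltW|rewrite pd].
    have /eH/= : ball z0 e (line_point z0 v p).
      by rewrite -ball_normE /ball_ /= distrC; apply: le_lt_trans pe de.
    move=> /le_trans; apply; rewrite -!mulrA; apply: ler_wpM2l => //.
    apply: (@le_trans _ _ (((2 * d * `|v|) ^+ k.+1) ^+ 2)).
      by rewrite lerXn2r ?nnegrE ?exprn_ge0 ?lerXn2r ?nnegrE ?mulr_ge0 // ltW.
    rewrite le_eqVlt; apply/orP; left; apply/eqP.
    have -> : 2 * d * `|v| = d * (2 * `|v|) by ring.
    by move: (2 * `|v|) => w; rewrite exprMn [(d * d) ^+ k]exprMn expr2 [d ^+ _]exprS; ring.
  rewrite le_max; apply/orP; left; rewrite sqnM sqnX sqnV slpt p4 exprVn.
  rewrite ler_pM2r ?invr_gt0 ?exprn_gt0 //.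
  have pr : `|line_point z0 v p - z0| <= 4 * r.
    by apply: le_trans (line_point_norm _ _ _) _; rewrite ?p4 // ler_pM2l.
  by case: (fM _ pr).
rewrite -ler_pdivlMr ?exprn_gt0 // leNgt; apply/negP => big.
set A := c * ((2 * `|v|) ^+ k.+1) ^+ 2 in key.
have A0 : 0 <= A by rewrite mulr_ge0 ?sqr_ge0.
have fy0 : 0 < sqn (f y) by apply: le_lt_trans big; rewrite divr_ge0 ?exprn_ge0.
(* The three bounds keep the inner circle inside the unit circle, inside the
   ball where the Taylor estimate holds, and so small that its contribution is
   below |f y|^2. *)
pose d := Num.min (2^-1) (Num.min (e / (4 * `|v|)) (sqn (f y) / (2 * (A + 1)))).
have d0 : 0 < d by rewrite !lt_min invr_gt0 ltr0n /= !divr_gt0 ?mulr_gt0 //; lra.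
have d1 : d <= 2^-1 by rewrite ge_min lexx.
have d2 : d <= e / (4 * `|v|) by rewrite !ge_min lexx orbT.
have d3 : d <= sqn (f y) / (2 * (A + 1)) by rewrite !ge_min lexx !orbT.
have h1 : d * (4 * `|v|) <= e by rewrite -ler_pdivlMr ?mulr_gt0.
have h2 : d * (2 * (A + 1)) <= sqn (f y) by rewrite -ler_pdivlMr ?mulr_gt0 //; lra.
have dlt1 : d < 1 by lra.
have dv0 : 0 < d * `|v| by rewrite mulr_gt0.
have dlte : 2 * d * `|v| < e by lra.
have := key d d0 dlt1 dlte.
rewrite le_max => /orP[|]; first by rewrite leNgt big.
have : d * A * d <= d * A by apply: ler_piMr; [apply: mulr_ge0; [exact: ltW|]|exact: ltW].
rewrite expr2; lra.
Qed.

(** The Schwarz estimate holds for every order k, and 4^k is unbounded. *)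
Lemma cflat_eq0 (W : set Cn) (f : Cn -> C) z0 (r M : R) : open W -> holomorphic_on W f ->
  (forall y, `|y - z0| <= 4 * r -> W y /\ sqn (f y) <= M) -> (forall k, cflat k f z0) ->
  forall y, `|y - z0| <= r -> f y = 0.
Proof.
move=> oW hf fM ff y yr; apply/eqP; rewrite -sqn_eq0 eq_le sqn_ge0 andbT leNgt; apply/negP => f0.
have H k : sqn (f y) * k%:R <= M.
  apply: le_trans (schwarz oW hf fM (ff k.+1) yr); rewrite ler_pM2l //.
  by rewrite -natrX ler_nat ltnW // ltn_expl.
have M0 : 0 <= M by have := H 0%N; rewrite mulr0.
have := archi_boundP (divr_ge0 M0 (sqn_ge0 (f y))).
rewrite ltr_pdivrMr // mulrC => /lt_le_trans/(_ (H _)).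
by rewrite ltxx.
Qed.

End Schwarz.

(** * Functionals, subspaces and inner products *)

Section DualSpace.
Variables (R : realType) (W : lmodType (cplx R)).
Local Notation C := (cplx R).
Implicit Types (u v w : W) (s t : dual W).

Lemma dual_of (f : W -> C) : (forall a u v, f (a *: u + v) = a * f u + f v) ->
  exists s : dual W, forall w, s w = f w.
Proof.
move=> lf; have lf' : linear (f : W -> C^o) by move=> a u v; exact: lf.
pose l := GRing.isLinear.Build C W C^o *:%R f lf'.
pose L : {linear W -> C^o} := HB.pack f l.
by exists (L : dual W).
Qed.

Lemma dual_lin s a u v : s (a *: u + v) = a * s u + s v.
Proof. by rewrite /dual_fun linearP. Qed.
Lemma dualDE s t w : dual_fun (s + t) w = s w + t w. Proof. by []. Qed.
Lemma dualZE (a : C) s w : dual_fun (a *: s) w = a * s w. Proof. by []. Qed.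
Lemma dual_0 s : s 0 = 0. Proof. by rewrite /dual_fun linear0. Qed.
Lemma dualZ s (a : C) u : s (a *: u) = a * s u.
Proof. by rewrite /dual_fun linearZ. Qed.
Lemma dualD s u v : s (u + v) = s u + s v.
Proof. by rewrite /dual_fun linearD. Qed.
Lemma dual_sumE (I : Type) (r : seq I) (F : I -> dual W) w :
  dual_fun (\sum_(i <- r) F i) w = \sum_(i <- r) F i w.
Proof. by elim: r => [|i r IH]; rewrite ?big_nil // !big_cons dualDE IH. Qed.
Lemma dual_sum s (I : Type) (r : seq I) (F : I -> W) :
  s (\sum_(i <- r) F i) = \sum_(i <- r) s (F i).
Proof. by elim: r => [|i r IH]; rewrite ?big_nil ?dual_0 // !big_cons dualD IH. Qed.

End DualSpace.

Section Subspaces.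
Variables (R : realType) (W : lmodType (cplx R)).
Local Notation C := (cplx R).
Implicit Types (u v w : W) (V : set W) (ip : W -> W -> C).

Lemma subspaceT : subspace [set: W]. Proof. by split. Qed.

Lemma subspace_sum V (I : Type) (r : seq I) (a : I -> C) (v : I -> W) : subspace V ->
  (forall i, V (v i)) -> V (\sum_(i <- r) a i *: v i).
Proof.
move=> [V0 VL] Vv; elim: r => [|i r IH]; first by rewrite big_nil.
by rewrite big_cons; apply: VL.
Qed.

Lemma ip_suml V ip (I : Type) (r : seq I) (a : I -> C) (v : I -> W) w : subspace V ->
  inner_product V ip -> (forall i, V (v i)) -> V w ->
  ip (\sum_(i <- r) a i *: v i) w = \sum_(i <- r) a i * ip (v i) w.
Proof.
move=> sV [il ih] Vv Vw; have [V0 VL] := sV; elim: r => [|i r IH].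
  rewrite !big_nil; have := il 0 0 0 w V0 V0 Vw.
  rewrite scale0r addr0 mul0r add0r; have := il 1 0 0 w V0 V0 Vw.
  by rewrite scale1r addr0 mul1r => /esym/eqP; rewrite -subr_eq0 addrK => /eqP.
by rewrite !big_cons il // ?IH //; exact: subspace_sum.
Qed.

Lemma ip_sumr V ip (I : Type) (r : seq I) (a : I -> C) (v : I -> W) w : subspace V ->
  inner_product V ip -> (forall i, V (v i)) -> V w ->
  ip w (\sum_(i <- r) a i *: v i) = \sum_(i <- r) (a i)^* * ip w (v i).
Proof.
move=> sV iV Vv Vw; have [il ih] := iV; have Vs := subspace_sum r a sV Vv.
rewrite ih // (ip_suml r a sV iV) // rmorph_sum; apply: eq_bigr => i _ /=.
by rewrite rmorphM /= [ip w (v i)]ih.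
Qed.

Lemma ip_combr V ip (a : C) u v w : subspace V -> inner_product V ip -> V u -> V v -> V w ->
  ip w (a *: u + v) = a^* * ip w u + ip w v.
Proof.
move=> [V0 VL] [il ih] Vu Vv Vw; rewrite ih //; last exact: VL.
by rewrite il // rmorphD rmorphM /= -!ih.
Qed.

Lemma cauchy_schwarz V ip u v : subspace V -> inner_product V ip -> possemidef V ip ->
  V u -> V v -> sqn (ip u v) <= re (ip u u) * re (ip v v).
Proof.
move=> sV iV pV Vu Vv; have [il ih] := iV; have [V0 VL] := sV.
have quad (t : R) : 0 <= re (ip u u) - 2 * t * sqn (ip u v) + t * t * sqn (ip u v) * re (ip v v).
  pose l := - (RC t * ip u v).
  have Vw : V (l *: v + u) by exact: VL.
  have := pV _ Vw; rewrite ge0_RC => /andP[_].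
  rewrite il // !(ip_combr _ sV iV) // (ih u v) //.
  have r0 x : V x -> im (ip x x) = 0 by move=> /pV; rewrite ge0_RC => /andP[/eqP].
  have := r0 u Vu; have := r0 v Vv; rewrite /l /sqn !reimE.
  case: (ip u v) (ip u u) (ip v v) => [a b] [c c'] [d d']; rewrite /re /im /= => -> _ h.
  by apply: le_trans h _; rewrite le_eqVlt; apply/orP; left; apply/eqP; ring.
have d0 : 0 <= re (ip v v) by have := pV _ Vv; rewrite ge0_RC => /andP[].
have a0 : 0 <= re (ip u u) by have := pV _ Vu; rewrite ge0_RC => /andP[].
move: quad d0 a0 (sqn_ge0 (ip u v)); move: (re _) (re _) (sqn _) => d a c quad d0 a0 c0.
move: d0; rewrite le_eqVlt => /orP[/eqP d0|d0].
  rewrite -d0 mulr0 leNgt; apply/negP => cp.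
  have := quad ((a + 1) / (2 * c)); rewrite -d0 mulr0 addr0.
  have -> : 2 * ((a + 1) / (2 * c)) * c = a + 1 by field; rewrite gt_eqF.
  by lra.
have := quad d^-1; have -> : a - 2 * d^-1 * c + d^-1 * d^-1 * c * d = a - c / d.
  by field; rewrite gt_eqF.
by rewrite subr_ge0 ler_pdivrMr.
Qed.

End Subspaces.

Section FiniteDimension.
Variables (R : realType) (W : lmodType (cplx R)) (m : nat).
Local Notation C := (cplx R).
Variable T : W -> 'rV[C]_m.
Hypothesis Tlin : forall (a : C) u v, T (a *: u + v) = a *: T u + T v.
Hypothesis Tinj : forall w, T w = 0 -> w = 0.
Implicit Types (u v w : W) (V : set W) (ip : W -> W -> C).

Let T0 : T 0 = 0.
Proof.
have := Tlin 1 0 0; rewrite scaler0 addr0 scale1r => /esym/eqP.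
by rewrite -subr_eq0 addrK => /eqP.
Qed.

Let Tsum (I : Type) (r : seq I) (a : I -> C) (v : I -> W) :
  T (\sum_(i <- r) a i *: v i) = \sum_(i <- r) a i *: T (v i).
Proof. by elim: r => [|i r IH]; rewrite ?big_nil ?T0 // !big_cons Tlin IH. Qed.

(** The injection T into row vectors encodes finite dimension. A largest family
    of V with independent images is a basis, and its coordinate forms extend to
    the whole space by means of the partial inverse of the matrix of images. *)
Lemma subspace_dual_basis V : subspace V ->
  exists r (v : 'I_r -> W) (g : 'I_r -> dual W),
    [/\ forall l, V (v l), forall k l, g k (v l) = (k == l)%:R &
        forall w, V w -> w = \sum_l g l w *: v l].
Proof.
move=> sV; pose Mx r (v : 'I_r -> W) : 'M[C]_(r, m) := \matrix_l T (v l).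
pose P r := `[< exists v : 'I_r -> W, (forall l, V (v l)) /\ row_free (Mx r v) >].
have P0 : exists r, P r.
  exists 0; apply/asboolP; exists (fun=> 0); split=> [[]//|].
  by rewrite /row_free; move: (Mx _ _) => A; rewrite [A]flatmx0 mxrank0.
have Pm r : P r -> (r <= m)%N.
  by move=> /asboolP[v [_ /eqP <-]]; exact: rank_leq_col.
case: (ex_maxnP P0 Pm) => r /asboolP[v [Vv fv]] rmax.
have span w : V w -> (T w <= Mx r v)%MS.
  move=> Vw; apply/negP => /negP nS; have := rmax r.+1; rewrite ltnn => H; suff : P r.+1 by move/H.
  rewrite -addn1; apply/asboolP.
  pose v' (k : 'I_(r + 1)) := match fintype.split k with inl l => v l | inr _ => w end.
  exists v'; split=> [k|]; first by rewrite /v'; case: fintype.split.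
  have -> : Mx (r + 1)%N v' = col_mx (Mx r v) (T w).
    apply/row_matrixP => k; rewrite rowK /v'; case: fintype.splitP => l kl.
      have -> : k = lshift 1 l by apply: val_inj.
      by rewrite rowKu rowK.
    have -> : k = rshift r l by apply: val_inj.
    by rewrite rowKd row_id.
  rewrite -row_leq_rank -addsmxE.
  have /rank_ltmx : (Mx r v < Mx r v + T w)%MS.
    by rewrite ltmxE addsmxSl addsmx_sub submx_refl.
  by rewrite (eqP fv) addn1.
have lg (l : 'I_r) (a : C) (u w : W) : (T (a *: u + w) *m pinvmx (Mx r v)) 0 l
    = a * (T u *m pinvmx (Mx r v)) 0 l + (T w *m pinvmx (Mx r v)) 0 l.
  by rewrite Tlin mulmxDl -scalemxAl !mxE.
have [g gE] := choice (fun l : 'I_r => dual_of (lg l)).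
exists r, v, g; split=> //.
  move=> k l; rewrite gE; have -> : T (v l) = row l (Mx r v) by rewrite rowK.
  by rewrite -row_mul mulmxVp // !mxE eq_sym.
move=> w Vw; apply/eqP; rewrite -subr_eq0; apply/eqP; apply: Tinj.
rewrite -[w]scale1r addrC -scaleN1r.
rewrite Tlin scale1r Tsum scaleN1r addrC; apply/eqP; rewrite subr_eq0; apply/eqP.
rewrite -{1}(mulmxKpV (span w Vw)); apply/rowP => j; rewrite mxE summxE.
by apply: eq_bigr => l _; rewrite [RHS]mxE gE [Mx r v l j]mxE.
Qed.

Lemma riesz_exists V ip (sigma : dual W) : subspace V -> inner_product V ip -> nondegenerate V ip ->
  exists s, V s /\ forall u, V u -> sigma u = ip u s.
Proof.
move=> sV iV nV; have [r [v [g [Vv gv sp]]]] := subspace_dual_basis sV.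
pose A : 'M[C]_r := \matrix_(k, l) ip (v k) (v l).
have Au : A \in unitmx.
  rewrite -row_free_unit -kermx_eq0; apply/rowV0P => y /sub_kermxP yA.
  have Vy := subspace_sum (index_enum _) (fun k => y 0 k) sV Vv.
  have y0 : \sum_k y 0 k *: v k = 0.
    apply: nV => // u Vu; rewrite (sp u Vu) (ip_sumr _ _ sV iV) //.
    apply: big1 => l _; rewrite (ip_suml _ _ sV iV) //.
    have := congr1 (fun B : 'rV_r => B 0 l) yA; rewrite !mxE => yA0.
    rewrite (_ : \sum_i _ = 0) ?mulr0 // -[RHS]yA0; apply: eq_bigr => k _.
    by rewrite mxE.
  apply/rowP => k; rewrite mxE; have := congr1 (g k) y0; rewrite dual_0 dual_sum.
  rewrite (bigD1 k) //= big1 => [|l lk]; first by rewrite dualZ gv eqxx mulr1 addr0.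
  by rewrite dualZ gv eq_sym (negbTE lk) mulr0.
pose x : 'cV[C]_r := invmx A *m (\col_k sigma (v k)).
exists (\sum_l (x l 0)^* *: v l); split; first exact: subspace_sum.
have sV' k : sigma (v k) = ip (v k) (\sum_l (x l 0)^* *: v l).
  rewrite (ip_sumr _ _ sV iV) //.
  have := congr1 (fun B : 'cV_r => B k 0) (mulKVmx Au (\col_k sigma (v k))).
  rewrite -/x !mxE => <-; apply: eq_bigr => l _.
  by rewrite mxE conjCK mulrC.
move=> u Vu; rewrite (sp u Vu) dual_sum (ip_suml _ _ sV iV) //; last exact: subspace_sum.
by apply: eq_bigr => k _; rewrite dualZ sV'.
Qed.

Lemma rieszP V ip (sigma : dual W) : subspace V -> inner_product V ip -> nondegenerate V ip ->
  V (riesz V ip sigma) /\ forall u, V u -> sigma u = ip u (riesz V ip sigma).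
Proof.
move=> sV iV nV; have [s Hs] := riesz_exists sigma sV iV nV.
exact: (@xgetPex _ 0 [set s | V s /\ forall u, V u -> sigma u = ip u s] (ex_intro _ s Hs)).
Qed.

End FiniteDimension.

(** * Normal forms of semidefinite forms on the dual *)

Section Riesz.
Variables (R : realType) (W : lmodType (cplx R)).
Local Notation C := (cplx R).
Implicit Types (u v w : W) (V : set W) (ip : W -> W -> C).

Lemma posdef_nondegenerate V ip : posdef V ip -> nondegenerate V ip.
Proof.
move=> pV u Vu H; apply/eqP/negPn/negP => u0.
by have := pV u Vu u0; rewrite H // ltxx.
Qed.

Lemma riesz_eq V ip (sigma : dual W) s : subspace V -> inner_product V ip -> nondegenerate V ip ->
  V s -> (forall u, V u -> sigma u = ip u s) -> riesz V ip sigma = s.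
Proof.
move=> sV iV nV Vs Hs; have [V0 VL] := sV; have [il ih] := iV.
have [Vr Hr] := @xgetPex _ 0 [set s | V s /\ forall u, V u -> sigma u = ip u s]
  (ex_intro _ s (conj Vs Hs)).
rewrite -/(riesz V ip sigma) in Vr Hr.
have Vd : V (riesz V ip sigma - s) by rewrite addrC -scaleN1r; exact: VL.
apply/eqP; rewrite -subr_eq0; apply/eqP; apply: nV => // v Vv.
rewrite ih //.
rewrite [X in ip v X]addrC -scaleN1r (ip_combr _ sV iV) // -Hr // -Hs // rmorphN rmorph1.
by rewrite mulN1r addNr conjC0.
Qed.

Lemma orthonormal_coord V ip k (s : 'I_k -> W) (a : 'I_k -> C) j : subspace V ->
  inner_product V ip -> orthonormal_basis V ip s -> ip (\sum_i a i *: s i) (s j) = a j.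
Proof.
move=> sV iV [Vs oN _]; rewrite (ip_suml _ _ sV iV) // (bigD1 j) //= oN eqxx mulr1.
by rewrite big1 ?addr0 // => i ij; rewrite oN (negbTE ij) mulr0.
Qed.

Lemma orthonormal_nondegenerate V ip k (s : 'I_k -> W) : subspace V -> inner_product V ip ->
  orthonormal_basis V ip s -> nondegenerate V ip.
Proof.
move=> sV iV oB u Vu H; have [Vs oN sp] := oB; have [a ua] := sp u Vu.
rewrite ua big1 // => i _; have := orthonormal_coord a i sV iV oB.
by rewrite -ua H // => <-; rewrite scale0r.
Qed.

(** The Riesz vector of sigma is sum_j conj(sigma(s_j)) s_j, so delta is the
    pullback of the standard form under the functionals sigma(s_j). *)
Lemma delta_orthonormal V ip k (s : 'I_k -> W) (sigma tau : dual W) : subspace V ->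
  inner_product V ip -> orthonormal_basis V ip s ->
  delta V ip sigma tau = \sum_j sigma (s j) * (tau (s j))^*.
Proof.
move=> sV iV oB; have nV := orthonormal_nondegenerate sV iV oB; have [Vs oN sp] := oB.
have rE (rho : dual W) : riesz V ip rho = \sum_j (rho (s j))^* *: s j.
  apply: riesz_eq => //; first exact: subspace_sum.
  move=> u Vu; have [a ->] := sp u Vu; rewrite dual_sum (ip_sumr _ _ sV iV) //; last exact: subspace_sum.
  by apply: eq_bigr => j _; rewrite dualZ (orthonormal_coord a j sV iV oB) conjCK mulrC.
rewrite /delta !rE (ip_sumr _ _ sV iV) //; last exact: subspace_sum.
by apply: eq_bigr => j _; rewrite (orthonormal_coord _ j sV iV oB) conjCK.
Qed.

(** The functionals al make the independence of the s_k, and the subspace that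
    they span, explicit. *)
Definition normal_form (G : dual W -> dual W -> C) r (s : 'I_r -> W) (al : 'I_r -> dual W) :=
  (forall k l, al k (s l) = (k == l)%:R) /\
  forall sigma tau, G sigma tau = \sum_k sigma (s k) * (tau (s k))^*.

Definition nf_space r (s : 'I_r -> W) (al : 'I_r -> dual W) : set W :=
  [set w | w = \sum_k al k w *: s k].
Definition nf_ip r (al : 'I_r -> dual W) : W -> W -> C :=
  fun u w => \sum_k al k u * (al k w)^*.

Section NormalForm.
Variables (G : dual W -> dual W -> C) (r : nat) (s : 'I_r -> W) (al : 'I_r -> dual W).
Hypothesis nf : normal_form G s al.
Local Notation V := (nf_space s al).
Local Notation ip := (nf_ip al).

Lemma nf_al_sum (a : 'I_r -> C) k : al k (\sum_l a l *: s l) = a k.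
Proof.
rewrite dual_sum (bigD1 k) //= dualZ nf.1 eqxx mulr1 big1 ?addr0 // => l lk.
by rewrite dualZ nf.1 eq_sym (negbTE lk) mulr0.
Qed.

Lemma nf_spaceP w : V w <-> exists a : 'I_r -> C, w = \sum_k a k *: s k.
Proof.
split=> [Vw|[a ->]]; first by exists (fun k => al k w).
by rewrite /nf_space /=; apply: eq_bigr => k _; rewrite nf_al_sum.
Qed.

Lemma nf_subspace : subspace V.
Proof.
split=> [|a u v Vu Vv].
  by rewrite /nf_space /= big1 // => k _; rewrite dual_0 scale0r.
rewrite /nf_space /= {1}Vu {1}Vv scaler_sumr -big_split; apply: eq_bigr => k _ /=.
by rewrite dual_lin scalerDl scalerA.
Qed.

Lemma nf_inner_productT : inner_product setT ip.
Proof.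
split=> [a u v w _ _ _|u v _ _].
  rewrite /nf_ip mulr_sumr -big_split; apply: eq_bigr => k _ /=.
  by rewrite dual_lin mulrDl mulrA.
by rewrite /nf_ip rmorph_sum; apply: eq_bigr => k _; rewrite rmorphM /= conjCK mulrC.
Qed.

Lemma nf_inner_product : inner_product V ip.
Proof. by have [h1 h2] := nf_inner_productT; split=> *; [exact: h1|exact: h2]. Qed.

Lemma nf_posdef : posdef V ip.
Proof.
move=> u Vu u0; rewrite /nf_ip.
under eq_bigr do rewrite mulr_conj.
rewrite -RC_sum gt0_RC eqxx /= lt0r sumr_ge0 => [|k _]; last exact: sqn_ge0.
rewrite andbT; apply/eqP => S0; move/eqP: u0; apply; rewrite Vu big1 // => k _.
have /eqP := S0; rewrite psumr_eq0 => [/allP/(_ k)|i _]; last exact: sqn_ge0.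
by rewrite mem_index_enum sqn_eq0 => /(_ isT)/eqP ->; rewrite scale0r.
Qed.

Lemma nf_orthonormal : orthonormal_basis V ip s.
Proof.
split=> [k|i j|u Vu].
- apply/nf_spaceP; exists (fun l => (l == k)%:R).
  rewrite (bigD1 k) //= eqxx scale1r big1 ?addr0 // => l /negbTE ->.
  by rewrite scale0r.
- rewrite /nf_ip (bigD1 i) //= !nf.1 eqxx mul1r big1 ?addr0 => [|k ki].
    by rewrite eq_sym conjC_nat.
  by rewrite !nf.1 (negbTE ki) mul0r.
- by exists (fun k => al k u).
Qed.

Lemma nf_delta : G = delta V ip.
Proof.
apply/funext => sigma; apply/funext => tau.
by rewrite (delta_orthonormal _ _ nf_subspace nf_inner_product nf_orthonormal) nf.2.
Qed.

(** Any functional composed with the projection along the span of the s_k kills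
    the s_k, hence v. *)
Lemma nf_mem v : (forall sigma : dual W, (forall k, sigma (s k) = 0) -> sigma v = 0) ->
  (forall w, (forall sigma : dual W, sigma w = 0) -> w = 0) -> V v.
Proof.
move=> H sep; apply/eqP; rewrite -subr_eq0; apply/eqP; apply: sep => b.
have lf (a : C) (u w : W) : b (a *: u + w - \sum_k al k (a *: u + w) *: s k) =
    a * b (u - \sum_k al k u *: s k) + b (w - \sum_k al k w *: s k).
  rewrite -dual_lin; congr (b _); rewrite scalerBr scaler_sumr addrACA -opprD -big_split.
  by congr (_ - _); apply: eq_bigr => k _ /=; rewrite dual_lin scalerDl scalerA.
have [c cE] := dual_of lf; rewrite -cE; apply: H => k; rewrite cE.
have Vk : V (s k) by have [] := nf_orthonormal.
by rewrite -Vk subrr dual_0.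
Qed.

End NormalForm.

End Riesz.

Section DualForms.
Variables (R : realType) (W : lmodType (cplx R)) (N : nat).
Local Notation C := (cplx R).
Variables (b : 'I_N -> W) (be : 'I_N -> dual W).
Hypothesis bbe : forall k l, be k (b l) = (k == l)%:R.
Hypothesis spb : forall w, w = \sum_l be l w *: b l.

Lemma dual_sep w : (forall sigma : dual W, sigma w = 0) -> w = 0.
Proof. by move=> H; rewrite (spb w) big1 // => l _; rewrite H scale0r. Qed.

Lemma dual_expand (sigma : dual W) : sigma = \sum_l sigma (b l) *: be l.
Proof.
apply: dual_inj => w; rewrite dual_sumE {1}(spb w) dual_sum.
by apply: eq_bigr => l _; rewrite dualZ dualZE mulrC.
Qed.

Lemma form_expand (G : dual W -> dual W -> C) (sigma tau : dual W) : inner_product setT G ->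
  G sigma tau = \sum_i \sum_j sigma (b i) * (tau (b j))^* * G (be i) (be j).
Proof.
move=> iG; have sT := @subspaceT R (dual W).
rewrite {1}(dual_expand sigma) (ip_suml _ _ sT iG) //; apply: eq_bigr => i _.
rewrite {1}(dual_expand tau) (ip_sumr _ _ sT iG) // mulr_sumr; apply: eq_bigr => j _.
by rewrite mulrA.
Qed.

(** The spectral theorem diagonalizes the matrix of G in the dual basis; the
    eigenvalues are nonnegative, and the s_k are the eigenvectors with nonzero
    eigenvalue, scaled by its square root. *)
Lemma psd_normal_form (G : dual W -> dual W -> C) : inner_product setT G -> possemidef setT G ->
  exists r (s : 'I_r -> W) al, normal_form G s al.
Proof.
move=> iG pG; have [il ih] := iG.
pose A : 'M[C]_N := \matrix_(i, j) G (be i) (be j).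
have hA : A \is hermsymmx.
  apply/is_hermitianmxP; rewrite expr0 scale1r; apply/matrixP => i j.
  by rewrite !mxE ih.
have /orthomx_spectralP := hermitian_normalmx hA.
set P := spectralmx A; set D := spectral_diag A => AE.
have uP : P \is unitarymx := spectral_unitarymx A.
have iP : invmx P = map_mx Num.conj P^T by exact: invmx_unitary.
pose p k := \sum_i (P k i)^* *: b i.
pose rho (k : 'I_N) : dual W := \sum_i P k i *: be i.
have rho_p k l : rho k (p l) = (k == l)%:R.
  have /unitarymxP/matrixP/(_ k l) := uP; rewrite !mxE => <-.
  rewrite /rho dual_sumE; apply: eq_bigr => i _; rewrite dualZE dual_sum (bigD1 i) //=.
  rewrite dualZ bbe eqxx mulr1 big1 => [|j ji]; first by rewrite addr0 !mxE.
  by rewrite dualZ bbe eq_sym (negbTE ji) mulr0.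
have GE sigma tau : G sigma tau = \sum_k D 0 k * (sigma (p k) * (tau (p k))^*).
  have pE (s : dual W) k : s (p k) = \sum_i (P k i)^* * s (b i).
    by rewrite dual_sum; apply: eq_bigr => i _; rewrite dualZ.
  rewrite form_expand //.
  transitivity (\sum_i \sum_j \sum_k D 0 k * (((P k i)^* * sigma (b i)) * ((P k j)^* * tau (b j))^*)).
    apply: eq_bigr => i _; apply: eq_bigr => j _.
    have -> : G (be i) (be j) = A i j by rewrite mxE.
    rewrite AE iP -mulmxA mul_diag_mx !mxE mulr_sumr; apply: eq_bigr => k _.
    by rewrite !mxE rmorphM /= conjCK; ring.
  under eq_bigr do rewrite exchange_big /=.
  rewrite exchange_big /=; apply: eq_bigr => k _.
  rewrite !pE rmorph_sum mulr_suml mulr_sumr; apply: eq_bigr => i _.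
  by rewrite !mulr_sumr.
have D0 k : 0 <= D 0 k.
  have := pG (rho k) I; rewrite GE (bigD1 k) //= !rho_p eqxx mul1r conjC1 mulr1.
  by rewrite big1 ?addr0 // => l lk; rewrite rho_p eq_sym (negbTE lk) mul0r mulr0.
pose K := [pred k | D 0 k != 0].
pose q k := sqrtC (D 0 k).
have q0 (k : 'I_#|K|) : q (enum_val k) != 0.
  by rewrite sqrtC_eq0; have := enum_valP k; rewrite inE.
have qq k : q k * (q k)^* = D 0 k.
  by rewrite (geC0_conj _) ?sqrtC_ge0 // -expr2 sqrtCK.
exists #|K|, (fun k => q (enum_val k) *: p (enum_val k)), (fun k => (q (enum_val k))^-1 *: rho (enum_val k)).
split=> [k l|sigma tau].
  rewrite dualZE dualZ rho_p (inj_eq enum_val_inj) mulrCA.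
  by have [->|_] := eqVneq k l; rewrite ?mulr0 // mulr1 mulfV.
rewrite GE; transitivity (\sum_(k in K) D 0 k * (sigma (p k) * (tau (p k))^*)).
  rewrite (bigID (mem K)) /= [X in _ + X]big1 ?addr0 // => k.
  by rewrite inE negbK => /eqP ->; rewrite mul0r.
rewrite big_enum_val /=; apply: eq_bigr => k _.
by rewrite !dualZ rmorphM /= -qq; ring.
Qed.

End DualForms.

Lemma conjM (R : realType) (x y : cplx R) : (x * y)^* = x^* * y^*.
Proof. by rewrite rmorphM. Qed.

(** * The Levi form of log sum |f_a|^2 *)

Section LeviLog.
Variables (R : realType) (n m : nat).
Local Notation C := (cplx R).
Local Notation Cn := (Cn R n).
Variables (W : set Cn) (f : 'I_m -> Cn -> C).
Hypotheses (oW : open W) (hf : forall a, holomorphic_on W (f a)).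

Definition sumsq (z : Cn) : R := \sum_a sqn (f a z).
Hypothesis S0 : forall z, W z -> 0 < sumsq z.

Let sf a : csmooth W (f a) := hol_csmooth (hf a).

Lemma sumsq_smooth : smooth_on W sumsq.
Proof.
have [r _] := csmooth_sum oW (index_enum _) (fun a => csmoothM oW (sf a) (csmoothJ oW (sf a))).
apply: smooth_on_eq r => // z _ /=; rewrite re_sum; apply: eq_bigr => a _.
by rewrite mulr_conj.
Qed.

Let sS : csmooth W (fun z => RC (sumsq z)) := csmooth_RC oW sumsq_smooth.
Let sV : csmooth W (fun z => RC (sumsq z)^-1).
Proof.
apply: (csmooth_RC oW); apply: (smooth_onV oW) sumsq_smooth => z Wz.
by rewrite gt_eqF // S0.
Qed.

Let SE z : RC (sumsq z) = \sum_a f a z * (f a z)^*.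
Proof. by rewrite RC_sum; apply: eq_bigr => a _; rewrite mulr_conj. Qed.

Lemma dz_sumsq j z : W z -> dz j (fun y => RC (sumsq y)) z = \sum_a dz j (f a) z * (f a z)^*.
Proof.
move=> Wz; rewrite (dz_eq oW j (g := fun y => \sum_a f a y * (f a y)^*)) //.
have sP a := csmoothM oW (sf a) (csmoothJ oW (sf a)).
rewrite (dz_sum oW j _ sP Wz); apply: eq_bigr => a _.
rewrite (dzM j (sf a) (csmoothJ oW (sf a)) Wz) (dzJ j (sf a) Wz).
by have [_ _ ->] := hf a; rewrite // conjC0 mulr0 addr0.
Qed.

Lemma dzbar_sumsq k z : W z -> dzbar k (fun y => RC (sumsq y)) z = \sum_a f a z * (dz k (f a) z)^*.
Proof.
move=> Wz; rewrite (dzbar_eq oW k (g := fun y => \sum_a f a y * (f a y)^*)) //.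
have sP a := csmoothM oW (sf a) (csmoothJ oW (sf a)).
rewrite (dzbar_sum oW k _ sP Wz); apply: eq_bigr => a _.
rewrite (dzbarM k (sf a) (csmoothJ oW (sf a)) Wz) (dzbarJ k (sf a) Wz).
by have [_ _ ->] := hf a; rewrite // mul0r add0r.
Qed.

Lemma dzbar_ln k z : W z -> dzbar k (fun y => Complex (ln (sumsq y)) 0) z =
  (\sum_a f a z * (dz k (f a) z)^*) * RC (sumsq z)^-1.
Proof.
move=> Wz; rewrite -dzbar_sumsq //.
have H v : pd v (fun y => RC (ln (sumsq y))) z = pd v (fun y => RC (sumsq y)) z * RC (sumsq z)^-1.
  rewrite !pd_RC -RCM mulrC; congr RC.
  have [_ ->] // := is_derive_ln (@smooth_on_derivable _ _ W sumsq z v sumsq_smooth Wz) (S0 Wz).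
by rewrite /dzbar !H mulrA -mulrDl mulrAC.
Qed.

Lemma ddbar_ln_sumsq j k z : W z -> ddbar (fun y => ln (sumsq y)) z j k =
  (\sum_a dz j (f a) z * (dz k (f a) z)^*) * RC (sumsq z)^-1 -
  (\sum_a f a z * (dz k (f a) z)^*) * (\sum_a dz j (f a) z * (f a z)^*) * RC (sumsq z)^-1 ^+ 2.
Proof.
move=> Wz; rewrite mxE.
have hd a := hol_dz_hol k oW (hf a).
have sd a : csmooth W (dz k (f a)) := hol_csmooth (hd a).
have sP a := csmoothM oW (sf a) (csmoothJ oW (sd a)).
rewrite (dz_eq oW j (g := fun y => (\sum_a f a y * (dz k (f a) y)^*) * RC (sumsq y)^-1)) //; last first.
  by move=> y; exact: dzbar_ln.
rewrite (dzM j (csmooth_sum oW _ sP) sV Wz) (dz_sum oW j _ sP Wz).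
have -> : dz j (fun z0 => RC (sumsq z0)^-1) z =
    - ((\sum_a dz j (f a) z * (f a z)^*) * RC (sumsq z)^-1 ^+ 2).
  have E : dz j (fun y => RC (sumsq y) * RC (sumsq y)^-1) z = 0.
    rewrite (dz_eq oW j (g := fun=> 1)) // => [|y Wy].
      by rewrite /dz !pd_cst mulr0 subr0 mul0r.
    by rewrite -RCM mulfV ?RC1 // gt_eqF // S0.
  move: E; rewrite (dzM j sS sV Wz) (dz_sumsq j Wz).
  move: (dz j _ z) => t; have Sn : RC (sumsq z) != 0 by rewrite RC_eq0 gt_eqF // S0.
  rewrite RCV; move: (RC (sumsq z)) (\sum_a _) Sn => S T Sn /eqP.
  rewrite addrC addr_eq0 => /eqP E.
  by apply: (mulfI Sn); rewrite E; field.
rewrite mulrN mulrA; congr (_ * _ - _); apply: eq_bigr => a _.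
rewrite (dzM j (sf a) (csmoothJ oW (sd a)) Wz) (dzJ j (sd a) Wz).
by have [_ _ ->] := hd a; rewrite // conjC0 mulr0 addr0.
Qed.

Definition levi (A : 'M[C]_n) (v : 'rV[C]_n) : C :=
  \sum_(j < n) \sum_(k < n) A j k * v 0 j * (v 0 k)^*.

(** The derivative of g in the direction of v in T^{1,0}. *)
Definition dir_derive (v : 'rV[C]_n) (g : Cn -> C) (z : Cn) : C := \sum_j dz j g z * v 0 j.

(** The quotient rule gives (sum |q_a|^2) / S - |c|^2 / S^2; this is the Gram
    determinant of the vectors p and q divided by S^2, rewritten as a sum of
    squares. *)
Lemma levi_ln_sumsq (v : 'rV[C]_n) z : W z ->
  let p a := f a z in let q a := dir_derive v (f a) z in
  let c := \sum_a q a * (p a)^* in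
  levi (ddbar (fun y => ln (sumsq y)) z) v =
  RC ((\sum_a sqn (RC (sumsq z) * q a - c * p a)) / sumsq z ^+ 3).
Proof.
move=> Wz p q c; set S := sumsq z; pose Sc := RC S.
have Sn : Sc != 0 by rewrite RC_eq0 gt_eqF // S0.
pose Q := \sum_a q a * (q a)^*.
have cJ : c^* = \sum_a p a * (q a)^*.
  by rewrite rmorph_sum; apply: eq_bigr => a _; rewrite /= conjM conjCK mulrC.
have L : levi (ddbar (fun y => ln (sumsq y)) z) v = Q * Sc^-1 - c^* * c * Sc^-1 ^+ 2.
  have Q1 : \sum_(j < n) \sum_(k < n) (\sum_a dz j (f a) z * (dz k (f a) z)^*) * v 0 j * (v 0 k)^* = Q.
    rewrite /Q.
    transitivity (\sum_(j < n) \sum_(k < n) \sum_a (dz j (f a) z * v 0 j) * (dz k (f a) z * v 0 k)^*).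
      apply: eq_bigr => j _; apply: eq_bigr => k _.
      rewrite !mulr_suml; apply: eq_bigr => a _; rewrite conjM.
      by move: (dz j _ _) (dz k _ _) (v 0 k) (v 0 j) => x1 x2 x3 x4; ring.
    under eq_bigr do rewrite exchange_big /=.
    rewrite exchange_big /=; apply: eq_bigr => a _.
    rewrite /q /dir_derive rmorph_sum mulr_suml; apply: eq_bigr => j _.
    by rewrite mulr_sumr.
  have Q2 : \sum_(j < n) \sum_(k < n) (\sum_a f a z * (dz k (f a) z)^*) *
      (\sum_a dz j (f a) z * (f a z)^*) * v 0 j * (v 0 k)^* = c^* * c.
    have E1 : c = \sum_j (\sum_a dz j (f a) z * (f a z)^*) * v 0 j.
      rewrite /c /q /dir_derive; under eq_bigr do rewrite mulr_suml.
      rewrite exchange_big /=; apply: eq_bigr => j _; rewrite mulr_suml.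
      by apply: eq_bigr => a _; rewrite /p mulrAC.
    have E2 : c^* = \sum_k (\sum_a f a z * (dz k (f a) z)^*) * (v 0 k)^*.
      rewrite cJ /q /dir_derive; under eq_bigr do rewrite rmorph_sum mulr_sumr.
      rewrite exchange_big /=; apply: eq_bigr => k _; rewrite mulr_suml.
      by apply: eq_bigr => a _; rewrite conjM /p mulrA.
    rewrite E2 {1}E1 mulrC mulr_suml; apply: eq_bigr => j _; rewrite mulr_sumr.
    by apply: eq_bigr => k _; ring.
  rewrite /levi -Q1 -Q2 !mulr_suml -sumrB; apply: eq_bigr => j _.
  rewrite !mulr_suml -sumrB; apply: eq_bigr => k _.
  by rewrite ddbar_ln_sumsq // RCV; ring.
rewrite L.
have E : RC (\sum_a sqn (Sc * q a - c * p a)) = Sc ^+ 2 * Q - Sc * (c^* * c).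
  rewrite RC_sum; under eq_bigr do rewrite -mulr_conj.
  have E1 a : (Sc * q a - c * p a) * (Sc * q a - c * p a)^* =
    Sc ^+ 2 * (q a * (q a)^*) - Sc * c^* * (q a * (p a)^*)
    - Sc * c * (p a * (q a)^*) + c * c^* * (p a * (p a)^*).
    have ScJ : Sc^* = Sc by apply: cplx_eq; rewrite !reimE ?oppr0.
    by rewrite rmorphB !rmorphM /= ScJ; ring.
  under eq_bigr do rewrite E1.
  rewrite big_split /= !sumrB -!mulr_sumr -/Q -/c -cJ.
  have -> : \sum_a p a * (p a)^* = Sc by rewrite /Sc SE.
  by ring.
rewrite RCM E RCV -[RC (S ^+ 3)]/(RC (S * (S * S))) !RCM -/Sc.
by field.
Qed.

(** By the sum of squares formula the Levi form vanishes along v exactly when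
    the vector of derivatives is proportional to the vector of values. If it is
    not, its component w orthogonal to the values gives the combination t =
    conj(w); if it is, every combination that kills the values kills the
    derivatives. *)
Lemma levi_gt0P (v : 'rV[C]_n) z : W z ->
  0 < levi (ddbar (fun y => ln (sumsq y)) z) v <->
  exists t : 'I_m -> C, \sum_a t a * f a z = 0 /\ \sum_a t a * dir_derive v (f a) z != 0.
Proof.
move=> Wz; rewrite (levi_ln_sumsq v Wz) /=.
set c := \sum_a dir_derive v (f a) z * (f a z)^*; set S := RC (sumsq z).
have S3 : 0 < sumsq z ^+ 3 by rewrite exprn_gt0 // S0.
have Sn : S != 0 by rewrite RC_eq0 gt_eqF // S0.
rewrite gt0_RC eqxx /= pmulr_lgt0 ?invr_gt0 //.
have s0 a : true -> 0 <= sqn (S * dir_derive v (f a) z - c * f a z) by rewrite sqn_ge0.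
rewrite lt0r sumr_ge0 // andbT psumr_eq0 //.
split=> [/allPn[a _]|[t [t0 t1]]].
  rewrite sqn_eq0 => wa.
  pose w a := S * dir_derive v (f a) z - c * f a z.
  have cJ : c^* = \sum_a f a z * (dir_derive v (f a) z)^*.
    by rewrite rmorph_sum; apply: eq_bigr => b _; rewrite /= conjM conjCK mulrC.
  have ScJ : S^* = S by apply: cplx_eq; rewrite !reimE ?oppr0.
  have w0 : \sum_a (w a)^* * f a z = 0.
    transitivity (S * c^* - c^* * S); last by rewrite mulrC subrr.
    rewrite cJ mulr_sumr /S SE mulr_sumr -sumrB; apply: eq_bigr => b _.
    by rewrite -cJ -SE -/S /w rmorphB !rmorphM /= ScJ; ring.
  exists (fun a => (w a)^*); split=> //.
  have : S * (\sum_a (w a)^* * dir_derive v (f a) z) != 0.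
    have -> : S * (\sum_a (w a)^* * dir_derive v (f a) z) = RC (\sum_a sqn (w a)).
      transitivity (\sum_b ((w b)^* * w b + c * ((w b)^* * f b z))).
        rewrite mulr_sumr; apply: eq_bigr => b _; rewrite {3}/w.
        by move: (w b)^* (dir_derive _ _ _) (f b z) => x1 x2 x3; ring.
      rewrite big_split /= -mulr_sumr w0 mulr0 addr0 RC_sum.
      by apply: eq_bigr => b _; rewrite mulrC mulr_conj.
    rewrite RC_eq0 psumr_eq0 => [|b _]; last exact: sqn_ge0.
    by apply/allPn; exists a; rewrite ?mem_index_enum //= sqn_eq0.
  by rewrite mulf_eq0 negb_or => /andP[].
apply/negP => /allP H.
have E a : S * dir_derive v (f a) z = c * f a z.
  by have := H a; rewrite mem_index_enum sqn_eq0 subr_eq0 => /(_ isT)/eqP.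
move/eqP: t1; apply; apply: (mulfI Sn); rewrite mulr0 mulr_sumr.
transitivity (c * \sum_a t a * f a z); last by rewrite t0 mulr0.
by rewrite mulr_sumr; apply: eq_bigr => a _; rewrite mulrCA E mulrCA.
Qed.

End LeviLog.

(** * Jets and polarization *)

Section Jets.
Variables (R : realType) (n : nat).
Local Notation C := (cplx R).
Local Notation Cn := (Cn R n).
Implicit Types (W : set Cn) (f g : Cn -> C) (z : Cn).

(** Taken along the real coordinate directions, like the order of vanishing in
    the Schwarz lemma. *)
Definition cjet (ws : seq ('I_n + 'I_n)) f z : C :=
  Complex (iterD (map (@axis R n) ws) (@re R \o f) z) (iterD (map (@axis R n) ws) (@im R \o f) z).

Lemma cjet_cons k ws f : cjet (k :: ws) f = pd (axis R k) (cjet ws f).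
Proof. by []. Qed.

Lemma cjet_nil f z : cjet [::] f z = f z.
Proof. by apply: cplx_eq. Qed.

Lemma cjet_hol W ws f : open W -> holomorphic_on W f -> holomorphic_on W (cjet ws f).
Proof.
move=> oW hf; elim: ws => [|k ws IH]; last exact: (hol_pd (axis R k) oW IH).
by apply: (hol_eq oW _ hf) => z _; rewrite cjet_nil.
Qed.

Lemma cjet_eq W ws f g z : open W -> (forall y, W y -> f y = g y) -> W z ->
  cjet ws f z = cjet ws g z.
Proof.
move=> oW fg; elim: ws z => [|k ws IH] z Wz; first by rewrite !cjet_nil fg.
by rewrite !cjet_cons; apply: (pd_eq oW).
Qed.

Lemma cjet_lin W ws (a : C) f g z : open W -> holomorphic_on W f -> holomorphic_on W g -> W z ->
  cjet ws (fun y => a * f y + g y) z = a * cjet ws f z + cjet ws g z.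
Proof.
move=> oW hf hg; elim: ws z => [|k ws IH] z Wz; first by rewrite !cjet_nil.
rewrite !cjet_cons; apply: etrans (pd_eq oW _ IH Wz) _.
exact: (pd_lin a _ (cjet_hol ws oW hf) (cjet_hol ws oW hg) Wz).
Qed.

Lemma cjet0 W ws f z : open W -> (forall y, W y -> f y = 0) -> W z -> cjet ws f z = 0.
Proof.
move=> oW f0; elim: ws z => [|k ws IH] z Wz; first by rewrite cjet_nil f0.
rewrite cjet_cons; apply: etrans (pd_eq oW _ (g := fun=> 0) IH Wz) _; exact: pd_cst.
Qed.

Lemma cjet_cflat m f z : (forall ws, (size ws < m)%N -> cjet ws f z = 0) -> cflat m f z.
Proof. by move=> H; split=> ws sws; have [] := H ws sws. Qed.

(** The derivative of the vanishing sum along v is A + B, with A from the p_i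
    and B from the conjugates of the q_i; along i v it is i A - i B. Hence A =
    0. *)
Lemma polarize W (I : finType) (p q : I -> Cn -> C) v : open W ->
  (forall i, holomorphic_on W (p i)) -> (forall i, holomorphic_on W (q i)) ->
  (forall z, W z -> \sum_i p i z * (q i z)^* = 0) ->
  forall z, W z -> \sum_i pd v (p i) z * (q i z)^* = 0.
Proof.
move=> oW hp hq H z Wz.
have sp i := hol_csmooth (hp i); have sq i := hol_csmooth (hq i).
have sP i := csmoothM oW (sp i) (csmoothJ oW (sq i)).
have D w : \sum_i pd w (p i) z * (q i z)^* + \sum_i p i z * (pd w (q i) z)^* = 0.
  rewrite -big_split /=.
  transitivity (pd w (fun y => \sum_i p i y * (q i y)^*) z).
    rewrite (pd_sum oW _ w sP Wz); apply: eq_bigr => i _.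
    by rewrite (pdM w (sp i) (csmoothJ oW (sq i)) Wz) (pdJ w (sq i) Wz).
  by rewrite (pd_eq oW w (g := fun=> 0)) ?pd_cst.
have Ep i : pd (imul v) (p i) z = 'i * pd v (p i) z := hol_pd_imul v oW (hp i) Wz.
have Eq i : pd (imul v) (q i) z = 'i * pd v (q i) z := hol_pd_imul v oW (hq i) Wz.
have D1 : 'i * (\sum_i pd v (p i) z * (q i z)^* - \sum_i p i z * (pd v (q i) z)^*) = 0.
  rewrite -[RHS](D (imul v)) mulrBr !mulr_sumr -sumrN; apply: congr2; apply: eq_bigr => i _.
    by rewrite Ep mulrA.
  by rewrite Eq conjM conj_i mulNr mulrN mulrCA.
have := D v; move: D1; move: (\sum_i _) (\sum_i _) => x y /eqP.
rewrite mulf_eq0 (negbTE (neq0Ci _)) subr_eq0 => /eqP -> /eqP.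
by rewrite -mulr2n -mulr_natl mulf_eq0 pnatr_eq0 /= => /eqP.
Qed.

Lemma polarize_jets W (I : finType) (p q : I -> Cn -> C) ws ws' : open W ->
  (forall i, holomorphic_on W (p i)) -> (forall i, holomorphic_on W (q i)) ->
  (forall z, W z -> \sum_i p i z * (q i z)^* = 0) ->
  forall z, W z -> \sum_i cjet ws (p i) z * (cjet ws' (q i) z)^* = 0.
Proof.
move=> oW hp hq H.
have swap (f g : I -> Cn -> C) : (forall z, W z -> \sum_i f i z * (g i z)^* = 0) ->
    forall z, W z -> \sum_i g i z * (f i z)^* = 0.
  move=> H1 z Wz; transitivity ((\sum_i f i z * (g i z)^*)^*); last by rewrite H1 // conjC0.
  rewrite rmorph_sum; apply: eq_bigr => i _.
  by rewrite /= conjM conjCK mulrC.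
have step (f g : I -> Cn -> C) vs : (forall i, holomorphic_on W (f i)) -> (forall i, holomorphic_on W (g i)) ->
    (forall z, W z -> \sum_i f i z * (g i z)^* = 0) ->
    forall z, W z -> \sum_i cjet vs (f i) z * (g i z)^* = 0.
  move=> hf hg; elim: vs => [|k vs IH] H1 z Wz.
    by rewrite -[RHS](H1 z Wz); apply: eq_bigr => i _; rewrite cjet_nil.
  apply: (polarize _ oW _ hg (IH H1) Wz) => i; exact: cjet_hol.
apply: (swap (fun i => cjet ws' (q i)) (fun i => cjet ws (p i))).
apply: (step q (fun i => cjet ws (p i)) ws' hq (fun i => cjet_hol ws oW (hp i))).
exact: (swap (fun i => cjet ws (p i)) q (step p q ws hp hq H)).
Qed.

End Jets.

(** * Sections of the line bundle *)

Section Geometry.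
Variables (R : realType) (X : topologicalType) (n : nat).
Variables (M : complex_atlas R X n) (E : line_bundle M) (h : hermitian_metric E).
Local Notation C := (cplx R).
Local Notation Cn := (Cn R n).
Local Notation OE := (hsec E).
Implicit Types (x : X) (s t : OE) (i : frame_idx E) (c : chart M).

Lemma hsec_addE s t x : (s + t) x = s x + t x.
Proof. by rewrite -[LHS]/(1 *: s x + t x) scale1r. Qed.
Lemma hsec_scaleE (a : C) s x : (a *: s) x = a *: s x.
Proof. by rewrite -[LHS]/(a *: s x + 0) addr0. Qed.
(** Coefficient of a section in a frame. It is a chosen function, hence only
    meaningful on the domain of the frame. *)
Definition coef i s : X -> C := projT1 (cid2 (hsecP s i)).

Lemma coefE i s x : frame_dom i x -> s x = coef i s x *: frame i x.
Proof. by rewrite /coef; case: cid2 => f hf fE /= ix; exact: fE. Qed.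

Definition frame_chart c i : set Cn := chart_cod c `&` chart_of c @^-1` frame_dom i.

Lemma frame_chart_open c i : open (frame_chart c i).
Proof. by apply: open_chart_pre; exact: frame_dom_open. Qed.

Lemma coef_hol c i s : holomorphic_on (frame_chart c i) (coef i s \o chart_of c).
Proof. by rewrite /coef; case: cid2 => f hf fE /=; have := hf c; rewrite setTI. Qed.

Lemma line_inj i x (a b : C) : frame_dom i x -> a *: frame i x = b *: frame i x -> a = b.
Proof.
move=> ix /eqP; rewrite -subr_eq0 -scalerBl => /eqP ab.
apply/eqP; rewrite -subr_eq0; apply/negPn/negP => ab0; have /eqP := frame_neq0 ix; apply.
by rewrite -[frame i x]scale1r -(mulVf ab0) -scalerA ab scaler0.
Qed.

Lemma coef_eq i s x (a : C) : frame_dom i x -> s x = a *: frame i x -> coef i s x = a.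
Proof. by move=> ix sa; apply: (line_inj ix); rewrite -coefE. Qed.

Lemma coef_lin i (a : C) s t x : frame_dom i x ->
  coef i (a *: s + t) x = a * coef i s x + coef i t x.
Proof.
move=> ix; apply: (coef_eq ix).
by rewrite hsec_addE hsec_scaleE (coefE s ix) (coefE t ix) scalerA scalerDl.
Qed.

Lemma coef_eq0 i s x : frame_dom i x -> (coef i s x == 0) = (s x == 0).
Proof.
move=> ix; apply/eqP/eqP => [e|e]; first by rewrite (coefE s ix) e scale0r.
by apply: (coef_eq ix); rewrite scale0r.
Qed.

Definition frame_normsq i x : R := re (h x (frame i x) (frame i x)).

Lemma herm_frame i x : frame_dom i x -> h x (frame i x) (frame i x) = RC (frame_normsq i x) /\ 0 < frame_normsq i x.
Proof.
move=> ix; have := herm_gt0 h (frame_neq0 ix); rewrite gt0_RC => /andP[/eqP e1 e2].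
by split=> //; apply: cplx_eq; rewrite !reimE.
Qed.

Lemma hermZ x (a b : C) (u v : fiber E x) : h x (a *: u) (b *: v) = a * b^* * h x u v.
Proof.
have h0 w : h x 0 w = 0.
  have := herm_linear h 1 0 0 w; rewrite scale1r addr0 mul1r => /esym/eqP.
  by rewrite -subr_eq0 addrK => /eqP.
have Zl (d : C) u' w : h x (d *: u') w = d * h x u' w.
  by rewrite -[d *: u']addr0 herm_linear h0 addr0.
by rewrite Zl herm_sym Zl conjM -herm_sym mulrA.
Qed.

Lemma herm_coef i s t x : frame_dom i x ->
  h x (s x) (t x) = RC (frame_normsq i x) * (coef i s x * (coef i t x)^*).
Proof.
by move=> ix; rewrite {1}(coefE s ix) {1}(coefE t ix) hermZ (herm_frame ix).1 mulrC.
Qed.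

Lemma re_herm_coef i s x : frame_dom i x -> re (h x (s x) (s x)) = frame_normsq i x * sqn (coef i s x).
Proof. by move=> ix; rewrite (herm_coef _ _ ix) mulr_conj -RCM. Qed.

Lemma frame_normsq_smooth c i : smooth_on (frame_chart c i) (frame_normsq i \o chart_of c).
Proof. exact: herm_smooth. Qed.

Lemma chart_to_frame_chart c i x : chart_dom c x -> frame_dom i x -> frame_chart c i (chart_to c x).
Proof.
by move=> cx ix; split; [exact: chart_to_cod|rewrite /= chart_toK].
Qed.

Lemma chart_to_cvg c x : chart_dom c x -> {for x, continuous (chart_to c)}.
Proof. by move=> cx; apply: chart_to_continuous; exact/mem_set. Qed.

Lemma near_chart c x (P : Cn -> Prop) : chart_dom c x ->
  (\forall z \near chart_to c x, P z) -> \forall y \near x, chart_dom c y /\ P (chart_to c y).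
Proof.
move=> cx HP; apply: filterI; last exact: (chart_to_cvg cx HP).
by apply: open_nbhs_nbhs; split=> //; exact: chart_dom_open.
Qed.

Lemma normsq_continuous s : continuous (fun x => re (h x (s x) (s x))).
Proof.
move=> x; have [c cx] := chart_cover M x; have [i ix] := frame_cover E x.
have oW := @frame_chart_open c i; have Wx := chart_to_frame_chart cx ix.
have sm : smooth_on (frame_chart c i) (fun z => frame_normsq i (chart_of c z) * sqn (coef i s (chart_of c z))).
  exact: (smooth_onM oW (@frame_normsq_smooth c i) (smooth_sqn oW (hol_csmooth (coef_hol c i s)))).
have cg := smooth_on_cont sm Wx.
have : (fun y => frame_normsq i (chart_of c (chart_to c y)) * sqn (coef i s (chart_of c (chart_to c y)))) @ x
    --> re (h x (s x) (s x)).
  have := @cvg_comp _ _ _ (chart_to c) _ _ _ _ (chart_to_cvg cx) cg.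
  by rewrite /= chart_toK // (re_herm_coef s ix).
apply: cvg_trans; apply: near_eq_cvg.
have N : nbhs x (chart_dom c `&` frame_dom i).
  by apply: filterI; apply: open_nbhs_nbhs; split=> //; [exact: chart_dom_open|exact: frame_dom_open].
by apply: filterS N => y [cy iy]; rewrite (re_herm_coef s iy) chart_toK.
Qed.

Lemma jet_lin c i ws (a : C) s t z : frame_chart c i z ->
  cjet ws (coef i (a *: s + t) \o chart_of c) z =
  a * cjet ws (coef i s \o chart_of c) z + cjet ws (coef i t \o chart_of c) z.
Proof.
move=> Wz; have oW := @frame_chart_open c i.
rewrite -(cjet_lin ws a oW (coef_hol c i s) (coef_hol c i t) Wz).
by apply: (cjet_eq ws oW _ Wz) => y [cy iy] /=; rewrite coef_lin.
Qed.

Lemma near_le_ball (z : Cn) (P : set Cn) : nbhs z P -> exists2 r : R, 0 < r &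
  forall y, `|y - z| <= r -> P y.
Proof.
move=> /nbhs_ballP[e /= e0 eP]; exists (e / 2); first by rewrite divr_gt0.
move=> y ye; apply: eP; rewrite -ball_normE /ball_ /= distrC.
by apply: le_lt_trans ye _; lra.
Qed.

(** On each of finitely many balls that cover X, the squared norm of the frame
    varies by a factor of at most 4. Let s have zero 2-jets at the centres, and
    let K be the maximum of its squared norm, reached at x1. In the ball that
    contains x1 the coefficient satisfies |f|^2 <= 2 K / H with H the squared
    norm of the frame at the centre, and the Schwarz lemma at order 3 divides
    this by 4^2, so that K <= 2 H |f(x1)|^2 <= K / 4, which forces K = 0. So
    the 2-jets at the centres are a linear injection of O(E). *)
Lemma sections_finite_dim (X_compact : compact [set: X]) :
  exists m (T : OE -> 'rV[C]_m), (forall (a : C) s t, T (a *: s + t) = a *: T s + T t) /\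
    forall s, T s = 0 -> s = 0.
Proof.
have [[x0 _]|noX] := pselect (exists x : X, True); last first.
  exists 0%N, (fun=> 0); split=> [a s t|s _]; first by rewrite scaler0 addr0.
  by apply: hsec_inj => x; case: noX; exists x.
pose pX : ptopologicalType := HB.pack X (isPointed.Build X x0).
have [cx Hcx] := choice (fun x => chart_cover M x).
have [ix Hix] := choice (fun x => frame_cover E x).
pose zx x := chart_to (cx x) x.
have Wx x : frame_chart (cx x) (ix x) (zx x) by exact: chart_to_frame_chart.
have loc x : exists r : R, 0 < r /\ forall y, `|y - zx x| <= 4 * r ->
    frame_chart (cx x) (ix x) y /\ frame_normsq (ix x) x / 2 <= frame_normsq (ix x) (chart_of (cx x) y) <= 2 * frame_normsq (ix x) x.
  have H0 := (herm_frame (Hix x)).2.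
  have N : \forall y \near zx x, frame_chart (cx x) (ix x) y /\
      frame_normsq (ix x) x / 2 <= frame_normsq (ix x) (chart_of (cx x) y) <= 2 * frame_normsq (ix x) x.
    apply: filterI; first by apply: open_nbhs_nbhs; split=> //; exact: frame_chart_open.
    have := smooth_on_cont (@frame_normsq_smooth (cx x) (ix x)) (Wx x).
    have h20 : 0 < frame_normsq (ix x) x / 2 by rewrite divr_gt0.
    move=> /cvgrPdist_le/(_ _ h20); apply: filterS => y.
    rewrite /zx /= chart_toK // ler_distl => /andP[h1 h2].
    by apply/andP; split; lra.
  have [r r0 rN] := near_le_ball N.
  exists (r / 4); split; first by rewrite divr_gt0.
  by move=> y yr; apply: rN; move: yr; rewrite mulrC divfK // pnatr_eq0.
have [rx Hrx] := choice loc.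
pose U x := interior [set y | chart_dom (cx x) y /\ `|chart_to (cx x) y - zx x| <= rx x].
have [D _ cov] : finite_subset_cover [set: X] U [set: X].
  have : @cover_compact pX setT by rewrite -(@compact_cover pX).
  apply=> [x _|x _]; first exact: open_interior.
  have Nr : \forall z \near zx x, `|z - zx x| <= rx x.
    have r0 := (Hrx x).1; apply/nbhs_ballP; exists (rx x) => //= y.
    by rewrite -ball_normE /ball_ /= distrC; exact: ltW.
  by exists x => //; exact: (near_chart (Hcx x) Nr).
(* The 2-jets: words of at most two directions, at each centre. *)
pose J := (D * {k : 'I_3 & k.-tuple ('I_n + 'I_n)})%type.
pose L (j : J) s : C := cjet (tagged j.2) (coef (ix (val j.1)) s \o chart_of (cx (val j.1))) (zx (val j.1)).
exists #|{: J}|, (fun s => \row_k L (enum_val k) s); split.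
  by move=> a s t; apply/rowP => k; rewrite !mxE; apply: jet_lin.
move=> s Ts.
have Lj j : L j s = 0.
  have := congr1 (fun A : 'rV_(#|{: J}|) => A 0 (enum_rank j)) Ts.
  by rewrite !mxE enum_rankK.
have ne : [set: X] !=set0 by exists x0.
have cs : {within [set: X], continuous (fun x => re (h x (s x) (s x)))}.
  by apply: continuous_subspaceT; exact: normsq_continuous.
have [x1 _ xmax] := compact_EVT_max ne X_compact cs.
set K := re (h x1 (s x1) (s x1)) in xmax.
have [x /= xD /interior_subset [cx1 zr]] := cov x1 I.
have [r0 Hr] := Hrx x; have H0 := (herm_frame (Hix x)).2.
pose f := coef (ix x) s \o chart_of (cx x).
have fK y : `|y - zx x| <= 4 * rx x -> frame_chart (cx x) (ix x) y /\ sqn (f y) <= K / (frame_normsq (ix x) x / 2).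
  move=> yr; have [Wy /andP[h1 h2]] := Hr y yr; split=> //.
  have := xmax (chart_of (cx x) y); rewrite in_setT => /(_ isT).
  rewrite (re_herm_coef s Wy.2) => hK; rewrite ler_pdivlMr ?divr_gt0 //.
  apply: le_trans hK; rewrite mulrC; apply: ler_wpM2r => //; exact: sqn_ge0.
have ff : cflat 3 f (zx x).
  apply: cjet_cflat => ws sws.
  exact: (Lj ([` xD]%fset, Tagged (fun k : 'I_3 => k.-tuple ('I_n + 'I_n)) (in_tuple ws : (Ordinal sws).-tuple _))).
have sch : sqn (f (chart_to (cx x) x1)) * 4 ^+ 2 <= K / (frame_normsq (ix x) x / 2).
  exact: (schwarz (@frame_chart_open _ _) (coef_hol (cx x) (ix x) s) fK ff zr).
have z4 : `|chart_to (cx x) x1 - zx x| <= 4 * rx x by apply: le_trans zr _; lra.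
have [W1 /andP[h1 h2]] := Hr _ z4.
have K0 : K = frame_normsq (ix x) x1 * sqn (f (chart_to (cx x) x1)).
  have ix1 : frame_dom (ix x) x1 by have := W1.2; rewrite /= chart_toK.
  by rewrite /K /f /= chart_toK // (re_herm_coef s ix1).
have := sqn_ge0 (f (chart_to (cx x) x1)); rewrite chart_toK // in h1 h2.
move: K0 h1 h2 H0 sch; move: (sqn _) (frame_normsq _ x1) (frame_normsq _ x) => q H1 H0' K0 h1 h2 H0 hh q0.
rewrite expr2 ler_pdivlMr ?divr_gt0 // in hh.
have Kle : K <= 0.
  have : H1 * q <= 2 * H0' * q by apply: ler_wpM2r.
  rewrite -K0; lra.
have K00 y : s y = 0.
  have := xmax y; rewrite in_setT => /(_ isT) /le_trans /(_ Kle).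
  have [-> //|sy] := eqVneq (s y) 0.
  by have := herm_gt0 h sy; rewrite gt0_RC => /andP[_ /lt_le_trans H /H]; rewrite ltxx.
by apply: hsec_inj => y; rewrite K00.
Qed.

Lemma hol_locally_bounded (W : set Cn) (f : Cn -> C) z : open W -> holomorphic_on W f -> W z ->
  exists r K : R, 0 < r /\ forall y, `|y - z| <= 9 * r -> W y /\ sqn (f y) <= K.
Proof.
move=> oW hf Wz.
have N : \forall y \near z, W y /\ sqn (f y) <= sqn (f z) + 1.
  apply: filterI; first exact: open_nbhs_nbhs.
  have := smooth_on_cont (smooth_sqn oW (hol_csmooth hf)) Wz.
  move=> /cvgrPdist_le/(_ _ ltr01); apply: filterS => y.
  by rewrite ler_distl => /andP[h1 h2]; lra.
have [r r0 rN] := near_le_ball N.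
exists (r / 9), (sqn (f z) + 1); split; first by rewrite divr_gt0.
by move=> y yr; apply: rN; move: yr; rewrite mulrC divfK // pnatr_eq0.
Qed.

(** The interior of the zero set of s is nonempty by the Schwarz lemma. It is
    also closed: at a limit point y the lemma is applied on a ball centred at a
    nearby interior zero, large enough to contain a neighbourhood of y. This is
    why the radius r below depends on y and not on the centre of the ball.
    *)
Lemma section_jets_eq0 (X_connected : connected [set: X]) c i x s :
  chart_dom c x -> frame_dom i x ->
  (forall ws, cjet ws (coef i s \o chart_of c) (chart_to c x) = 0) -> s = 0.
Proof.
move=> cx ix jx.
(* Vanishing of all jets at one point close enough to y makes s vanish near y.
   *)
have key c' i' y : chart_dom c' y -> frame_dom i' y -> exists2 r : R, 0 < r &
    forall y', chart_dom c' y' -> `|chart_to c' y' - chart_to c' y| <= r ->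
    (forall ws, cjet ws (coef i' s \o chart_of c') (chart_to c' y') = 0) ->
    \forall w \near y, s w = 0.
  move=> cy iy; have oW := @frame_chart_open c' i'; have Wy := chart_to_frame_chart cy iy.
  have [r [K [r0 rK]]] := hol_locally_bounded oW (coef_hol c' i' s) Wy.
  exists r => // y' cy' y'r jy'.
  have H : forall z, `|z - chart_to c' y'| <= 2 * r -> (coef i' s \o chart_of c') z = 0.
    apply: (cflat_eq0 (M := K) oW (coef_hol c' i' s)) => [z zr|k].
      apply: rK; apply: le_trans (ler_distD (chart_to c' y') _ _) _; lra.
    by apply: cjet_cflat => ws _.
  have N : \forall z \near chart_to c' y, `|z - chart_to c' y| <= r.
    apply/nbhs_ballP; exists r => //= z; rewrite -ball_normE /ball_ /= distrC; exact: ltW.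
  have := near_chart cy N; apply: filterS => w [cw wr].
  have W9 : frame_chart c' i' (chart_to c' w) by apply: (rK _ _).1; lra.
  have iw : frame_dom i' w by have := W9.2; rewrite /= chart_toK.
  apply/eqP; rewrite -(coef_eq0 _ iw); apply/eqP.
  have := H (chart_to c' w); rewrite /= chart_toK //; apply.
  apply: le_trans (ler_distD (chart_to c' y) _ _) _.
  by rewrite distrC in y'r; lra.
pose Z := interior [set y | s y = 0].
have ZT : Z = [set: X].
  apply: X_connected.
  - exists x; have [r r0 H] := key c i x cx ix; apply: (H x) => //.
    by rewrite subrr normr0 ltW.
  - by exists Z; [exact: open_interior|rewrite setTI].
  - exists Z; last by rewrite setTI.
    move=> y cly; have [c' cy] := chart_cover M y; have [i' iy] := frame_cover E y.
    have [r r0 H] := key c' i' y cy iy.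
    have N : \forall z \near chart_to c' y, frame_chart c' i' z /\ `|z - chart_to c' y| <= r.
      apply: filterI; first by apply: open_nbhs_nbhs; split; [exact: frame_chart_open|exact: chart_to_frame_chart].
      apply/nbhs_ballP; exists r => //= z; rewrite -ball_normE /ball_ /= distrC; exact: ltW.
    have [y' [Zy' [cy' [Wy' yr']]]] := cly _ (near_chart cy N).
    apply: (H y' cy' yr') => ws.
    pose W0 := chart_cod c' `&` chart_of c' @^-1` (Z `&` frame_dom i').
    have oW0 : open W0.
      by apply: open_chart_pre; apply: openI; [exact: open_interior|exact: frame_dom_open].
    apply: (cjet0 ws oW0) => [z [cz [Zz iz]]|].
      by apply/eqP; rewrite /= coef_eq0 //; apply/eqP; exact: (interior_subset Zz).
    have iy' : frame_dom i' y' by have := Wy'.2; rewrite /= chart_toK.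
    split; first exact: chart_to_cod.
    by rewrite /preimage /= chart_toK.
apply: hsec_inj => y; have : Z y by rewrite ZT.
by move/interior_subset.
Qed.

End Geometry.

(** * The Bergman function as a value of the form *)

Section DdbarAdditive.
Variables (R : realType) (n : nat) (W : set (Cn R n)).
Hypothesis oW : open W.
Local Notation C := (cplx R).
Local Notation Cn := (Cn R n).
Implicit Types (f g : Cn -> C) (z : Cn).

Lemma csmooth_dzbar f k : csmooth W f -> csmooth W (dzbar k f).
Proof.
move=> sf; apply: (csmoothM oW _ (csmooth_cst oW _)).
apply: (csmoothD oW (csmooth_pd _ sf)).
exact: (csmoothM oW (csmooth_cst oW _) (csmooth_pd _ sf)).
Qed.

Lemma dzD f g k z : csmooth W f -> csmooth W g -> W z ->
  dz k (fun y => f y + g y) z = dz k f z + dz k g z.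
Proof.
move=> sf sg Wz; rewrite /dz (pdD _ sf sg Wz) (pdD _ sf sg Wz).
by move: (pd _ _ _) (pd _ _ _) (pd _ _ _) (pd _ _ _) => a b c d; field.
Qed.

Lemma dzbarD f g k z : csmooth W f -> csmooth W g -> W z ->
  dzbar k (fun y => f y + g y) z = dzbar k f z + dzbar k g z.
Proof.
move=> sf sg Wz; rewrite /dzbar (pdD _ sf sg Wz) (pdD _ sf sg Wz).
by move: (pd _ _ _) (pd _ _ _) (pd _ _ _) (pd _ _ _) => a b c d; field.
Qed.

Lemma ddbarE (u : Cn -> R) z j k : ddbar u z j k = dz j (dzbar k (fun w => RC (u w))) z.
Proof. by rewrite mxE. Qed.

Lemma ddbar_eq (u w : Cn -> R) z : (forall y, W y -> u y = w y) -> W z -> ddbar u z = ddbar w z.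
Proof.
move=> uw Wz; apply/matrixP => j k.
apply: etrans (ddbarE _ _ _ _) (etrans _ (esym (ddbarE _ _ _ _))).
apply: (dz_eq oW _ _ Wz) => y Wy.
by apply: (dzbar_eq oW _ _ Wy) => x Wx; rewrite uw.
Qed.

Lemma ddbarD (u w : Cn -> R) z : smooth_on W u -> smooth_on W w -> W z ->
  ddbar (fun y => u y + w y) z = ddbar u z + ddbar w z.
Proof.
move=> su sw Wz; apply/matrixP => j k.
have addE (A B : 'M[C]_n) : (A + B) j k = A j k + B j k by rewrite mxE.
apply: etrans (ddbarE _ _ _ _) (etrans _ (esym (addE _ _))).
apply: etrans _ (esym (congr2 +%R (ddbarE u z j k) (ddbarE w z j k))).
have su' := csmooth_RC oW su; have sw' := csmooth_RC oW sw.
rewrite -(dzD j (csmooth_dzbar k su') (csmooth_dzbar k sw') Wz).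
apply: (dz_eq oW _ _ Wz) => y Wy; rewrite -(dzbarD k su' sw' Wy).
by apply: (dzbar_eq oW _ _ Wy) => x _; rewrite -RCD.
Qed.

End DdbarAdditive.

Section Bergman.
Variables (R : realType) (X : topologicalType) (n : nat).
Variables (M : complex_atlas R X n) (E : line_bundle M) (h : hermitian_metric E).
Local Notation C := (cplx R).
Local Notation Cn := (Cn R n).
Local Notation OE := (hsec E).
Implicit Types (x : X) (s t : OE) (i : frame_idx E) (c : chart M).

(** A choice of frame at each point turns evaluation at x into a functional.
    The choice need not be continuous in x: only products with the norm of the
    frame are used globally. *)
Definition frame_at x : frame_idx E := projT1 (cid (frame_cover E x)).
Lemma frame_atP x : frame_dom (frame_at x) x.
Proof. by rewrite /frame_at; case: cid. Qed.

Lemma ev_exists x : exists e : dual OE, forall s, e s = coef (frame_at x) s x.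
Proof. by apply: dual_of => a u v; rewrite (coef_lin _ _ _ (frame_atP x)). Qed.

Definition ev x : dual OE := projT1 (cid (ev_exists x)).
Lemma evE x s : ev x s = coef (frame_at x) s x.
Proof. by rewrite /ev; case: cid. Qed.

Lemma ev_frame x s : s x = ev x s *: frame (frame_at x) x.
Proof. by rewrite evE -(coefE s (frame_atP x)). Qed.

Lemma ev_eq0 x s : (ev x s == 0) = (s x == 0).
Proof. by rewrite evE (coef_eq0 _ (frame_atP x)). Qed.

Lemma ev_separates s : (forall x, ev x s = 0) -> s = 0.
Proof. by move=> H; apply: hsec_inj => x; apply/eqP; rewrite -ev_eq0 H. Qed.

Definition ev_normsq x : R := frame_normsq h (frame_at x) x.
Lemma ev_normsq_gt0 x : 0 < ev_normsq x. Proof. exact: (herm_frame h (frame_atP x)).2. Qed.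

Lemma normsq_ev x s : re (h x (s x) (s x)) = ev_normsq x * sqn (ev x s).
Proof. by rewrite (re_herm_coef h s (frame_atP x)) evE. Qed.

(** The Bergman function of G, written without reference to V. *)
Definition form_kappa (G : dual OE -> dual OE -> C) x : R := ev_normsq x * re (G (ev x) (ev x)).

(** An orthonormal basis (s_j) gives G(ev_x, ev_x) = sum_j |ev_x(s_j)|^2. *)
Lemma is_bergmanE (G : dual_forms OE) kappa : is_bergman h G kappa -> kappa = form_kappa G.
Proof.
move=> [V [ip [m [s [sV iV pV GE [oB kE]]]]]]; apply/funext => x.
rewrite kE /form_kappa GE (delta_orthonormal _ _ sV iV oB) re_sum mulr_sumr.
by apply: eq_bigr => j _; rewrite mulr_conj normsq_ev.
Qed.

Lemma nf_is_bergman (G : dual_forms OE) r (s : 'I_r -> OE) al : normal_form G s al ->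
  is_bergman h G (fun x => \sum_j re (h x (s j x) (s j x))).
Proof.
move=> nf; exists (nf_space s al), (nf_ip al), r, s; split=> //.
- exact: nf_subspace.
- exact: nf_inner_product.
- exact: nf_posdef.
- exact: nf_delta.
- split=> //; exact: nf_orthonormal nf.
Qed.

Lemma nf_kappa (G : dual_forms OE) r (s : 'I_r -> OE) al x : normal_form G s al ->
  form_kappa G x = \sum_j re (h x (s j x) (s j x)).
Proof. by move=> nf; have /is_bergmanE/(congr1 (@^~ x)) := nf_is_bergman nf. Qed.

Lemma nf_bergman (G : dual_forms OE) r (s : 'I_r -> OE) al : normal_form G s al ->
  bergman h G = form_kappa G.
Proof.
move=> nf; apply: is_bergmanE; rewrite /bergman.
by apply: (@xgetPex _ _ [set k | is_bergman h G k]); exists (fun x => \sum_j re (h x (s j x) (s j x))); exact: nf_is_bergman nf.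
Qed.

Lemma nf_kappa_coef (G : dual_forms OE) r (s : 'I_r -> OE) al i x : normal_form G s al ->
  frame_dom i x -> form_kappa G x = frame_normsq h i x * \sum_j sqn (coef i (s j) x).
Proof.
move=> nf ix; rewrite (nf_kappa x nf) mulr_sumr; apply: eq_bigr => j _.
exact: re_herm_coef.
Qed.

Lemma dir_derive_dual c i (v : 'rV[C]_n) (z : Cn) : frame_chart c i z ->
  exists d : dual OE, forall s, d s = dir_derive v (coef i s \o chart_of c) z.
Proof.
move=> Wz; apply: dual_of => a s t; rewrite /dir_derive mulr_sumr -big_split.
apply: eq_bigr => j _ /=.
have dE u : dz j (coef i u \o chart_of c) z = cjet [:: inl j] (coef i u \o chart_of c) z.
  by rewrite (hol_dz _ (coef_hol c i u) Wz).
by rewrite !dE (jet_lin [:: inl j] a s t Wz); ring.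
Qed.

Lemma coef_dual i x : frame_dom i x -> exists d : dual OE, forall s, d s = coef i s x.
Proof. by move=> ix; apply: dual_of => a u v; rewrite coef_lin. Qed.

Lemma frame_local i : local_frame (frame_dom i) (@frame _ _ _ _ E i).
Proof.
split=> [|j|x ix]; [exact: frame_dom_open| |exact: frame_neq0].
have [g gh gE] := frame_trans j i; exists g; first by rewrite setIC.
by move=> x ix jx; exact: gE.
Qed.

(** Where a section vanishes, its derivative is multiplied by the value of the
    transition function when the frame is changed, so that its nonvanishing
    does not depend on the frame. *)
Lemma dhol_change c i x U e t (psi : X -> C) (v : 'rV[C]_n) : chart_dom c x -> frame_dom i x ->
  local_frame U e -> U x -> (forall y, U y -> t y = psi y *: e y) -> psi x = 0 ->
  dhol c v psi x != 0 -> dir_derive v (coef i t \o chart_of c) (chart_to c x) != 0.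
Proof.
move=> cx ix [oU he e0] Ux tpsi psi0; have [g gh gE] := he i.
have g0 y : U y -> frame_dom i y -> g y != 0.
  by move=> Uy iy; apply: contraNneq (e0 y Uy) => gy; rewrite gE // gy scale0r.
pose W := chart_cod c `&` chart_of c @^-1` (U `&` frame_dom i).
have oW : open W by apply: open_chart_pre; apply: openI => //; exact: frame_dom_open.
have Wx : W (chart_to c x) by split; [exact: chart_to_cod|rewrite /preimage /= chart_toK].
have hg : holomorphic_on W (g \o chart_of c) := gh c.
have hV : holomorphic_on W (fun z => (g (chart_of c z))^-1).
  by apply: (holV oW _ hg) => z [_ [Uz iz]]; exact: g0.
have ht : holomorphic_on W (coef i t \o chart_of c).
  by apply: holomorphic_onS (coef_hol c i t) => z [cz [_ iz]].
have psiE z : W z -> psi (chart_of c z) = coef i t (chart_of c z) * (g (chart_of c z))^-1.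
  move=> [cz [Uz iz]]; rewrite (coef_eq iz (a := psi (chart_of c z) * g (chart_of c z))).
    by rewrite mulfK // g0.
  by rewrite tpsi // gE // scalerA.
have ctx : coef i t x = 0 by apply: (coef_eq ix); rewrite tpsi // psi0 !scale0r.
rewrite /dhol => H; apply: contraNneq H => D0; apply/eqP.
transitivity (dir_derive v (coef i t \o chart_of c) (chart_to c x) * (g x)^-1); last by rewrite D0 mul0r.
rewrite /dir_derive mulr_suml; apply: eq_bigr => j _.
rewrite (dz_eq oW j psiE Wx).
rewrite (dzM j (hol_csmooth ht) (hol_csmooth hV) Wx) /= chart_toK // ctx mul0r addr0.
by rewrite mulrAC.
Qed.

Variable omega : form11 M.
Hypothesis omega_curv : curvature h omega.

(** * Rather ample spaces and positivity of the curvature *)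

Section NF.
Variables (G : dual_forms OE) (r : nat) (s : 'I_r -> OE) (al : 'I_r -> dual OE).
Hypothesis nf : normal_form G s al.
Hypothesis kappa_gt0 : forall x, 0 < form_kappa G x.
Local Notation ff c i := (fun (k : 'I_r) => coef i (s k) \o chart_of c).

Lemma nf_PhiE x : Phi h G x = ln (form_kappa G x).
Proof. by rewrite /Phi (nf_bergman nf). Qed.

Lemma nf_sumsq_gt0 c i z : frame_chart c i z -> 0 < sumsq (ff c i) z.
Proof.
move=> [cz iz]; have := kappa_gt0 (chart_of c z).
by rewrite (nf_kappa_coef nf iz) pmulr_rgt0 //; exact: (herm_frame h iz).2.
Qed.

Lemma nf_Phi_local c i z : frame_chart c i z -> Phi h G (chart_of c z) =
  ln (frame_normsq h i (chart_of c z)) + ln (sumsq (ff c i) z).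
Proof.
move=> Wz; have [cz iz] := Wz.
rewrite nf_PhiE (nf_kappa_coef nf iz) lnM ?posrE //; first exact: (herm_frame h iz).2.
exact: nf_sumsq_gt0 Wz.
Qed.

Lemma ln_frame_normsq_smooth c i : smooth_on (frame_chart c i) (fun z => ln (frame_normsq h i (chart_of c z))).
Proof.
apply: (smooth_on_ln (@frame_chart_open _ _ _ _ _ c i) _ (@frame_normsq_smooth _ _ _ _ _ h c i)).
by move=> z [_ iz]; exact: (herm_frame h iz).2.
Qed.

Let hff c i k : holomorphic_on (frame_chart c i) (ff c i k). Proof. exact: coef_hol. Qed.

Lemma nf_Phi_smooth : csmooth_on M setT (Phi h G).
Proof.
move=> c vs z [cz _]; have [i iz] := frame_cover E (chart_of c z).
have Wz : frame_chart c i z by [].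
have oW := @frame_chart_open _ _ _ _ E c i.
have sm : smooth_on (frame_chart c i) (Phi h G \o chart_of c).
  have sL := smooth_on_ln oW (@nf_sumsq_gt0 c i) (sumsq_smooth oW (@hff c i)).
  by apply: (smooth_on_eq oW _ (smooth_onD oW (@ln_frame_normsq_smooth c i) sL)) => y Wy; rewrite -nf_Phi_local.
exact: sm.
Qed.

(** The curvature of h is exactly minus d dbar of the summand log h(e, e) of
    log kappa. *)
Lemma nf_levi c i z (v : 'rV[C]_n) : frame_chart c i z ->
  levi (omega c z + ddbar (Phi h G \o chart_of c) z) v =
  levi (ddbar (fun y => ln (sumsq (ff c i) y)) z) v.
Proof.
move=> Wz; have [cz iz] := Wz; congr (levi _ v).
have oW := @frame_chart_open _ _ _ _ E c i.
have sL := smooth_on_ln oW (@nf_sumsq_gt0 c i) (sumsq_smooth oW (@hff c i)).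
rewrite (omega_curv (frame_local i) cz iz).
rewrite (ddbar_eq oW (@nf_Phi_local c i) Wz) (ddbarD oW (@ln_frame_normsq_smooth c i) sL Wz).
by rewrite addrA addNr add0r.
Qed.

Lemma nf_span (a : 'I_r -> C) : nf_space s al (\sum_k a k *: s k).
Proof. by apply/(nf_spaceP nf); exists a. Qed.

(** A section of the space that vanishes at x to first order along v supplies
    the combination required by the positivity criterion. *)
Lemma nf_levi_gt0 : rather_ample (nf_space s al) ->
  forall c z, chart_cod c z -> herm_posdef (omega c z + ddbar (Phi h G \o chart_of c) z).
Proof.
move=> rA c z cz v v0; have [i iz] := frame_cover E (chart_of c z).
have Wz : frame_chart c i z by []; have oW := @frame_chart_open _ _ _ _ E c i.
rewrite -[X in 0 < X]/(levi _ v) (nf_levi v Wz).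
apply/(levi_gt0P oW (@hff c i) (@nf_sumsq_gt0 c i) v Wz).
have cx := chart_of_dom cz.
have [s0 [t [Vs Vt sx [U [e [psi [lU Ux tpsi psi0 dpsi]]]]]]] := rA (chart_of c z) c v cx v0.
have := dhol_change cx iz lU Ux tpsi psi0 dpsi; rewrite chart_ofK // => Dt.
exists (fun k => al k t); split.
  have [d dE] := coef_dual iz.
  transitivity (d t); last by rewrite dE; apply: (coef_eq iz); rewrite tpsi // psi0 !scale0r.
  by rewrite [in RHS]Vt dual_sum; apply: eq_bigr => k _; rewrite dualZ dE.
have [d dE] := dir_derive_dual v Wz.
suff -> : \sum_a al a t * dir_derive v (ff c i a) z = d t by rewrite dE.
by rewrite [in RHS]Vt dual_sum; apply: eq_bigr => k _; rewrite dualZ dE.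
Qed.

(** Positivity of kappa gives a section that does not vanish at x; the
    positivity criterion for the Levi form gives the other one. *)
Lemma nf_rather_ample :
  (forall c z, chart_cod c z -> herm_posdef (omega c z + ddbar (Phi h G \o chart_of c) z)) ->
  rather_ample (nf_space s al).
Proof.
move=> pos x c v cx v0; have [i ix] := frame_cover E x.
have oW := @frame_chart_open _ _ _ _ E c i.
have Wx : frame_chart c i (chart_to c x) by exact: chart_to_frame_chart.
have := pos c _ (chart_to_cod cx) v v0.
rewrite -[X in 0 < X]/(levi _ v) (nf_levi v Wx).
move=> /(levi_gt0P oW (@hff c i) (@nf_sumsq_gt0 c i) v Wx)[a [a0 da]].
have [k sk] : exists k, s k x != 0.
  apply: contrapT => nk; have := kappa_gt0 x; rewrite (nf_kappa x nf) big1 ?ltxx // => k _.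
  rewrite normsq_ev; have /eqP -> : ev x (s k) == 0.
    by rewrite ev_eq0; apply/negPn/negP => sk; apply: nk; exists k.
  by rewrite /sqn !reimE mulr0 addr0 mulr0.
exists (s k), (\sum_k a k *: s k); split=> //.
- by have [] := nf_orthonormal nf.
- exact: nf_span.
- exists (frame_dom i), (@frame _ _ _ _ E i), (coef i (\sum_k a k *: s k)); split=> //.
  + exact: frame_local.
  + by move=> y iy; exact: coefE.
  + have [d dE] := coef_dual ix; rewrite -dE dual_sum -[RHS]a0; apply: eq_bigr => l _.
    by rewrite dualZ dE /= chart_toK.
  + have [d dE] := dir_derive_dual v Wx.
    rewrite -[dhol _ _ _ _]/(dir_derive v (coef i _ \o chart_of c) (chart_to c x)) -dE dual_sum.
    rewrite (_ : \sum_l _ = \sum_a0 a a0 * dir_derive v (ff c i a0) (chart_to c x)) //.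
    by apply: eq_bigr => l _; rewrite dualZ dE.
Qed.

End NF.

End Bergman.

(** * Elements of A_E *)

Section FormsAndBergman.
Variables (R : realType) (X : topologicalType) (n : nat).
Variables (M : complex_atlas R X n) (E : line_bundle M) (h : hermitian_metric E).
Local Notation C := (cplx R).
Local Notation Cn := (Cn R n).
Local Notation OE := (hsec E).
Variables (m : nat) (T : OE -> 'rV[C]_m).
Hypothesis Tlin : forall (a : C) u v, T (a *: u + v) = a *: T u + T v.
Hypothesis Tinj : forall w, T w = 0 -> w = 0.
Variables (N : nat) (b : 'I_N -> OE) (be : 'I_N -> dual OE).
Hypothesis bbe : forall k l, be k (b l) = (k == l)%:R.
Hypothesis spb : forall w, w = \sum_l be l w *: b l.
Hypothesis n_gt0 : (0 < n)%N.
Implicit Types (x : X) (s t : OE) (c : chart M).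

Lemma ip_0r V (ip : OE -> OE -> C) u : subspace V -> inner_product V ip -> V u -> ip u 0 = 0.
Proof.
move=> sV iV Vu; have [V0 _] := sV.
have := ip_combr (-1) sV iV V0 V0 Vu.
by rewrite scaleN1r addr0 oppr0 rmorphN1 mulN1r addNr.
Qed.

Lemma ip_extend V (ip : OE -> OE -> C) u : subspace V -> inner_product V ip -> V u ->
  exists sigma : dual OE, forall v, V v -> sigma v = ip v u.
Proof.
move=> sV iV Vu; have [q [w [g [Vw gw sp]]]] := subspace_dual_basis Tlin Tinj sV.
have lf (a : C) y z : \sum_l g l (a *: y + z) * ip (w l) u =
    a * (\sum_l g l y * ip (w l) u) + \sum_l g l z * ip (w l) u.
  by rewrite mulr_sumr -big_split; apply: eq_bigr => l _ /=; rewrite dual_lin; ring.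
have [ph phE] := dual_of lf; exists ph => v Vv.
by rewrite phE [in RHS](sp v Vv) (ip_suml _ _ sV iV).
Qed.

(** A functional that kills the s_k is in the radical of G; its Riesz vector in
    V is then orthogonal to all of V, hence 0, so that the functional kills V.
    *)
Lemma delta_sub_nf_space (G : dual_forms OE) V ip r (s : 'I_r -> OE) al : subspace V ->
  inner_product V ip -> nondegenerate V ip -> G = delta V ip -> normal_form G s al ->
  V `<=` nf_space s al.
Proof.
move=> sV iV nV GE nf v Vv; apply: (nf_mem nf) => [sigma Hs|w]; last exact: (dual_sep spb).
have [Vr Hr] := rieszP Tlin Tinj sigma sV iV nV.
suff r0 : riesz V ip sigma = 0 by rewrite Hr // r0 (ip_0r sV iV).
apply: (nV _ Vr) => u Vu; have [ph phE] := ip_extend sV iV Vu.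
have ru : riesz V ip ph = u by exact: riesz_eq.
have G0 : G sigma ph = 0 by rewrite nf.2 big1 // => k _; rewrite Hs mul0r.
by rewrite iV.2 // -[X in ip X]ru -[ip _ _]/(delta V ip sigma ph) -GE G0 rmorph0.
Qed.

Lemma rather_ampleS (V V' : set OE) : V `<=` V' -> rather_ample V -> rather_ample V'.
Proof.
move=> VV rV x c v cx v0; have [s [t [Vs Vt sx Ht]]] := rV x c v cx v0.
by exists s, t; split=> //; exact: VV.
Qed.

Lemma nf_kappa_gt0 (G : dual_forms OE) r (s : 'I_r -> OE) al : normal_form G s al ->
  (forall x, exists2 t, nf_space s al t & t x != 0) -> forall x, 0 < form_kappa h G x.
Proof.
move=> nf bpf x; rewrite /form_kappa pmulr_rgt0 ?ev_normsq_gt0 //.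
have GE : re (G (ev E x) (ev E x)) = \sum_k sqn (ev E x (s k)).
  by rewrite nf.2 re_sum; apply: eq_bigr => k _; rewrite mulr_conj.
rewrite GE lt0r sumr_ge0 ?andbT => [|k _]; last exact: sqn_ge0.
apply/eqP => /eqP; rewrite psumr_eq0 => [/allP S0|k _]; last exact: sqn_ge0.
have [t Vt] := bpf x; rewrite -ev_eq0 Vt dual_sum big1 ?eqxx // => k _.
by have := S0 k (mem_index_enum k); rewrite sqn_eq0 => /eqP sk; rewrite dualZ sk mulr0.
Qed.

(** Tangent vectors exist only when n > 0, which is what makes a rather ample
    space base point free. *)
Lemma rather_ample_bpf (V : set OE) : rather_ample V -> forall x, exists2 t, V t & t x != 0.
Proof.
move=> rV x; have [c cx] := chart_cover M x.
have v0 : delta_mx 0 (Ordinal n_gt0) != 0 :> 'rV[C]_n.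
  apply/eqP => /rowP/(_ (Ordinal n_gt0)) /eqP.
  by rewrite !mxE !eqxx oner_eq0.
by have [s [t [Vs _ sx _]]] := rV x c _ cx v0; exists s.
Qed.

Lemma A_E_nf G : A_E (E := E) G -> exists r (s : 'I_r -> OE) al,
  [/\ normal_form G s al, forall x, 0 < form_kappa h G x & rather_ample (nf_space s al)].
Proof.
move=> [iG pG [V [ip [sV iV nV GE rV]]]].
have [r [s [al nf]]] := psd_normal_form bbe spb iG pG.
have rS := rather_ampleS (delta_sub_nf_space sV iV nV GE nf) rV.
exists r, s, al; split=> //; apply: (nf_kappa_gt0 nf); exact: rather_ample_bpf.
Qed.

Lemma A_E_ip G : A_E (E := E) G ->
  inner_product setT (G : dual OE -> dual OE -> C) /\ possemidef setT (G : dual OE -> dual OE -> C).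
Proof. by case. Qed.

Lemma nf_A_E (G : dual_forms OE) r (s : 'I_r -> OE) al :
  inner_product setT (G : dual OE -> dual OE -> C) ->
  possemidef setT (G : dual OE -> dual OE -> C) ->
  normal_form G s al -> rather_ample (nf_space s al) -> A_E (E := E) G.
Proof.
move=> iG pG nf rA; split=> //; exists (nf_space s al), (nf_ip al); split=> //.
- exact: nf_subspace.
- exact: nf_inner_product.
- exact: (posdef_nondegenerate (@nf_posdef _ _ _ _ _)).
- exact: nf_delta nf.
Qed.

Lemma Phi_form_kappa G : A_E (E := E) G ->
  (forall x, 0 < form_kappa h G x) /\ forall x, Phi h G x = ln (form_kappa h G x).
Proof.
move=> AG; have [r [s [al [nf k0 _]]]] := A_E_nf AG.
by split=> // x; exact: nf_PhiE nf x.
Qed.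

(** * Injectivity *)

Section Injectivity.
Hypothesis X_connected : connected [set: X].

Lemma jet_dual c (i : frame_idx E) ws (z : Cn) : frame_chart c i z ->
  exists d : dual OE, forall s, d s = cjet ws (coef i s \o chart_of c) z.
Proof. by move=> Wz; apply: dual_of => a s t; exact: jet_lin. Qed.

Lemma coef_ev (i : frame_idx E) x : frame_dom i x -> exists l : C, forall s, coef i s x = ev E x s * l.
Proof.
move=> ix; have [l lE] := frame_span ix (frame (frame_at E x) x); exists l => s.
by apply: (coef_eq ix); rewrite ev_frame lE scalerA.
Qed.

(** Polarized, the hypothesis says that the jets at one point of the sections
    P_j = sum_k D_kj b_k pair to zero with the conjugate jets of the b_j.
    Unique continuation is applied twice: for fixed jets of the b_j, to a
    combination of the P_j, then to a combination of the b_j. *)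
Lemma sections_separate_forms (D : 'I_N -> 'I_N -> C) :
  (forall x, \sum_i \sum_j ev E x (b i) * (ev E x (b j))^* * D i j = 0) -> forall i j, D i j = 0.
Proof.
move=> HD k l.
have [x _] : exists x : X, True.
  have [//|noX] := pselect (exists x : X, True).
  have b0 : b k = 0 by apply: ev_separates => x; case: noX; exists x.
  by have /eqP := bbe k k; rewrite b0 dual_0 eqxx eq_sym oner_eq0.
have [c cx] := chart_cover M x; have [i ix] := frame_cover E x.
have oW := @frame_chart_open _ _ _ _ E c i; have Wx := chart_to_frame_chart cx ix.
pose P j := \sum_k D k j *: b k.
have PE : forall z, frame_chart c i z ->
    \sum_j (coef i (P j) \o chart_of c) z * ((coef i (b j) \o chart_of c) z)^* = 0.
  move=> z [cz iz]; set y := chart_of c z; have [a aE] := coef_ev iz.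
  transitivity (a * a^* * (\sum_i \sum_j ev E y (b i) * (ev E y (b j))^* * D i j)).
    rewrite exchange_big mulr_sumr; apply: eq_bigr => j _ /=.
    rewrite !aE dual_sum !mulr_suml mulr_sumr; apply: eq_bigr => k' _.
    by rewrite dualZ conjM; ring.
  by rewrite HD mulr0.
have jj ws ws' := polarize_jets ws ws' oW (fun j => coef_hol c i (P j)) (fun j => coef_hol c i (b j)) PE Wx.
have S0 ws' : \sum_j (cjet ws' (coef i (b j) \o chart_of c) (chart_to c x))^* *: P j = 0.
  apply: (section_jets_eq0 X_connected cx ix) => ws.
  have [d dE] := jet_dual ws Wx; rewrite -dE dual_sum -[RHS](jj ws ws').
  by apply: eq_bigr => j _; rewrite dualZ dE mulrC.
have DS : \sum_j (D k j)^* *: b j = 0.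
  apply: (section_jets_eq0 X_connected cx ix) => ws.
  have [d dE] := jet_dual ws Wx; rewrite -dE dual_sum.
  have /(congr1 (be k)) := S0 ws; rewrite dual_0 dual_sum => /(congr1 (fun a : C => a^*)).
  rewrite rmorph0 rmorph_sum /= => H; rewrite -[RHS]H; apply: eq_bigr => j _.
  rewrite !dualZ conjM conjCK dE mulrC; congr (_ * _^*).
  rewrite /P dual_sum (bigD1 k) //= dualZ bbe eqxx mulr1 big1 ?addr0 // => q qk.
  by rewrite dualZ bbe eq_sym (negbTE qk) mulr0.
have /(congr1 (be l)) := DS; rewrite dual_0 dual_sum (bigD1 l) //= dualZ bbe eqxx mulr1.
rewrite big1 => [|q ql]; last by rewrite dualZ bbe eq_sym (negbTE ql) mulr0.
by rewrite addr0 => /eqP; rewrite conjC_eq0 => /eqP.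
Qed.

Lemma Phi_injective : {in A_E (E := E) &, injective (Phi h)}.
Proof.
move=> G1 G2 /set_mem A1 /set_mem A2 eG.
have [i1 p1] := A_E_ip A1; have [i2 p2] := A_E_ip A2.
have [k1 P1] := Phi_form_kappa A1; have [k2 P2] := Phi_form_kappa A2.
have ev12 x : G1 (ev E x) (ev E x) = G2 (ev E x) (ev E x).
  have kk : form_kappa h G1 x = form_kappa h G2 x.
    by apply: ln_inj; rewrite ?posrE // -P1 -P2 eG.
  have := p1 (ev E x) I; have := p2 (ev E x) I; rewrite !ge0_RC => /andP[/eqP e2 _] /andP[/eqP e1 _].
  apply: cplx_eq; last by rewrite e1 e2.
  by apply: (mulfI (lt0r_neq0 (ev_normsq_gt0 h x))).
have D0 := sections_separate_forms (D := fun i j => G1 (be i) (be j) - G2 (be i) (be j)).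
have {}D0 i j : G1 (be i) (be j) = G2 (be i) (be j).
  apply/eqP; rewrite -subr_eq0; apply/eqP; move: i j; apply: D0 => x.
  have := ev12 x; rewrite (form_expand spb _ _ i1) (form_expand spb _ _ i2) => /eqP.
  rewrite -subr_eq0 -sumrB => /eqP H; rewrite -[RHS]H; apply: eq_bigr => i _.
  by rewrite -sumrB; apply: eq_bigr => j _; rewrite mulrBr.
apply/funext => sigma; apply/funext => tau.
rewrite (form_expand spb _ _ i1) (form_expand spb _ _ i2).
by apply: eq_bigr => i _; apply: eq_bigr => j _; rewrite D0.
Qed.

End Injectivity.

(** * Recognizing elements of A_E *)

Section Curvature.
Variable omega : form11 M.
Hypothesis omega_curv : curvature h omega.

Lemma Phi_H_omega G : A_E (E := E) G -> H_omega omega (Phi h G).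
Proof.
move=> AG; have [r [s [al [nf k0 rA]]]] := A_E_nf AG.
split; first exact: nf_Phi_smooth nf k0.
exact: (@nf_levi_gt0 _ _ _ _ _ _ _ omega_curv _ _ _ _ nf k0 rA).
Qed.

Lemma bergman_H_omega (G : dual_forms OE) (u : cinfty M) :
  inner_product setT (G : dual OE -> dual OE -> C) ->
  possemidef setT (G : dual OE -> dual OE -> C) -> H_omega omega u ->
  (forall x, form_kappa h G x = expR (u x)) -> A_E (E := E) G /\ Phi h G = u.
Proof.
move=> iG pG [su pu] kE; have [r [s [al nf]]] := psd_normal_form bbe spb iG pG.
have k0 x : 0 < form_kappa h G x by rewrite kE expR_gt0.
have PE : Phi h G = u by apply/funext => x; rewrite (nf_PhiE h nf) kE expRK.
split=> //; apply: (nf_A_E iG pG nf).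
by apply: (nf_rather_ample omega_curv nf k0) => c z cz; rewrite PE; exact: pu.
Qed.

End Curvature.

(** * The Fubini-Study map *)

Section FubiniStudy.
Hypothesis E_very_ample : very_ample E.

(** If every section vanishing at x had zero derivative along v, the derivative
    would be a multiple of the value, against the injectivity of the
    differential of the Kodaira map. *)
Lemma very_ample_rather_ample : rather_ample [set: OE].
Proof.
have [bpf _ imm] := E_very_ample.
move=> x c v cx v0; have [s sx] := bpf x; have [i ix] := frame_cover E x.
have Wx := chart_to_frame_chart cx ix; have [d dE] := dir_derive_dual v Wx; have [e eE] := coef_dual ix.
have es0 : e s != 0 by rewrite eE coef_eq0.
have [t [te td]] : exists t, e t = 0 /\ d t != 0.
  apply: contrapT => /forallNP H.
  have := imm c x (frame_dom i) (@frame _ _ _ _ E i) (coef i) v cx ix (frame_local i)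
    (fun s y => @coefE _ _ _ _ _ i s y) v0.
  (* The multiple is read off from s; the section t - (t(x) / s(x)) s vanishes at
     x, and so does its derivative. *)
  apply; exists (d s / e s) => t; rewrite -eE -[LHS]/(dir_derive v (coef i t \o chart_of c) (chart_to c x)) -dE.
  have := H ((- (e t / e s)) *: s + t); rewrite !dual_lin => /not_andP[].
    by rewrite mulNr divfK // addNr.
  move=> /negP; rewrite negbK addrC mulNr subr_eq0 => /eqP ->.
  by rewrite mulrAC [RHS]mulrAC [d s * _]mulrC.
exists s, t; split=> //; exists (frame_dom i), (@frame _ _ _ _ E i), (coef i t); split=> //.
- exact: frame_local.
- by move=> y iy; exact: coefE.
- by rewrite -eE.
- by move: td; rewrite dE.
Qed.

Section DeltaFull.
Variable ip : OE -> OE -> C.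
Hypothesis ipE : H_E ip.
Let G : dual_forms OE := delta setT ip.
Let sT : subspace [set: OE] := @subspaceT R OE.
Let iT : inner_product setT ip. Proof. by case: ipE. Qed.
Let nT : nondegenerate setT ip. Proof. by apply: posdef_nondegenerate; case: ipE. Qed.
Local Notation rz := (riesz setT ip).

Lemma rieszT (sigma : dual OE) u : sigma u = ip u (rz sigma).
Proof. by have [_ ->] := rieszP Tlin Tinj sigma sT iT nT. Qed.

Lemma ipT_ge0 u : 0 <= ip u u.
Proof.
have [->|u0] := eqVneq u 0; first by rewrite (ip_0r sT iT).
by apply: ltW; have [_] := ipE; apply.
Qed.

Lemma deltaT_inner : inner_product setT (G : dual OE -> dual OE -> C).
Proof.
split=> [a sg tau rho _ _ _|sg tau _ _]; last exact: iT.2.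
by rewrite /G /delta -!rieszT.
Qed.

Lemma deltaT_psd : possemidef setT (G : dual OE -> dual OE -> C).
Proof. by move=> sg _; exact: ipT_ge0. Qed.

Lemma deltaT_A_E : A_E (E := E) G.
Proof.
split; [exact: deltaT_inner|exact: deltaT_psd|].
exists setT, ip; split=> //; exact: very_ample_rather_ample.
Qed.

(** The supremum of |ev_x(s)|^2 / <s, s> is reached at the Riesz vector of
    ev_x, by the Cauchy-Schwarz inequality, and equals its squared norm. *)
Lemma FS_Phi : FS h ip = Phi h G.
Proof.
apply/funext => x; have [_ ->] := Phi_form_kappa deltaT_A_E; congr ln.
have [bpf _ _] := E_very_ample; have [s0 s0x] := bpf x.
set A := [set _ | _ in _]; set r := rz (ev E x).
have sE s : ev E x s = ip s r by exact: rieszT.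
have ipR u : u != 0 -> ip u u = RC (re (ip u u)) /\ 0 < re (ip u u).
  move=> u0; have := ipE.2 u I u0; rewrite gt0_RC => /andP[/eqP e1 e2]; split=> //.
  by apply: cplx_eq; rewrite !reimE.
have r0 : r != 0.
  apply: contraNneq s0x => r0.
  by rewrite -ev_eq0 sE r0 (ip_0r sT iT).
have kE : form_kappa h G x = ev_normsq h x * re (ip r r) by [].
have valE s : s <> 0 -> re (h x (s x) (s x) / ip s s) = ev_normsq h x * sqn (ip s r) / re (ip s s).
  move=> /eqP sn0; have [-> p0] := ipR s sn0.
  rewrite (herm_coef h s s (frame_atP E x)) mulr_conj -RCM -RCV -RCM -evE sE //.
have ubA : ubound A (form_kappa h G x).
  move=> _ [s /= sn0 <-]; rewrite valE; last exact/eqP.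
  rewrite kE ler_pdivrMr; last exact: (ipR s sn0).2.
  rewrite -mulrA ler_pM2l ?ev_normsq_gt0 // mulrC.
  by rewrite mulrC [leRHS]mulrC; apply: (cauchy_schwarz sT iT) => // u _; exact: ipT_ge0.
have Ak : A (form_kappa h G x).
  exists r => //; rewrite valE; last exact/eqP.
  rewrite kE; have [rE p0] := ipR r r0.
  rewrite -mulrA; congr (_ * _); apply: (mulIf (lt0r_neq0 p0)).
  rewrite divfK ?lt0r_neq0 //; rewrite {1}rE.
  by rewrite /sqn !reimE; ring.
apply/eqP; rewrite eq_le; apply/andP; split.
  by apply: ge_sup => //; exists (form_kappa h G x).
by apply: ub_le_sup => //; exists (form_kappa h G x).
Qed.

End DeltaFull.

(** When G is definite no functional kills all the s_k, so the space of the
    normal form is the whole of O(E). *)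
Lemma definite_form_FS (G : dual_forms OE) :
  inner_product setT (G : dual OE -> dual OE -> C) ->
  posdef setT (G : dual OE -> dual OE -> C) ->
  A_E (E := E) G /\ (FS h @` H_E (E := E)) (Phi h G).
Proof.
move=> iG pG; have ppG : possemidef setT (G : dual OE -> dual OE -> C).
  move=> sg _; have [->|s0] := eqVneq sg 0; last exact: ltW (pG sg I s0).
  have := ip_suml (V := setT) [::] (fun _ : nat => 0) (v := fun _ : nat => 0) (w := 0)
    (@subspaceT R (dual OE)) iG (fun=> I) I.
  by rewrite !big_nil => ->.
have [r [s [al nf]]] := psd_normal_form bbe spb iG ppG.
have full w : nf_space s al w.
  apply: (nf_mem nf) => [sg Hs|w']; last exact: (dual_sep spb).
  have [->//|s0] := eqVneq sg 0.
  by have := pG sg I s0; rewrite nf.2 big1 ?ltxx // => k _; rewrite Hs mul0r.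
have VT : nf_space s al = setT by apply/seteqP; split.
have ipH : H_E (nf_ip al).
  by split; [exact: nf_inner_productT|rewrite -VT; exact: nf_posdef].
have GE : G = delta setT (nf_ip al) by rewrite -VT; exact: nf_delta nf.
rewrite GE; split; first exact: deltaT_A_E.
by exists (nf_ip al) => //; exact: FS_Phi.
Qed.

End FubiniStudy.

End FormsAndBergman.

(** * Topologies on functions and forms *)

Section Topology.

Lemma cvg_initial (S : choiceType) (T : topologicalType) (f : S -> T)
  (F : set_system (initial_topology f)) (s : initial_topology f) : Filter F ->
  f @ F --> f s -> F --> s.
Proof.
move=> FF cF A /= [_ [[B Bop <-] Bfs sBfA]].
apply: filterS sBfA _; apply: (cF B).
by apply: open_nbhs_nbhs.
Qed.

Lemma cvg_prod (I : Type) (T : I -> topologicalType) (F : set_system (prod_topology T))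
  (p : prod_topology T) : Filter F -> (forall i, (fun q : prod_topology T => q i) @ F --> p i) ->
  F --> p.
Proof.
move=> FF H; apply/cvg_sup => i.
exact: (@cvg_initial _ _ (fun q : forall i, T i => q i)).
Qed.

Lemma prod_ev_continuous (I : Type) (T : I -> topologicalType) i :
  continuous (fun q : prod_topology T => q i).
Proof. exact: (@proj_continuous {classic I} T i). Qed.

(** Replaces the subspace topology by an arbitrary parameter space in which A
    appears as an open set, which is the setting of smooth families. *)
Lemma continuous_within_family (T U : topologicalType) (A : set T) (f : T -> U) :
  (forall (P : topologicalType) (Q : set P) (g : P -> T), open Q -> (forall p, Q p -> A (g p)) ->
    continuous g -> forall p, Q p -> (fun q => f (g q)) @ p --> f (g p)) ->
  {within A, continuous f}.
Proof.
move=> H p; have [Ap|nAp] := pselect (A p).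
  have oA : open (A : set (subspace_topology.subspace A)) by exact: open_subspaceT.
  apply: (H (subspace_topology.subspace A) A id oA) => //.
  by apply: (@continuous_subspaceT _ _ A id) => x; exact: cvg_id.
move=> B /nbhs_singleton Bp; suff : nbhs p (f @^-1` B) by [].
by case: (@nbhs_subspaceP _ A p) => // _ _ ->.
Qed.

End Topology.

Section CplxTopology.
Variable R : realType.
Local Notation C := (cplx R).

Lemma re_continuous : continuous (@re R).
Proof.
move=> z; have FF : Filter (nbhs z) := nbhs_filter z.
apply/cvgrPdist_lt => e e0.
have /cvgrPdist_lt/(_ (RC e)) : (id : C -> C) @ z --> z by exact: cvg_id.
rewrite gt0_RC !reimE eqxx e0 => /(_ isT); apply: filterS => w.
have <- : re (z - w) = re z - re w by rewrite reD reN.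
move=> H; have := le_lt_trans (normc_ge_Re (z - w)) H.
by rewrite ltcR.
Qed.

Lemma im_continuous : continuous (@im R).
Proof.
have -> : @im R = @re R \o ( *%R (- 'i)).
  by apply/funext => z /=; rewrite !reimE; ring.
move=> z; apply: continuous_comp; last exact: re_continuous.
exact: (@mulrl_continuous C).
Qed.

Lemma cplx_cvg (T : Type) (F : set_system T) (f : T -> C) (l : C) : Filter F ->
  (fun t => re (f t)) @ F --> re l -> (fun t => im (f t)) @ F --> im l -> f @ F --> l.
Proof.
move=> FF /cvgrPdist_lt cr /cvgrPdist_lt ci; apply/cvgrPdist_lt => e.
rewrite gt0_RC => /andP[/eqP ie re0].
have eE : e = RC (re e) by apply: cplx_eq; rewrite !reimE.
have h0 : 0 < re e / 2 by rewrite divr_gt0.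
apply: filterS2 (cr _ h0) (ci _ h0) => t rt it.
rewrite eE.
have -> : l - f t = RC (re l - re (f t)) + 'i * RC (im l - im (f t)).
  by apply: cplx_eq; rewrite !reimE; ring.
have nRC (a : R) : `|RC a : C| = RC `|a| by rewrite /RC normc_def /= expr0n addr0 sqrtr_sqr.
apply: le_lt_trans (ler_normD _ _) _.
rewrite normrM normCi mul1r !nRC -RCD ltcR.
rewrite (splitr (re e)); exact: ltrD.
Qed.

End CplxTopology.

Section FormTopology.
Variables (R : realType) (W : lmodType (cplx R)).
Local Notation C := (cplx R).

Lemma form_ev_continuous (sigma tau : dual W) :
  continuous (fun G : dual_forms W => G sigma tau : C).
Proof.
move=> G; apply: (@continuous_comp _ _ _ (fun q : dual_forms W => q sigma)
  (fun q : {ptws dual W -> C} => q tau)); exact: prod_ev_continuous.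
Qed.

Lemma forms_cvg (F : set_system (dual_forms W)) (G : dual_forms W) : Filter F ->
  (forall sigma tau, (fun G' : dual_forms W => G' sigma tau : C) @ F --> (G sigma tau : C)) ->
  F --> G.
Proof. by move=> FF H; apply: cvg_prod => sigma; apply: cvg_prod => tau; exact: H. Qed.

End FormTopology.

Section SmoothTopology.
Variables (R : realType) (X : topologicalType) (n : nat) (M : complex_atlas R X n).
Local Notation C := (cplx R).
Local Notation Cn := (Cn R n).

Lemma cinfty_cvg (F : set_system (cinfty M)) (u : cinfty M) : Filter F ->
  (forall (c : chart M) vs (K : set Cn) (e : R), compact K -> K `<=` chart_cod c -> 0 < e ->
    \forall w \near F, forall z, K z ->
      `|iterD vs (u \o chart_of c) z - iterD vs (w \o chart_of c) z| < e) ->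
  F --> u.
Proof.
move=> FF H; apply: cvg_initial; apply: cvg_prod => -[c vs].
apply/fam_cvgP => K [cK KW] B /uniform_nbhs[En [entE sB]].
move: entE; rewrite -entourage_ballE => -[e /= e0 eE].
apply: filterS (H c vs K e cK KW e0) => w wK; apply: sB => z Kz; apply: eE; exact: wK.
Qed.

Lemma cinfty_ev_continuous (x : X) : continuous (fun w : cinfty M => w x : R).
Proof.
move=> u; have [c cx] := chart_cover M x.
pose k : chart M * seq Cn := (c, [::]).
have cj : {for u, continuous (fun w : cinfty M => @jets _ _ _ M w k)}.
  apply: (@continuous_comp _ _ _ (@jets _ _ _ M : cinfty M -> _) (fun q => q k)).
    exact: initial_continuous.
  exact: prod_ev_continuous.
have /fam_cvgP/(_ [set chart_to c x]) := cj.
have FF : Filter ((fun w : cinfty M => @jets _ _ _ M w k) @ u) by exact: (fmap_filter _ (nbhs_filter u)).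
rewrite uniform_set1 => H.
have xK : [set K : set Cn | compact K /\ K `<=` chart_cod k.1] [set chart_to c x].
  by split; [exact: compact_set1|move=> _ ->; exact: chart_to_cod].
have := H FF xK; rewrite /jets /= chart_toK // => H' B uB.
have Fu : Filter (nbhs u) := nbhs_filter u.
have := H' B uB; rewrite !nbhs_filterE.
by apply: (@filterS _ _ Fu) => w /=; rewrite chart_toK.
Qed.

End SmoothTopology.

(** * Continuity of the dual Fubini-Study map *)

Section PhiContinuity.
Variables (R : realType) (X : topologicalType) (n : nat).
Variables (M : complex_atlas R X n) (E : line_bundle M) (h : hermitian_metric E).
Local Notation C := (cplx R).
Local Notation Cn := (Cn R n).
Local Notation OE := (hsec E).
Variables (m : nat) (T : OE -> 'rV[C]_m).
Hypothesis Tlin : forall (a : C) u v, T (a *: u + v) = a *: T u + T v.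
Hypothesis Tinj : forall w, T w = 0 -> w = 0.
Variables (N : nat) (b : 'I_N -> OE) (be : 'I_N -> dual OE).
Hypothesis bbe : forall k l, be k (b l) = (k == l)%:R.
Hypothesis spb : forall w, w = \sum_l be l w *: b l.
Hypothesis n_gt0 : (0 < n)%N.

Local Notation AE := (A_E (E := E)).

Lemma form_kappa_frame (G : dual_forms OE) i x (d : dual OE) : A_E (E := E) G -> frame_dom i x ->
  (forall s, d s = coef i s x) -> form_kappa h G x = frame_normsq h i x * re (G d d).
Proof.
move=> AG ix dE; have [r [s [al [nf _ _]]]] := A_E_nf h Tlin Tinj bbe spb n_gt0 AG.
rewrite (nf_kappa_coef h nf ix) nf.2 re_sum; congr (_ * _); apply: eq_bigr => k _.
by rewrite mulr_conj dE.
Qed.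

Let cfp (c : chart M) i k l (z : Cn) : C := coef i (b k) (chart_of c z) * (coef i (b l) (chart_of c z))^*.
Let S (c : chart M) i (G : dual_forms OE) (z : Cn) : R :=
  \sum_k \sum_l (re (G (be k) (be l)) * re (cfp c i k l z) +
                 (- im (G (be k) (be l))) * im (cfp c i k l z)).

Lemma form_kappaE c i (G : dual_forms OE) z : A_E (E := E) G -> frame_chart c i z ->
  form_kappa h G (chart_of c z) = frame_normsq h i (chart_of c z) * S c i G z.
Proof.
move=> AG [cz iz]; have [d dE] := coef_dual iz; rewrite (form_kappa_frame AG iz dE); congr (_ * _).
rewrite (form_expand spb d d (A_E_ip AG).1) re_sum; apply: eq_bigr => k _.
rewrite re_sum; apply: eq_bigr => l _; rewrite !dE reM -/(cfp c i k l z) mulrC.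
by congr (_ + _); rewrite mulrC mulNr.
Qed.

Section Family.
Variables (P : topologicalType) (Q : set P) (g : P -> dual_forms OE).
Hypothesis oQ : open Q.
Hypothesis gA : forall p, Q p -> AE (g p).
Hypothesis gcont : forall sigma tau p, Q p -> {for p, continuous (fun q => g q sigma tau : C)}.

(** Locally log kappa is log h(e, e) plus the logarithm of a finite sum of real
    and imaginary parts of the G(be_k, be_l), continuous in the parameter,
    times smooth functions of z. *)
Lemma Phi_smooth_family c i :
  smooth_family Q (@frame_chart _ _ _ _ E c i) (fun p z => Phi h (g p) (chart_of c z)).
Proof.
move=> k; have oW := @frame_chart_open _ _ _ _ E c i.
have S0 G z : AE G -> frame_chart c i z -> 0 < S c i G z.
  move=> AG Wz; have [k0 _] := Phi_form_kappa h Tlin Tinj bbe spb n_gt0 AG.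
  have := k0 (chart_of c z); rewrite (form_kappaE AG Wz) pmulr_rgt0 //; exact: (herm_frame h Wz.2).2.
apply: (@Ck_family_eq _ _ _ _ _ oQ oW _
    (fun p z => ln (frame_normsq h i (chart_of c z)) + ln (S c i (g p) z))) => [p z Qp Wz|].
  have AG := gA Qp; have [k0 ->] := Phi_form_kappa h Tlin Tinj bbe spb n_gt0 AG.
  rewrite (form_kappaE AG Wz) lnM ?posrE ?S0 //; exact: (herm_frame h Wz.2).2.
apply: (Ck_familyD oQ oW).
  by apply: Ck_family_smooth_on; exact: ln_frame_normsq_smooth.
apply: (Ck_family_ln oQ oW) => [p z Qp Wz|]; first by apply: S0 => //; exact: gA.
move: k; apply: (smooth_family_sum oQ oW) => k; apply: (smooth_family_sum oQ oW) => l j.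
have cB : csmooth (frame_chart c i) (cfp c i k l).
  by apply: (csmoothM oW); [|apply: (csmoothJ oW)]; apply: hol_csmooth; exact: coef_hol.
have cG (f : C -> R) : continuous f -> forall p, Q p ->
    {for p, continuous (fun q => f (g q (be k) (be l)))}.
  by move=> coef p Qp; apply: continuous_comp; [exact: gcont|exact: coef].
apply: (Ck_familyD oQ oW); apply: (Ck_familyM oQ oW).
- by apply: (Ck_family_cst oQ oW); apply: cG; exact: re_continuous.
- by apply: Ck_family_smooth_on; case: cB.
- apply: (Ck_family_cst oQ oW); apply: (cG (fun a => - im a)).
  move=> a; apply: (@continuous_comp _ _ _ (@im R) (fun x => - x)); first exact: im_continuous.
  exact: opp_continuous.
- by apply: Ck_family_smooth_on; case: cB.
Qed.

(** Joint continuity of each derivative at (p, z) controls it near z uniformly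
    for parameters near p; compactness of K makes the neighbourhood of p
    independent of z. *)
Lemma Phi_cvg p : Q p -> (fun q => Phi h (g q)) @ p --> Phi h (g p).
Proof.
move=> Qp; apply: cinfty_cvg => c vs K e cK KW e0.
apply: (proj1 (compact_near_coveringP K) cK _ (nbhs p)
  (fun q z => `|iterD vs (Phi h (g p) \o chart_of c) z - iterD vs (Phi h (g q) \o chart_of c) z| < e)).
move=> z Kz; have [i iz] := frame_cover E (chart_of c z).
have Wz : frame_chart c i z by split=> //; exact: KW.
have jc := Ck_family_jcont (smooth_family_iterD vs (Phi_smooth_family c i) 0) Qp Wz.
have e2 : 0 < e / 2 by rewrite divr_gt0.
have [[A B] /= [Ap Bz] AB] := (@cvgrPdist_lt _ _ _ _ _ _ _).1 jc _ e2.
exists (B, A) => //= -[z' q] /= [Bz' Aq].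
have h1 := AB (p, z') (conj (nbhs_singleton Ap) Bz').
have h2 := AB (q, z') (conj Aq Bz').
rewrite (splitr e); apply: le_lt_trans _ (ltrD h1 h2).
rewrite [X in _ <= X + _]distrC; exact: ler_distD.
Qed.

End Family.

Lemma Phi_continuous : {within AE, continuous (Phi h)}.
Proof.
apply: continuous_within_family => P Q g oQ gA cg p Qp; apply: (Phi_cvg oQ gA) => // sigma tau q Qq.
apply: (@continuous_comp _ _ _ g (fun G : dual_forms OE => G sigma tau : C)); first exact: cg.
exact: form_ev_continuous.
Qed.

End PhiContinuity.

(** * Limits along ultrafilters *)

Section Ultra.
Variables (T : Type) (F : set_system T).
Context {FU : UltraFilter F}.

Lemma ultra_fmap (S : Type) (f : T -> S) : UltraFilter (f @ F).
Proof.
split=> [|G PG FG]; first exact: fmap_proper_filter.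
apply/seteqP; split=> // B GB; have [//|nB] := in_ultra_setVsetC (f @^-1` B) FU.
have GnB : G (~` B) by apply: FG.
by have [] := @filter_not_empty _ G PG; rewrite -(setICr B); exact: filterI.
Qed.

Lemma ultra_bounded_cvg (R : realType) (f : T -> R) (c : R) :
  (\forall t \near F, `|f t| <= c) -> exists l : R, f @ F --> l.
Proof.
move=> bf; have := @segment_compact R (- c) c; rewrite compact_ultra => H.
have [|l [_ fl]] := H (f @ F) (ultra_fmap f); last by exists l.
apply: filterS bf => t; rewrite /= in_itv /= => ft; rewrite -ler_norml //.
Qed.

End Ultra.

Section CplxLimits.
Variables (T : Type) (F : set_system T) (R : realType).
Context {FF : ProperFilter F}.
Local Notation C := (cplx R).
Implicit Types f g : T -> C.

Lemma cvg_re f l : f @ F --> l -> (fun t => re (f t)) @ F --> re l.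
Proof. exact: (fun fl => @cvg_comp _ _ _ f (@re R) F (nbhs l) (nbhs (re l)) fl (@re_continuous R l)). Qed.

Lemma cvg_im f l : f @ F --> l -> (fun t => im (f t)) @ F --> im l.
Proof. exact: (fun fl => @cvg_comp _ _ _ f (@im R) F (nbhs l) (nbhs (im l)) fl (@im_continuous R l)). Qed.

Lemma cvg_near (U : topologicalType) (f g : T -> U) (l : U) : f @ F --> l ->
  (\forall t \near F, f t = g t) -> g @ F --> l.
Proof.
by move=> fl fg; apply: cvg_trans fl; apply: near_eq_cvg; apply: filterS fg.
Qed.

Lemma cplx_cvg_unique f g (l l' : C) :
  f @ F --> l -> g @ F --> l' -> (\forall t \near F, f t = g t) -> l = l'.
Proof.
move=> fl gl fg; apply: cplx_eq.
  apply: (@cvg_unique _ (@Rhausdorff R) _ _ _ _ (cvg_re (cvg_near fl fg)) (cvg_re gl)).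
exact: (@cvg_unique _ (@Rhausdorff R) _ _ _ _ (cvg_im (cvg_near fl fg)) (cvg_im gl)).
Qed.

Lemma cvg_conj f l : f @ F --> l -> (fun t => (f t)^*) @ F --> l^*.
Proof.
move=> fl; apply: cplx_cvg.
  by rewrite reJ; apply: (cvg_near (cvg_re fl)); apply: nearW => t; rewrite reJ.
have ci : (fun t => - im (f t)) @ F --> - im l by apply: cvgN; exact: cvg_im fl.
by rewrite imJ; apply: (cvg_near ci); apply: nearW => t; rewrite imJ.
Qed.

Lemma cvg_lin f g (a l l' : C) : f @ F --> l -> g @ F --> l' ->
  (fun t => a * f t + g t) @ F --> a * l + l'.
Proof.
move=> fl gl; have [rf mf] := (cvg_re fl, cvg_im fl); have [rg mg] := (cvg_re gl, cvg_im gl).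
have cM (c : R) (k : T -> R) (q : R) : k @ F --> q -> (fun t => c * k t) @ F --> c * q.
  by move=> kq; apply: cvgM => //; exact: cvg_cst.
apply: cplx_cvg.
  have H : (fun t => re a * re (f t) - im a * im (f t) + re (g t)) @ F -->
      re a * re l - im a * im l + re l'.
    by apply: cvgD => //; apply: cvgB; exact: cM.
  by rewrite reD reM; apply: (cvg_near H); apply: nearW => t; rewrite reD reM.
have H : (fun t => re a * im (f t) + im a * re (f t) + im (g t)) @ F -->
    re a * im l + im a * re l + im l'.
  by apply: cvgD => //; apply: cvgD; exact: cM.
by rewrite imD imM; apply: (cvg_near H); apply: nearW => t; rewrite imD imM.
Qed.

End CplxLimits.

(** * Limits of semidefinite forms *)

Section Main.
Variables (R : realType) (X : topologicalType) (n : nat).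
Variables (M : complex_atlas R X n) (E : line_bundle M) (h : hermitian_metric E).
Local Notation C := (cplx R).
Local Notation OE := (hsec E).
Variables (m : nat) (T : OE -> 'rV[C]_m).
Hypothesis Tlin : forall (a : C) u v, T (a *: u + v) = a *: T u + T v.
Hypothesis Tinj : forall w, T w = 0 -> w = 0.
Variables (N : nat) (b : 'I_N -> OE) (be : 'I_N -> dual OE).
Hypothesis bbe : forall k l, be k (b l) = (k == l)%:R.
Hypothesis spb : forall w, w = \sum_l be l w *: b l.
Hypothesis n_gt0 : (0 < n)%N.
Local Notation AE := (A_E (E := E)).

(** A linear map that projects the dual along V composed with evaluation at b_j
    is itself evaluation at some section, by finite dimension. That section is
    killed by all the ev_x, hence is 0. *)
Lemma ev_span (V : set (dual OE)) : subspace V -> (forall x, V (ev E x)) -> forall sigma, V sigma.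
Proof.
move=> sV Vev sigma.
have T'lin (a : C) (s t : dual OE) :
    \row_l (a *: s + t) (b l) = a *: (\row_l s (b l)) + \row_l t (b l) :> 'rV[C]_N.
  by apply/rowP => l; rewrite !mxE.
have T'inj (s : dual OE) : \row_l s (b l) = 0 :> 'rV[C]_N -> s = 0.
  move=> /rowP s0; rewrite (dual_expand spb s) big1 // => l _.
  by have := s0 l; rewrite !mxE => ->; rewrite scale0r.
have [r [v [g [Vv gv sp]]]] := subspace_dual_basis T'lin T'inj sV.
have pj j : sigma (b j) = \sum_l g l sigma * v l (b j).
  have lf (a : C) (s t : dual OE) :
      (a *: s + t) (b j) - \sum_l g l (a *: s + t) * v l (b j) =
      a * (s (b j) - \sum_l g l s * v l (b j)) + (t (b j) - \sum_l g l t * v l (b j)).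
    rewrite -[(a *: s + t) (b j)]/(a * s (b j) + t (b j)) mulrBr addrACA -opprD; congr (_ - _).
    by rewrite mulr_sumr -big_split; apply: eq_bigr => l _ /=; rewrite dual_lin mulrDl mulrA.
  have [f fE] := dual_of lf.
  pose s := \sum_i f (be i) *: b i.
  have sE (rho : dual OE) : rho s = f rho.
    rewrite [in RHS](dual_expand spb rho) !dual_sum; apply: eq_bigr => i _.
    by rewrite !dualZ mulrC.
  have s0 : s = 0.
    by apply: ev_separates => x; rewrite sE fE [in X in X - _](sp _ (Vev x)) dual_sumE subrr.
  by apply/eqP; rewrite -subr_eq0 -fE -sE s0 dual_0.
suff -> : sigma = \sum_l g l sigma *: v l by exact: subspace_sum.
apply: dual_inj => w; rewrite (spb w) !dual_sum; apply: eq_bigr => j _.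
by rewrite !dualZ pj dual_sumE.
Qed.

Section UltraLimit.
Variable F : set_system (dual_forms OE).
Context {FU : UltraFilter F}.
Hypothesis Fip : \forall G \near F, inner_product setT (G : dual OE -> dual OE -> C) /\
  possemidef setT (G : dual OE -> dual OE -> C).
Variable k : X -> R.
Hypothesis Fk : forall x, (fun G : dual_forms OE => re (G (ev E x) (ev E x))) @ F --> k x.

Definition converges sigma tau :=
  exists l : C, (fun G : dual_forms OE => G sigma tau : C) @ F --> l.

(** By the Cauchy-Schwarz inequality G(ev_x, ev_y) is bounded by the diagonal
    values, which converge; bounded functions converge along an ultrafilter. *)
Lemma converges_ev x y : converges (ev E x) (ev E y).
Proof.
have bd z : \forall G \near F, re (G (ev E z) (ev E z)) <= k z + 1.
  have /cvgrPdist_lt/(_ _ ltr01) := @Fk z; apply: filterS => G.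
  by rewrite ltr_norml => /andP[h1 h2]; lra.
have bG : \forall G \near F, sqn (G (ev E x) (ev E y)) <= (k x + 1) * (k y + 1).
  apply: filterS3 Fip (bd x) (bd y) => G [iG pG] bx by'.
  have cs := cauchy_schwarz (@subspaceT R (dual OE)) iG pG (u := ev E x) (v := ev E y) I I.
  have pos z : 0 <= re (G (ev E z) (ev E z)).
    by have := pG (ev E z) I; rewrite ge0_RC => /andP[].
  by apply: le_trans cs _; apply: ler_pM => //; exact: pos.
have sqb (a d c : R) : a * a + d * d <= c -> `|a| <= c + 1 /\ `|d| <= c + 1.
  by move=> ac; rewrite !ler_norml; split; apply/andP; split; nra.
have [lr Lr] := ultra_bounded_cvg (f := fun G : dual_forms OE => re (G (ev E x) (ev E y)))
  (filterS (fun G bG => (sqb _ _ _ bG).1) bG).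
have [li Li] := ultra_bounded_cvg (f := fun G : dual_forms OE => im (G (ev E x) (ev E y)))
  (filterS (fun G bG => (sqb _ _ _ bG).2) bG).
by exists (Complex lr li); exact: cplx_cvg.
Qed.

Lemma near_form (P : dual_forms OE -> Prop) :
  (forall G, inner_product setT (G : dual OE -> dual OE -> C) ->
    possemidef setT (G : dual OE -> dual OE -> C) -> P G) -> \forall G \near F, P G.
Proof. by move=> H; apply: filterS Fip => G [iG pG]; exact: H. Qed.

(** The functionals sigma such that G(sigma, tau) converges form a subspace, so
    convergence spreads from the ev_x to the whole dual, first in one variable
    and then, by hermitian symmetry, in the other. *)
Lemma converges_all sigma tau : converges sigma tau.
Proof.
have cl (tau' : dual OE) : (forall x, converges (ev E x) tau') -> forall s, converges s tau'.
  move=> H; apply: ev_span => //; split=> [|a u v [l Hl] [l' Hl']].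
    exists 0; apply: (cvg_near (cvg_cst 0)); apply: near_form => G iG _; apply/esym.
    have := ip_suml (V := setT) [::] (fun _ : nat => 0) (v := fun _ : nat => 0) (w := tau')
      (@subspaceT R (dual OE)) iG (fun=> I) I.
    by rewrite !big_nil => ->.
  exists (a * l + l'); apply: (cvg_near (cvg_lin (a := a) Hl Hl')).
  by apply: near_form => G iG _; rewrite iG.1.
have sw s t : converges s t -> converges t s.
  move=> [l Hl]; exists (l^*); apply: (cvg_near (cvg_conj Hl)).
  by apply: near_form => G iG _; rewrite (iG.2 s t).
by apply: (cl tau) => x; apply: sw; apply: (cl (ev E x)) => y; exact: converges_ev.
Qed.

Lemma ultra_form_limit : exists G : dual_forms OE, [/\ F --> G,
  inner_product setT (G : dual OE -> dual OE -> C), possemidef setT (G : dual OE -> dual OE -> C) &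
  forall x, re (G (ev E x) (ev E x)) = k x].
Proof.
pose G : dual_forms OE := fun s t => projT1 (cid (converges_all s t)).
have GE s t : (fun G' : dual_forms OE => G' s t : C) @ F --> (G s t : C).
  by rewrite /G; case: cid.
exists G; split.
- exact: forms_cvg.
- split=> [a u v w _ _ _|u v _ _].
    apply: (cplx_cvg_unique (@GE _ _) (cvg_lin (a := a) (@GE u w) (@GE v w))).
    by apply: near_form => G' iG _; rewrite iG.1.
  apply: (cplx_cvg_unique (@GE _ _) (cvg_conj (@GE u v))).
  by apply: near_form => G' iG _; rewrite iG.2.
- move=> u _; rewrite ge0_RC; apply/andP; split.
    apply/eqP.
    have ci := cvg_im (@GE u u).
    apply: (@cvg_unique _ (@Rhausdorff R) _ _ _ _ ci).
    apply: (cvg_near (cvg_cst (0 : R))); apply: near_form => G' _ pG.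
    by have := pG u I; rewrite ge0_RC => /andP[/eqP ->].
  have cr := cvg_re (@GE u u).
  rewrite leNgt; apply/negP => lt0.
  have [G' [lt0' ge0']] : exists G' : dual_forms OE, re (G' u u) < 0 /\ 0 <= re (G' u u).
    apply: (@filter_ex _ F _); apply: filterI; first exact: (cvgr_lt _ cr _ lt0).
    by apply: near_form => G' _ pG; have := pG u I; rewrite ge0_RC => /andP[].
  by have := lt_le_trans lt0' ge0'; rewrite ltxx.
- move=> x; have cr := cvg_re (@GE (ev E x) (ev E x)).
  exact: (@cvg_unique _ (@Rhausdorff R) _ _ _ _ cr (@Fk x)).
Qed.

End UltraLimit.

(** * Properness and the closure of the image *)

Section Conclusion.
Variable omega : form11 M.
Hypothesis omega_curv : curvature h omega.

(** Convergence of log kappa in the smooth topology is used only through its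
    values at points; that the limit is in H_omega is what keeps the limit form
    in A_E. *)
Lemma A_E_ultra_limit (F : set_system (dual_forms OE)) (u : cinfty M) : UltraFilter F -> F AE ->
  Phi h @ F --> u -> H_omega omega u -> exists G, [/\ F --> G, AE G & Phi h G = u].
Proof.
move=> FU FA Fu Hu.
have Fip : \forall G \near F, inner_product setT (G : dual OE -> dual OE -> C) /\
    possemidef setT (G : dual OE -> dual OE -> C).
  by apply: filterS FA => G; exact: A_E_ip.
have Fk x : (fun G : dual_forms OE => re (G (ev E x) (ev E x))) @ F --> expR (u x) / ev_normsq h x.
  have c1 : (fun G => Phi h G x) @ F --> (u x : R) :=
    @cvg_comp _ _ _ (Phi h) (fun w : cinfty M => w x : R) F (nbhs u) (nbhs (u x)) Fu
      (@cinfty_ev_continuous _ _ _ M x u).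
  have c2 :=
    @cvg_comp _ _ _ (fun G => Phi h G x) (@expR R) F (nbhs (u x : R)) (nbhs (expR (u x))) c1
      (@continuous_expR R (u x)).
  have c3 : (fun G => expR (Phi h G x) / ev_normsq h x) @ F --> expR (u x) / ev_normsq h x.
    by apply: cvgM => //; exact: cvg_cst.
  apply: (cvg_near c3); apply: filterS FA => G AG.
  have [k0 ->] := Phi_form_kappa h Tlin Tinj bbe spb n_gt0 AG.
  rewrite lnK ?posrE // /form_kappa mulrAC mulfV ?mul1r //; exact: lt0r_neq0 (ev_normsq_gt0 h x).
have [G [FG iG pG Gk]] := ultra_form_limit Fip Fk.
have kE x : form_kappa h G x = expR (u x).
  by rewrite /form_kappa Gk mulrC divfK //; exact: lt0r_neq0 (ev_normsq_gt0 h x).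
by have [AG PG] := bergman_H_omega bbe spb omega_curv iG pG Hu kE; exists G.
Qed.

Lemma Phi_proper : proper_map AE (H_omega omega) (Phi h).
Proof.
split; first exact: (Phi_continuous Tlin Tinj bbe spb n_gt0).
  by move=> _ [G AG <-]; exact: (Phi_H_omega Tlin Tinj bbe spb n_gt0 omega_curv AG).
move=> K KH; rewrite !compact_ultra => cK F FU FAK.
have FK : (Phi h @ F) K by apply: (@filterS _ F _ _ _ _ FAK) => G [].
have FA : F AE by apply: (@filterS _ F _ _ _ _ FAK) => G [].
have [u [Ku Fu]] := cK _ (ultra_fmap (Phi h)) FK.
have [G [FG AG GE]] := A_E_ultra_limit FU FA Fu (KH u Ku).
by exists G; split=> //; split=> //=; rewrite GE.
Qed.

Hypothesis E_very_ample : very_ample E.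

Definition l2_form : dual_forms OE := fun sigma tau => \sum_i sigma (b i) * (tau (b i))^*.

(** A definite form as soon as G is semidefinite and e > 0. *)
Definition perturb (G : dual_forms OE) (e : R) : dual_forms OE :=
  fun sigma tau => G sigma tau + RC e * l2_form sigma tau.

Lemma perturb_cvg G : (fun k => perturb G (harmonic k)) @ \oo --> G.
Proof.
apply: forms_cvg => s t.
suff : (fun k => perturb G (harmonic k) s t) @ \oo --> (G s t : C) by [].
apply: cplx_cvg.
  have -> : re (G s t) = re (G s t) + 0 * re (l2_form s t) by rewrite mul0r addr0.
  under eq_fun do rewrite /perturb reD reM re_RC im_RC mul0r subr0.
  apply: cvgD; first exact: cvg_cst.
  by apply: cvgM; [exact: cvg_harmonic|exact: cvg_cst].
have -> : im (G s t) = im (G s t) + 0 * im (l2_form s t) by rewrite mul0r addr0.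
under eq_fun do rewrite /perturb imD imM re_RC im_RC mul0r addr0.
apply: cvgD; first exact: cvg_cst.
by apply: cvgM; [exact: cvg_harmonic|exact: cvg_cst].
Qed.

Lemma perturb_inner G e : inner_product setT (G : dual OE -> dual OE -> C) ->
  inner_product setT (perturb G e : dual OE -> dual OE -> C).
Proof.
move=> [il ih]; split=> [a u v w _ _ _|u v _ _].
  rewrite /perturb il //.
  have -> : l2_form (a *: u + v) w = a * l2_form u w + l2_form v w.
    rewrite /l2_form mulr_sumr -big_split; apply: eq_bigr => i _ /=.
    by rewrite mulrDl mulrA.
  by ring.
rewrite /perturb ih // rmorphD rmorphM /=.
have -> : (RC e : C)^* = RC e by apply: cplx_eq; rewrite ?reJ ?imJ ?im_RC ?oppr0.
congr (_ + _ * _); rewrite /l2_form rmorph_sum; apply: eq_bigr => i _ /=.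
by rewrite conjM conjCK mulrC.
Qed.

Lemma perturb_posdef G e : possemidef setT (G : dual OE -> dual OE -> C) -> 0 < e ->
  posdef setT (perturb G e : dual OE -> dual OE -> C).
Proof.
move=> pG e0 s _ s0; rewrite /perturb; apply: ltr_wpDl; first exact: pG.
apply: mulr_gt0; first by rewrite gt0_RC !reimE eqxx.
have -> : l2_form s s = RC (\sum_i sqn (s (b i))).
  by rewrite RC_sum; apply: eq_bigr => i _; rewrite mulr_conj.
rewrite gt0_RC !reimE eqxx /= lt0r sumr_ge0 ?andbT => [|i _]; last exact: sqn_ge0.
apply: contraNneq s0 => /eqP; rewrite psumr_eq0 => [/allP S0|i _]; last exact: sqn_ge0.
apply/eqP; rewrite [LHS](dual_expand spb s) big1 // => i _.
have /= := S0 i (mem_index_enum i); rewrite sqn_eq0 => /eqP si.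
exact: etrans (congr1 (fun a : C => a *: be i) si) (scale0r _).
Qed.

Lemma closure_FS : closure (FS h @` H_E (E:=E)) `&` H_omega omega = Phi h @` AE.
Proof.
apply/seteqP; split=> [u [cu Hu]|_ [G AG <-]].
  (* The preimages of the neighbourhoods of u meet A_E, so they generate a proper
     filter on forms; any ultrafilter finer than it has a limit. *)
  pose D B := [set G : dual_forms OE | AE G /\ B (Phi h G)].
  pose F0 := filter_from (nbhs (u : cinfty M)) D.
  have PF0 : ProperFilter F0.
    apply: filter_from_proper => [|B uB].
      apply: filter_from_filter; first by exists setT; exact: filterT.
      move=> A B uA uB; exists (A `&` B); first exact: filterI.
      by move=> G [AG [AB BB]]; split; split.
    have [_ [[ip Hip <-] Bip]] := cu B uB.
    exists (delta setT ip); split; first exact: (deltaT_A_E Tlin Tinj E_very_ample Hip).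
    by rewrite -(FS_Phi h Tlin Tinj bbe spb n_gt0 E_very_ample Hip).
  have [F [FU F0F]] := ultraFilterLemma PF0.
  have FA : F AE by apply: F0F; exists setT; [exact: filterT|move=> G []].
  have Fu : Phi h @ F --> u by move=> B uB; apply: F0F; exists B => // G [].
  by have [G [_ AG GE]] := A_E_ultra_limit FU FA Fu Hu; exists G.
split; last exact: (Phi_H_omega Tlin Tinj bbe spb n_gt0 omega_curv AG).
move=> B GB; have [iG pG] := A_E_ip AG.
have /subspace_continuousP/(_ G AG) := Phi_continuous (h := h) Tlin Tinj bbe spb n_gt0.
move=> /(_ B GB) nB; have := perturb_cvg nB => nn.
have [k /= Bk] := @filter_ex _ \oo _ _ nn.
have e0 : 0 < harmonic k :> R by exact: harmonic_gt0.
have [AGk FGk] := definite_form_FS h Tlin Tinj bbe spb n_gt0 E_very_ample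
  (perturb_inner (harmonic k) iG) (perturb_posdef pG e0).
by exists (Phi h (perturb G (harmonic k))); split=> //; exact: Bk.
Qed.

End Conclusion.

End Main.

Theorem theorem6p4 (R : realType) (X : topologicalType) (n : nat)
    (M : complex_atlas R X n) (E : line_bundle M) (h : hermitian_metric E)
    (omega : form11 M) (n_gt0 : (0 < n)%N)
    (X_hausdorff : hausdorff_space X) (X_compact : compact [set: X])
    (X_connected : connected [set: X])
    (E_very_ample : very_ample E) (omega_curv : curvature h omega) :
  [/\ proper_map (A_E (E:=E)) (H_omega omega) (Phi h),
      {in A_E (E:=E) &, injective (Phi h)} &
      closure (FS h @` H_E (E:=E)) `&` H_omega omega = Phi h @` A_E (E:=E)].
Proof.
have [m [T [Tlin Tinj]]] := sections_finite_dim h X_compact.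
have [N [b [be [_ bbe spb]]]] := subspace_dual_basis Tlin Tinj (@subspaceT R (hsec E)).
have {}spb w : w = \sum_l be l w *: b l by exact: spb.
split.
- exact: (Phi_proper Tlin Tinj bbe spb n_gt0 omega_curv).
- exact: (Phi_injective Tlin Tinj bbe spb n_gt0 X_connected).
- exact: (closure_FS Tlin Tinj bbe spb n_gt0 omega_curv E_very_ample).
Qed.
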